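(* Let $\xi$ be a non-negative integer-valued random variable with $\mathbb E\xi=1$ and $0<\operatorname{Var}\xi<\infty$. If $\mathbb E\xi^k<\infty$ for an integer $k\ge3$, then $\mu(\alpha)$ can be continued as a meromorphic function in $\operatorname{Re}\alpha<\frac{k-1}2$ with simple poles at $\{\frac12,\frac32,\frac52,\dots\}$ (or possibly a subset of these points) and no other poles.
   Context: Let $\mathcal T$ be the Galton--Watson tree with offspring distribution $\xi$ (each node has a number of children that is an independent copy of $\xi$), and $|\mathcal T|$ its (a.s. finite) number of nodes. For $\operatorname{Re}\alpha<\frac12$, $\mu(\alpha):=\mathbb E|\mathcal T|^\alpha=\sum_{n\ge1}n^\alpha\,\mathbb P(|\mathcal T|=n)$, which is an analytic function in this half-plane. *)

(* Defs.v *)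
From HB Require Import structures.
From mathcomp Require Export all_boot all_order all_algebra.
From mathcomp Require Export all_classical all_reals all_analysis.
From mathcomp Require Export complex.
Set Implicit Arguments.
Unset Strict Implicit.
Unset Printing Implicit Defensive.
Import Order.TTheory GRing.Theory Num.Theory.
Import numFieldNormedType.Exports.
Local Open Scope classical_set_scope.
Local Open Scope ring_scope.
Local Open Scope complex_scope.

(* The topology and normed-module structure of C over itself are carried by
   the regular algebra (R[i])^o, which is convertible to R[i]. *)
Notation CC R := ((complex (Real.sort R))^o) (only parsing).

Section complex_functions.
Variable R : realType.

Definition complex_differentiable (f : R[i] -> R[i]) (z : R[i]) : Prop :=
  derivable (f : CC R -> CC R) (z : CC R) 1.

Definition holomorphic_at (f : R[i] -> R[i]) (z : R[i]) : Prop :=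
  \forall w \near (z : CC R), complex_differentiable f w.

Definition pole_of_order (m : nat) (f : R[i] -> R[i]) (z : R[i]) : Prop :=
  (0 < m)%N /\
  exists g : R[i] -> R[i],
    [/\ holomorphic_at g z, g z != 0 &
        \forall w \near (z : CC R)^', f w = g w / (w - z) ^+ m].

Definition pole (f : R[i] -> R[i]) (z : R[i]) : Prop :=
  exists m, pole_of_order m f z.

Definition simple_pole (f : R[i] -> R[i]) (z : R[i]) : Prop :=
  pole_of_order 1 f z.

(* The value of f at a pole is irrelevant; removable singularities in U have
   to be filled in. *)
Definition meromorphic_on (U : set R[i]) (f : R[i] -> R[i]) : Prop :=
  forall z, U z -> holomorphic_at f z \/ pole f z.

Definition cexp (z : R[i]) : R[i] :=
  (expR (complex.Re z))%:C * (cos (complex.Im z) +i* sin (complex.Im z)).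

(* n ^ a = exp (a log n); only used for n >= 1 (ln 0 is a default value). *)
Definition npow (n : nat) (a : R[i]) : R[i] := cexp (a * (ln n%:R)%:C).

End complex_functions.

Section galton_watson.
Context d (T : measurableType d) (R : realType) (P : probability T R).

Definition mutually_independent (I : choiceType) d' (T' : measurableType d')
    (X : I -> {RV P >-> T'}) : Prop :=
  forall (s : seq I) (A : I -> set T'),
    uniq s -> (forall i, measurable (A i)) ->
    P (\bigcap_(i in [set` s]) X i @^-1` A i) =
      (\prod_(i <- s) P (X i @^-1` A i))%E.

(* Ulam-Harris encoding: a node is the word of child indices on the path from
   the root [::]; c v is the number of children of v, and v has the children
   rcons v i for i < c v. *)
Definition gw_tree (c : seq nat -> nat) : set (seq nat) :=
  [set u | forall j, (j < size u)%N -> (nth 0%N u j < c (take j u))%N].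

Definition gw_size_prob (X : seq nat -> {RV P >-> nat}) (n : nat) : R :=
  fine (P [set w | (gw_tree (fun u => X u w) #= `I_n)%card]).

Definition mu_partial_sum (X : seq nat -> {RV P >-> nat}) (a : R[i])
    : nat -> CC R :=
  fun N => \sum_(1 <= n < N) npow n a * (gw_size_prob X n)%:C.

Definition mu (X : seq nat -> {RV P >-> nat}) (a : R[i]) : R[i] :=
  limn (mu_partial_sum X a).

End galton_watson.

(* Main.v *)
From HB Require Import structures.
From mathcomp Require Import finmap.
Require Import Defs.
From mathcomp Require Import measurable_realfun ring lra zify.
Set Implicit Arguments.
Unset Strict Implicit.
Unset Printing Implicit Defensive.
Import Order.TTheory GRing.Theory Num.Theory.
Import numFieldNormedType.Exports.
Local Open Scope classical_set_scope.
Local Open Scope ring_scope.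
Local Open Scope complex_scope.

(** Write pi_n = P(|T| = n) and Y(t) = sum_n pi_n e^{-nt} for t > 0. Euler's
    integral expresses n^a through the exponentials e^{-nt}, so mu(a) is,
    up to a Gamma factor, a Mellin transform of Y, and the continuation of a
    Mellin transform is governed by the behaviour of the function as t -> 0.

    The generating function satisfies Y = e^{-t} phi(Y), where phi is the
    generating function of the offspring law (gw_generating_eq). It comes from
    an exact sum over plane trees: the probability that the tree has a given
    finite shape is a product of offspring probabilities, because that event
    only prescribes the degrees of finitely many nodes. Since phi'(1) = 1 and
    phi''(1) > 0, the equation for x = 1 - Y reads
    (e^t - 1)(1 - x) = x^2 (A_0 + A_1 x + ...) + O(x^k) with A_0 > 0, where the
    moment of order k gives the Taylor expansion of phi at 1. Solving for x in
    powers of s = sqrt t yields Y = e^{-t} + s D(s) + O(s^{k-1}) with D a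
    polynomial (puiseux_expansion).

    With t = e^{-u} the Mellin transform becomes the two-sided Laplace
    transform laplace, taken over the real line, and e^{-nt} becomes a translate
    of gumbel u = exp(-e^{-u}), whose transform at b is Gamma(-b). One
    integration by parts gives
      n^a Gamma(1-a) = Gamma(1-a) - a laplace (gumbel_diff (ln n)) a
    for Re a < 1, and summing over n, by dominated convergence,
      mu(a) = 1 - a laplace psi a / Gamma(1-a),  psi = Y - e^{-t},
    for Re a < 1/2 (mu_formula). By the expansion, psi is a combination of the
    functions e^{-ju/2} on u >= 0, whose transforms are 1/(j/2 - a), plus a
    remainder whose transform is holomorphic for Re a < (k-1)/2. The numbers
    j/2 are therefore the only candidates for poles, and they are simple. The
    integers among them are removed by the zeros of 1/Gamma(1-a), and
    1/Gamma has no poles since Gamma does not vanish (gammaN_neq0). *)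

(** * Plane forests and the law of the tree *)

(** A plane tree is the forest of the subtrees at its root, so the same
    inductive type, in the style of first child and next sibling, describes
    forests and, through the children of an added root, trees. *)
Inductive forest := fnil | fcons (children siblings : forest).

Fixpoint forest_code (F : forest) : GenTree.tree unit :=
  match F with
  | fnil => GenTree.Node 0 [::]
  | fcons a s => GenTree.Node 1 [:: forest_code a; forest_code s]
  end.

Fixpoint forest_decode (t : GenTree.tree unit) : option forest :=
  match t with
  | GenTree.Node 1 [:: a; s] =>
      if forest_decode a is Some a' then
        if forest_decode s is Some s' then Some (fcons a' s') else None
      else None
  | _ => Some fnil
  end.

Lemma forest_codeK : pcancel forest_code forest_decode.
Proof. by elim=> //= a -> s ->. Qed.

HB.instance Definition _ := Countable.copy forest (pcan_type forest_codeK).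

Fixpoint nroots (F : forest) : nat :=
  if F is fcons _ s then (nroots s).+1 else 0.

Fixpoint nnodes (F : forest) : nat :=
  if F is fcons a s then (nnodes a + nnodes s).+1 else 0.

(** Nodes with their numbers of children, in Ulam-Harris words; pre is the word
    of the common parent of the roots and i the position of the first root. *)
Fixpoint degrees (pre : seq nat) (i : nat) (F : forest) : seq (seq nat * nat) :=
  if F is fcons a s then
    (rcons pre i, nroots a) :: degrees (rcons pre i) 0 a ++ degrees pre i.+1 s
  else [::].

(** F seen as the tree whose root carries the forest F. *)
Definition tree_degrees (F : forest) : seq (seq nat * nat) :=
  ([::], nroots F) :: degrees [::] 0 F.

Definition subtree (c : seq nat -> nat) (i : nat) : seq nat -> nat :=
  fun u => c (i :: u).

Fixpoint agree (c : seq nat -> nat) (i : nat) (F : forest) : Prop :=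
  if F is fcons a s then
    [/\ c [:: i] = nroots a, agree (subtree c i) 0 a & agree c i.+1 s]
  else True.

Definition tree_is (c : seq nat -> nat) (F : forest) : Prop :=
  c [::] = nroots F /\ agree c 0 F.

Lemma degrees_cons j pre i F :
  degrees (j :: pre) i F = [seq (j :: x.1, x.2) | x <- degrees pre i F].
Proof.
elim: F pre i => //= a IHa s IHs pre i.
by rewrite map_cat IHa IHs.
Qed.

Lemma size_degrees pre i F : size (degrees pre i F) = nnodes F.
Proof.
by elim: F pre i => //= a IHa s IHs pre i; rewrite size_cat IHa IHs.
Qed.

(** Having a given shape amounts to finitely many conditions c u = d at
    distinct nodes u, which is the form independence of the offspring numbers
    applies to. *)
Lemma agree_degrees c i F :
  agree c i F <-> (forall x, x \in degrees [::] i F -> c x.1 = x.2).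
Proof.
elim: F c i => [|a IHa s IHs] c i /=; first by split.
rewrite degrees_cons; split.
  case=> ca /IHa Ha /IHs Hs x; rewrite inE mem_cat => /or3P[/eqP-> //| |/Hs//].
  by case/mapP=> y ya -> /=; exact: Ha.
move=> H; split.
- by have /= := H ([:: i], nroots a); rewrite inE eqxx; apply.
- apply/IHa => x xa; rewrite /subtree.
  have /= := H (i :: x.1, x.2); apply; rewrite inE mem_cat; apply/or3P/Or32.
  by apply/mapP; exists x.
- by apply/IHs => x xs; apply: H; rewrite inE mem_cat xs !orbT.
Qed.

Lemma tree_is_degrees c F :
  tree_is c F <-> (forall x, x \in tree_degrees F -> c x.1 = x.2).
Proof.
rewrite /tree_is agree_degrees; split.
  by case=> c0 H x; rewrite inE => /orP[/eqP->//|/H].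
move=> H; split; first by have /= := H ([::], nroots F); rewrite inE eqxx; apply.
by move=> x xF; apply: H; rewrite inE xF orbT.
Qed.

Lemma degrees_head i F x : x \in degrees [::] i F ->
  exists j u, x.1 = j :: u /\ (i <= j < i + nroots F)%N.
Proof.
elim: F i x => // a _ s IHs i x /=; rewrite degrees_cons inE mem_cat.
case/or3P=> [/eqP->|/mapP[y _ ->]|/IHs[j [u [-> /andP[ij js]]]]] /=.
- by exists i, [::]; rewrite leqnn addnS ltnS leq_addr.
- by exists i, y.1; rewrite leqnn addnS ltnS leq_addr.
- by exists j, u; rewrite (ltnW ij) addnS -addSn.
Qed.

Lemma degrees_uniq i F : uniq (map fst (degrees [::] i F)).
Proof.
elim: F i => //= a IHa s IHs i.
rewrite degrees_cons map_cat cat_uniq IHs andbT -map_comp.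
rewrite mem_cat negb_or.
have -> : [seq (fst \o (fun x => (i :: x.1, x.2))) x | x <- degrees [::] 0 a] =
  map (cons i) (map fst (degrees [::] 0 a)) by rewrite -map_comp.
rewrite map_inj_uniq ?IHa; last by move=> u v [].
apply/andP; split; [apply/andP; split|].
- apply/mapP => -[u /mapP[x /degrees_head[j [v [-> _]]] ->]]; by [].
- apply/mapP => -[x /degrees_head[j [v [-> /andP[ij _]]]] [ji _]].
  by rewrite -ji ltnn in ij.
- apply/hasPn => u /mapP[x /degrees_head[j [v [-> /andP[ij _]]]] ->].
  by apply/mapP => -[w _ [ji _]]; rewrite ji ltnn in ij.
Qed.

Lemma tree_degrees_uniq F : uniq (map fst (tree_degrees F)).
Proof.
rewrite /= degrees_uniq andbT.
by apply/mapP => -[x /degrees_head[j [v [-> _]]]].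
Qed.

Lemma gw_tree_nil c : gw_tree c [::].
Proof. by move=> j. Qed.

Lemma gw_tree_cons c i u :
  gw_tree c (i :: u) <-> (i < c [::])%N /\ gw_tree (subtree c i) u.
Proof.
split.
  move=> H; split; first by have /= := H 0%N isT.
  by move=> j ju; have /= := H j.+1 ju.
by case=> H0 H [|j] //= ju; exact: H.
Qed.

Lemma agree_nodes c i F u : agree c i F ->
  (u \in map fst (degrees [::] i F)) <->
  (exists j v, [/\ u = j :: v, (i <= j < i + nroots F)%N &
     gw_tree (subtree c j) v]).
Proof.
elim: F c i u => [|a IHa s IHs] c i u.
  move=> _; split=> // -[j [v [_]]] /=; rewrite addn0 => /andP[ij ji].
  by move: (leq_ltn_trans ij ji); rewrite ltnn.
move=> /= [ca Ha Hs]; rewrite degrees_cons map_cat -map_comp inE mem_cat.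
have -> : [seq (fst \o (fun x => (i :: x.1, x.2))) x | x <- degrees [::] 0 a] =
  map (cons i) (map fst (degrees [::] 0 a)) by rewrite -map_comp.
split.
  case/or3P=> [/eqP->|/mapP[v /(IHa _ _ _ Ha)[j [w [-> jw Hw]]] ->]|].
  - exists i, [::]; rewrite leqnn addnS ltnS leq_addr; split=> //.
  - exists i, (j :: w); rewrite leqnn addnS ltnS leq_addr; split=> //.
    by apply/gw_tree_cons; split=> //; rewrite /subtree ca.
  - case/(IHs _ _ _ Hs)=> j [v [-> /andP[ij js] Hv]].
    by exists j, v; rewrite (ltnW ij) addnS -addSn.
move=> [j [v [-> /andP[ij js] Hv]]].
move: ij; rewrite leq_eqVlt => /predU1P[ij|ij]; last first.
  apply/or3P/Or33/(IHs _ _ _ Hs).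
  by exists j, v; rewrite ij addSn -addnS.
subst j; case: v Hv => [|w v] Hv; first by rewrite eqxx.
apply/or3P/Or32/mapP; exists (w :: v) => //.
apply/(IHa _ _ _ Ha); exists w, v; split=> //.
  by have := (gw_tree_cons _ _ _).1 Hv; rewrite /subtree ca => -[].
by have := (gw_tree_cons _ _ _).1 Hv => -[].
Qed.

Lemma tree_is_nodes c F : tree_is c F ->
  gw_tree c = [set` map fst (tree_degrees F)].
Proof.
case=> c0 HF; apply/seteqP; split=> [[|j v]|[|j v]]; rewrite /= inE //=.
- move/gw_tree_cons => [jc Hv]; apply/(agree_nodes _ HF).
  by exists j, v; rewrite -c0.
- move=> /(agree_nodes _ HF)[j' [v' [[<- <-] jF Hv]]].
  by apply/gw_tree_cons; rewrite c0.
Qed.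

Lemma tree_is_card c F : tree_is c F -> (gw_tree c #= `I_(nnodes F).+1)%card.
Proof.
move=> /tree_is_nodes ->.
have -> : (nnodes F).+1 = size (map fst (tree_degrees F)).
  by rewrite size_map /= size_degrees.
have us := tree_degrees_uniq F; set s := map _ _ in us *.
have -> : [set` s] = [set` [fset x in s]%fset].
  by apply/seteqP; split=> x /=; rewrite ?inE.
by apply/card_eq_fsetP; rewrite card_fseq undup_id.
Qed.

Lemma agree_inj c i F F' : agree c i F -> agree c i F' ->
  nroots F = nroots F' -> F = F'.
Proof.
elim: F c i F' => [|a IHa s IHs] c i [|a' s'] //= [ca Ha Hs] [ca' Ha' Hs'] [ss].
have -> : a = a' by apply: IHa Ha Ha' _; rewrite -ca.
by have -> : s = s' by exact: IHs Hs Hs' _.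
Qed.

Lemma tree_is_inj c F F' : tree_is c F -> tree_is c F' -> F = F'.
Proof. by move=> [c0 H] [c0' H']; apply: agree_inj H H' _; rewrite -c0. Qed.

(** Induction on a bound for the height: the subtrees at the root have smaller
    height, and their shapes assemble into a forest. *)
Lemma tree_is_ex_depth h c : (forall u, gw_tree c u -> (size u < h)%N) ->
  exists F, tree_is c F.
Proof.
elim: h c => [|h IHh] c Hc; first by have := Hc [::] (gw_tree_nil c).
have sub j : (j < c [::])%N -> exists F, tree_is (subtree c j) F.
  move=> jc; apply: IHh => u Hu.
  by have /= := Hc (j :: u); rewrite ltnS; apply; apply/gw_tree_cons.
suff build : forall m i, (i + m = c [::])%N ->
    exists F, nroots F = m /\ agree c i F.
  by have [F [rF aF]] := build (c [::]) 0%N erefl; exists F; split.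
elim=> [|m IHm] i im; first by exists fnil.
have [|s [rs as_]] := IHm i.+1; first by rewrite addSnnS.
have [|a [ra aa]] := sub i; first by rewrite -im addnS ltnS leq_addr.
by exists (fcons a s); rewrite /= rs; split.
Qed.

Lemma tree_is_ex c : finite_set (gw_tree c) -> exists F, tree_is c F.
Proof.
move=> /finite_seqP[s sE].
apply: (@tree_is_ex_depth (\max_(u <- s) size u).+1) => u; rewrite sE /= => us.
by rewrite ltnS; exact: (@leq_bigmax_seq _ s xpredT size).
Qed.

(** Hence the events that the tree has shape F, for F with n - 1 nodes below the
    root, partition the event that the tree has n nodes. *)
Lemma gw_tree_card c n : (gw_tree c #= `I_n)%card <->
  exists2 F, (nnodes F).+1 = n & tree_is c F.
Proof.
split=> [cn|[F <- /tree_is_card//]].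
have [|F HF] := @tree_is_ex c; first by apply/finite_setP; exists n.
exists F => //; apply/card_eq_II.
by apply: card_eq_trans cn; rewrite card_eq_sym; exact: tree_is_card.
Qed.

Lemma esumZl (R : realType) (T : choiceType) (D : set T) (a : T -> \bar R)
    (r : R) : (0 <= r)%R -> (forall i, 0 <= a i)%E ->
  \esum_(i in D) (r%:E * a i)%E = (r%:E * \esum_(i in D) a i)%E.
Proof.
move=> r0 a0.
rewrite /esum -ereal_supZl//; last by apply/set0P; exists 0%E, set0;
  [exact: fsets_set0|rewrite fsbig_set0].
congr ereal_sup; rewrite image_comp; apply/eq_imagel => A _ /=.
by rewrite ge0_mule_fsumr.
Qed.

(** Countable additivity over an arbitrary countable index type, transported
    to the natural numbers by the enumeration of that type. *)
Lemma measure_esum d (T : measurableType d) (R : realType)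
    (mu : {measure set T -> \bar R}) (I : countType) (D : set I)
    (A : I -> set T) : (forall i, measurable (A i)) -> trivIset D A ->
  mu (\bigcup_(i in D) A i) = \esum_(i in D) mu (A i).
Proof.
move=> mA tA.
pose B n := if choice.unpickle n is Some i then A i else set0.
have BE i : B (choice.pickle i) = A i by rewrite /B choice.pickleK.
have -> : \bigcup_(i in D) A i = \bigcup_(n in choice.pickle @` D) B n.
  by rewrite bigcup_image; apply: eq_bigcupr => i _; rewrite BE.
rewrite measure_bigcup.
- rewrite nneseries_esum// set_mem_set esum_image; last first.
    by move=> i j _ _; exact: (pcan_inj choice.pickleK).
  by apply: eq_esum => i _; rewrite BE.
- by move=> n _; rewrite /B; case: choice.unpickle.
- move=> _ _ [i Di <-] [j Dj <-]; rewrite !BE => /(tA _ _ Di Dj) ->//.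
Qed.

Lemma cvg_series_nneseries (R : realType) (f : nat -> R) (l : R) :
  (forall n, 0 <= f n) -> (\sum_(n <oo) (f n)%:E = l%:E)%E ->
  series f @ \oo --> l.
Proof.
move=> f0 fl.
have : (fun n => \sum_(0 <= i < n) (f i)%:E)%E @ \oo --> l%:E.
  by rewrite -fl; apply: is_cvg_nneseries => n _ _; rewrite lee_fin.
move/fine_cvgP => [_]; apply: cvg_trans; apply: near_eq_cvg; near=> n.
by rewrite /= /series /= sumEFin.
Unshelve. all: by end_near. Qed.

Section tree_law.
Context d (T : measurableType d) (R : realType) (P : probability T R).
Variables (X : seq nat -> {RV P >-> nat}) (p : nat -> R).
Hypothesis Xindep : mutually_independent X.
Hypothesis Xp : forall u c, P (X u @^-1` [set c]) = (p c)%:E.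

(** The probability that independent trees attached to the given roots have the
    shapes prescribed by F. *)
Fixpoint forest_weight (F : forest) : R :=
  if F is fcons a s then p (nroots a) * forest_weight a * forest_weight s
  else 1.

Definition tree_weight (F : forest) : R := p (nroots F) * forest_weight F.

Lemma offspring_prob_ge0 c : 0 <= p c.
Proof. by rewrite -lee_fin -(Xp [::]); exact: measure_ge0. Qed.

Lemma forest_weight_ge0 F : 0 <= forest_weight F.
Proof.
elim: F => //= a IHa s IHs.
by rewrite !mulr_ge0//; exact: offspring_prob_ge0.
Qed.

Lemma tree_weight_ge0 F : 0 <= tree_weight F.
Proof. by rewrite mulr_ge0 ?offspring_prob_ge0 ?forest_weight_ge0. Qed.

Lemma prod_degrees pre i F :
  \prod_(x <- degrees pre i F) p x.2 = forest_weight F.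
Proof.
elim: F pre i => [|a IHa s IHs] pre i /=; first by rewrite big_nil.
by rewrite big_cons big_cat/= IHa IHs mulrA.
Qed.

Definition tree_event (F : forest) : set T :=
  [set w | tree_is (fun u => X u w) F].

Lemma assoc_uniq (I J : eqType) (s : seq (I * J)) x y : uniq (map fst s) ->
  x \in s -> y \in s -> x.1 = y.1 -> x = y.
Proof.
elim: s => //= z s IHs /andP[zs us]; rewrite !inE.
case/orP=> [/eqP->|xs] /orP[/eqP->|ys] // e; last exact: IHs.
- by move: zs; rewrite e map_f.
- by move: zs; rewrite -e map_f.
Qed.

(** Conditions are indexed by all words, as independence requires; a word that is not a
    node of F carries no condition. *)
Let event_cond F (u : seq nat) : set nat :=
  [set c | forall x, x \in tree_degrees F -> x.1 = u -> c = x.2].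

Lemma tree_eventE F :
  tree_event F = \bigcap_(u in [set` map fst (tree_degrees F)])
                   X u @^-1` event_cond F u.
Proof.
apply/seteqP; split=> w /=.
  move=> /tree_is_degrees H u uF x xF xu /=.
  by rewrite -xu H.
move=> H; apply/tree_is_degrees => x xF.
exact: (H x.1 (map_f _ xF) x xF erefl).
Qed.

Lemma tree_event_measurable F : measurable (tree_event F).
Proof.
rewrite tree_eventE; apply: fin_bigcap_measurable => [|u _].
  exact: finite_seq.
by rewrite -[X in measurable X]setTI; apply: measurable_funP.
Qed.

(** Mutual independence enters only here, for the finite family of nodes
    of F. *)
Lemma tree_event_prob F : P (tree_event F) = (tree_weight F)%:E.
Proof.
rewrite tree_eventE Xindep//; last exact: tree_degrees_uniq.
rewrite big_map big_seq (eq_bigr (fun x => (p x.2)%:E)).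
  rewrite -big_seq prodEFin big_cons prod_degrees//.
move=> x xF; rewrite -(Xp x.1); congr (P (_ @^-1` _)).
apply/seteqP; split=> c /=; first by apply.
move=> -> y yF yx; congr snd.
exact: assoc_uniq (tree_degrees_uniq F) _ _ _.
Qed.

Lemma bigcup_tree_event_measurable D : measurable (\bigcup_(F in D) tree_event F).
Proof.
rewrite bigcup_mkcond; apply: countable_bigcupT_measurable => // F.
by case: ifP => _ //; exact: tree_event_measurable.
Qed.

Lemma tree_event_trivIset D : trivIset D tree_event.
Proof. by move=> F G _ _ [w [wF wG]]; exact: tree_is_inj wF wG. Qed.

Lemma esum_tree_weight_le1 :
  (\esum_(F in [set: forest]) (tree_weight F)%:E <= 1)%E.
Proof.
under eq_esum do rewrite -tree_event_prob.
rewrite -measure_esum; [|exact: tree_event_measurable|exact: tree_event_trivIset].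
apply: probability_le1; exact: bigcup_tree_event_measurable.
Qed.

Lemma gw_size_probE n : (gw_size_prob X n)%:E =
  (\esum_(F in [set F | (nnodes F).+1 = n]) (tree_weight F)%:E)%E.
Proof.
under eq_esum do rewrite -tree_event_prob.
rewrite -measure_esum; [|exact: tree_event_measurable|exact: tree_event_trivIset].
rewrite /gw_size_prob.
have -> : [set w | (gw_tree (fun u => X u w) #= `I_n)%card] =
    \bigcup_(F in [set F | (nnodes F).+1 = n]) tree_event F.
  apply/seteqP; split=> w /=.
    by move/gw_tree_card => [F Fn HF]; exists F.
  by move=> [F Fn HF]; apply/gw_tree_card; exists F.
by rewrite fineK// fin_num_measure//; apply: bigcup_tree_event_measurable.
Qed.


Lemma gw_size_prob_ge0 n : 0 <= gw_size_prob X n.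
Proof. by rewrite /gw_size_prob fine_ge0// measure_ge0. Qed.

Lemma gw_size_prob0 : gw_size_prob X 0 = 0.
Proof.
apply: EFin_inj; rewrite gw_size_probE (_ : [set _ | _] = set0) ?esum_set0//.
by apply/seteqP; split.
Qed.

(** Summation by the fibres of f; used with the number of nodes and with the
    number of roots. *)
Lemma esum_preimage (I : choiceType) (f : I -> nat) (a : I -> \bar R) :
  (forall i, 0 <= a i)%E ->
  (\esum_(i in [set: I]) a i =
   \sum_(n <oo) \esum_(i in [set i | f i = n]) a i)%E.
Proof.
move=> a0; rewrite nneseries_esumT; last by move=> n; exact: esum_ge0.
rewrite -esum_bigcupT//; last by move=> m n _ _ [i [/= <- <-]].
congr esum; apply/seteqP; split=> i // _; by exists (f i).
Qed.

Lemma gw_size_prob_sum_le1 N : series (gw_size_prob X) N <= 1.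
Proof.
rewrite -lee_fin /series /= -sumEFin; apply: (le_trans _ esum_tree_weight_le1).
have w0 F : (0 <= (tree_weight F)%:E)%E by rewrite lee_fin tree_weight_ge0.
rewrite (esum_preimage (fun F => (nnodes F).+1))//.
rewrite (eq_bigr (fun n =>
  \esum_(F in [set F | (nnodes F).+1 = n]) (tree_weight F)%:E)%E).
  by apply: nneseries_lim_ge => n _ _; exact: esum_ge0.
by move=> n _; exact: gw_size_probE.
Qed.

Section generating.
Variable r : R.
Hypothesis r01 : 0 <= r <= 1.
Let r0 : 0 <= r := (andP r01).1.

Let Y := (\esum_(F in [set: forest]) (tree_weight F * r ^+ (nnodes F).+1)%:E)%E.
Let G c := (\esum_(F in [set F | nroots F = c])
  (forest_weight F * r ^+ nnodes F)%:E)%E.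

Let forest_term_ge0 F : (0 <= (forest_weight F * r ^+ nnodes F)%:E)%E.
Proof. by rewrite lee_fin mulr_ge0 ?exprn_ge0 ?forest_weight_ge0. Qed.

Let tree_term_ge0 F : (0 <= (tree_weight F * r ^+ (nnodes F).+1)%:E)%E.
Proof. by rewrite lee_fin mulr_ge0 ?exprn_ge0 ?tree_weight_ge0. Qed.

Let Y_ge0 : (0 <= Y)%E. Proof. by apply: esum_ge0 => F _. Qed.

Let Y_le1 : (Y <= 1)%E.
Proof.
apply: le_trans esum_tree_weight_le1; apply: le_esum => F _.
by rewrite lee_fin ler_piMr ?tree_weight_ge0// exprn_ile1 ?(andP r01).2.
Qed.

Let Y_fin : Y \is a fin_num.
Proof. by rewrite ge0_fin_numE// (le_lt_trans Y_le1)// ltry. Qed.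

Let G0 : G 0 = 1%E.
Proof.
rewrite /G (_ : [set _ | _] = [set fnil]) ?esum_set1 ?mulr1//.
by apply/seteqP; split=> F /=; [case: F|move=> ->].
Qed.

(** Cutting off the first tree of a forest is a bijection onto pairs of a tree and
    a forest with one root less, and both weight and size split accordingly. *)
Let GS c : G c.+1 = (Y * G c)%E.
Proof.
have Gc0 : (0 <= G c)%E by apply: esum_ge0 => F _.
rewrite -[X in (X * _)%E](fineK Y_fin) /G -esumZl ?fine_ge0//.
under [in RHS]eq_esum do rewrite fineK// muleC /Y -esumZl// ?lee_fin ?mulr_ge0 ?exprn_ge0 ?forest_weight_ge0//.
rewrite esum_esum//; last by move=> i j _ _; rewrite mule_ge0.
rewrite (reindex_esum
  ([set F | nroots F = c] `*`` (fun=> [set: forest])) _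
  (fun x => fcons x.2 x.1)) /=.
  apply: eq_esum => -[s a] _ /=; rewrite -EFinM; congr EFin.
  rewrite /tree_weight !exprS exprD; ring.
split.
- by move=> [s a] [/= -> _].
- by move=> [s a] [s' a'] _ _ /= [-> ->].
- by move=> [|a s] //= [sc]; exists (s, a).
Qed.

Let GE c : G c = ((fine Y) ^+ c)%:E.
Proof.
elim: c => [|c IHc]; first by rewrite G0.
by rewrite GS IHc exprS EFinM fineK.
Qed.

(** Forests with c roots have generating function y^c, so sorting trees by the
    degree of the root gives y = r phi(y). *)
Lemma gw_generating_eq : exists y : R, [/\ 0 <= y <= 1,
  (\sum_(n <oo) (gw_size_prob X n * r ^+ n)%:E = y%:E)%E &
  (r%:E * \sum_(c <oo) (p c * y ^+ c)%:E = y%:E)%E].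
Proof.
exists (fine Y); split.
- by rewrite fine_ge0//= -lee_fin fineK.
- rewrite fineK// /Y (esum_preimage (fun F => (nnodes F).+1))//.
  apply: eq_eseriesr => n _.
  rewrite mulrC EFinM gw_size_probE -esumZl ?exprn_ge0//; last first.
    by move=> F; rewrite lee_fin tree_weight_ge0.
  by apply: eq_esum => F /= <-; rewrite -EFinM mulrC.
- rewrite -nneseriesZl; last first.
    by move=> c _; rewrite lee_fin mulr_ge0 ?exprn_ge0 ?fine_ge0// offspring_prob_ge0.
  rewrite [RHS](fineK Y_fin) [RHS](esum_preimage nroots)//.
  apply: eq_eseriesr => c _; rewrite EFinM -GE /G muleA -EFinM -esumZl//.
    by apply: eq_esum => F /= <-; rewrite -EFinM /tree_weight exprS; congr EFin; ring.
  by rewrite mulr_ge0// offspring_prob_ge0.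
Qed.

End generating.
End tree_law.

Section offspring_law.
Context d (T : measurableType d) (R : realType) (P : probability T R).
Variable xi : {RV P >-> nat}.

Definition offspring_prob c : R := fine (P (xi @^-1` [set c])).

Lemma offspring_preimage_measurable c : measurable (xi @^-1` [set c]).
Proof. by rewrite -[X in measurable X]setTI; apply: measurable_funP. Qed.

Lemma offspring_probE c : P (xi @^-1` [set c]) = (offspring_prob c)%:E.
Proof.
by rewrite /offspring_prob fineK// fin_num_measure//;
  exact: offspring_preimage_measurable.
Qed.

Lemma ge0_expectation_nat (g : nat -> R) : (forall c, 0 <= g c) ->
  ('E_P[(fun w => g (xi w))%R] = \sum_(c <oo) (g c * offspring_prob c)%:E)%E.
Proof.
move=> g0; rewrite unlock.
have mxi c := offspring_preimage_measurable c.
have xiT : setT = \bigcup_c (xi @^-1` [set c]).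
  by apply/seteqP; split=> w // _; exists (xi w).
have mg : measurable_fun [set: T] (fun w => (g (xi w))%:E).
  apply/measurable_EFinP; apply: (@measurableT_comp _ _ _ _ _ _ g) => //.
rewrite [in LHS]xiT ge0_integral_bigcup//=.
- apply: eq_eseriesr => c _.
  rewrite (eq_integral (fun=> (g c)%:E)); last by move=> w /set_mem /= ->.
  rewrite integral_cst; last exact: mxi.
  by rewrite EFinM -offspring_probE.
- by rewrite -xiT.
- by move=> w _; rewrite lee_fin.
- by move=> i j _ _ [w [/= <- <-]].
Qed.

Lemma offspring_sum1 : (\sum_(c <oo) (offspring_prob c)%:E = 1)%E.
Proof.
have := ge0_expectation_nat (fun=> ler01).
rewrite (_ : (fun=> 1%R) = cst 1) // expectation_cst => ->.
by apply: eq_eseriesr => c _; rewrite mul1r.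
Qed.

(** Otherwise the offspring number is at most 1 with mean 1, hence almost surely
    1, and the variance vanishes. *)
Lemma offspring_ge2 :
  ('E_P[(fun w => (xi w)%:R : R)%R] = 1)%E ->
  (0 < 'V_P[(fun w => (xi w)%:R : R)%R])%E ->
  exists2 c, (2 <= c)%N & 0 < offspring_prob c.
Proof.
move=> E1 V0; apply: contrapT => /forall2NP H.
have p0 c : (2 <= c)%N -> offspring_prob c = 0.
  move=> c2; have [//|/negP] := H c; rewrite -leNgt => pc.
  by apply/eqP; rewrite eq_le pc fine_ge0.
have s2 (g : nat -> R) : (forall c, 0 <= g c) ->
   ('E_P[(fun w => g (xi w))%R] = (g 0%N * offspring_prob 0 + g 1%N * offspring_prob 1)%:E)%E.
  move=> g0; rewrite ge0_expectation_nat// (nneseries_split 0 2); last first.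
    by move=> c _; rewrite lee_fin mulr_ge0// fine_ge0.
  rewrite eseries0 ?adde0; last by move=> c c2 _; rewrite p0// mulr0.
  by rewrite big_nat_recr//= big_nat1 -EFinD.
have p1 : offspring_prob 1 = 1.
  by move: E1; rewrite (s2 (fun c => c%:R))// mul0r add0r mul1r => -[].
have p00 : offspring_prob 0 = 0.
  have := s2 (fun=> 1) (fun=> ler01).
  rewrite (_ : (fun=> 1%R) = cst 1) // expectation_cst !mul1r p1 => -[] h.
  by apply: (addIr 1); rewrite -h add0r.
move: V0; rewrite /variance unlock E1 /=.
rewrite (_ : (_ * _)%R = (fun w => ((xi w)%:R - 1) ^+ 2)); last first.
  by apply/funext => w; rewrite expr2.
rewrite (s2 (fun c => (c%:R - 1) ^+ 2)); last by move=> c; exact: sqr_ge0.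
by rewrite p00 subrr expr0n/= mul0r mulr0 addr0 ltxx.
Qed.

End offspring_law.

(** * Expansion of the generating function in powers of the square root of t *)

Section bigO_unit_interval.
Variable R : realType.
Implicit Types (f g : R -> R) (m n : nat).

(** A bound on the whole of ]0, 1] rather than near 0: it makes all
    manipulations of error terms algebraic. *)
Definition bigO_pow m g :=
  exists C, forall s, 0 < s <= 1 -> `|g s| <= C * s ^+ m.

Lemma bigO_powD m f g : bigO_pow m f -> bigO_pow m g ->
  bigO_pow m (fun s => f s + g s).
Proof.
move=> [C HC] [D HD]; exists (C + D) => s s01.
by rewrite mulrDl (le_trans (ler_normD _ _))// lerD ?HC ?HD.
Qed.

Lemma bigO_powN m f : bigO_pow m f -> bigO_pow m (fun s => - f s).
Proof. by move=> [C HC]; exists C => s s01; rewrite normrN HC. Qed.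

Lemma bigO_powB m f g : bigO_pow m f -> bigO_pow m g ->
  bigO_pow m (fun s => f s - g s).
Proof. by move=> Hf /bigO_powN; exact: bigO_powD. Qed.

Lemma bigO_powM m n f g : bigO_pow m f -> bigO_pow n g ->
  bigO_pow (m + n) (fun s => f s * g s).
Proof.
move=> [C HC] [D HD]; exists (C * D) => s s01.
by rewrite exprD mulrACA normrM ler_pM ?HC ?HD.
Qed.

Lemma bigO_powW m n f : (m <= n)%N -> bigO_pow n f -> bigO_pow m f.
Proof.
move=> mn [C HC]; exists `|C| => s /[dup] s01 /andP[s0 s1].
rewrite (le_trans (HC _ s01))// (le_trans (ler_norm _))// normrM.
rewrite ler_wpM2l// ger0_norm ?exprn_ge0//; last exact: ltW.
by rewrite ler_wiXn2l// ltW.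
Qed.

Lemma bigO_pow_exp m : bigO_pow m (fun s => s ^+ m).
Proof.
by exists 1 => s /andP[s0 _]; rewrite mul1r ger0_norm// exprn_ge0// ltW.
Qed.

Lemma bigO_pow_id : bigO_pow 1 id.
Proof. exact: bigO_pow_exp. Qed.

Lemma bigO_pow_cst c : bigO_pow 0 (fun=> c).
Proof. by exists `|c| => s _; rewrite mulr1. Qed.

Lemma bigO_powZ m c f : bigO_pow m f -> bigO_pow m (fun s => c * f s).
Proof. exact: bigO_powM (bigO_pow_cst c). Qed.

Lemma eq_bigO_pow m f g : (forall s, 0 < s <= 1 -> f s = g s) ->
  bigO_pow m f -> bigO_pow m g.
Proof. by move=> fg [C HC]; exists C => s s01; rewrite -fg ?HC. Qed.

Lemma bigO_powX m f n : bigO_pow m f -> bigO_pow (n * m) (fun s => f s ^+ n).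
Proof.
move=> Hf; elim: n => [|n IHn].
  by apply: eq_bigO_pow (bigO_pow_cst 1) => s _; rewrite expr0.
by apply: eq_bigO_pow (bigO_powM Hf IHn) => s _; rewrite exprS.
Qed.

(** Functions that are polynomial up to O(s^m). They form a ring, and
    multiplication by s raises the order by one (near_polyS), which is what makes
    the successive approximation of a power series solution work. *)
Definition near_poly m g :=
  exists D : {poly R}, bigO_pow m (fun s => g s - D.[s]).

Lemma eq_near_poly m f g : (forall s, 0 < s <= 1 -> f s = g s) ->
  near_poly m f -> near_poly m g.
Proof.
by move=> fg [D HD]; exists D; apply: eq_bigO_pow HD => s /fg ->.
Qed.

Lemma bigO_horner (D : {poly R}) : bigO_pow 0 (horner D).
Proof.
elim/poly_ind: D => [|D c IHD].
  by apply: eq_bigO_pow (bigO_pow_cst 0) => s _; rewrite horner0.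
apply: eq_bigO_pow (bigO_powD (bigO_powM IHD (bigO_powW _ bigO_pow_id)) (bigO_pow_cst c)) => //.
by move=> s _; rewrite hornerMXaddC.
Qed.

Lemma near_poly_bigO m f : bigO_pow m f -> near_poly m f.
Proof. by exists 0; apply: eq_bigO_pow H => s _; rewrite horner0 subr0. Qed.

Lemma near_poly_horner m (D : {poly R}) : near_poly m (horner D).
Proof.
exists D; apply: eq_bigO_pow (bigO_powZ 0 (bigO_pow_exp m)) => s _.
by rewrite mul0r subrr.
Qed.

Lemma near_poly_cst m c : near_poly m (fun=> c).
Proof. by apply: eq_near_poly (near_poly_horner m c%:P) => s _; rewrite hornerC. Qed.

Lemma near_polyD m f g : near_poly m f -> near_poly m g ->
  near_poly m (fun s => f s + g s).
Proof.
move=> [D HD] [E HE]; exists (D + E).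
by apply: eq_bigO_pow (bigO_powD HD HE) => s _; rewrite hornerD; ring.
Qed.

Lemma near_poly0_bigO f : near_poly 0 f -> bigO_pow 0 f.
Proof.
move=> [D HD]; apply: eq_bigO_pow (bigO_powD HD (bigO_horner D)) => s _.
by rewrite subrK.
Qed.

Lemma near_polyW m n f : (m <= n)%N -> near_poly n f -> near_poly m f.
Proof. by move=> mn [D HD]; exists D; exact: bigO_powW mn HD. Qed.

Lemma near_polyM m f g : near_poly m f -> near_poly m g ->
  near_poly m (fun s => f s * g s).
Proof.
move=> Hf Hg; have Bg := near_poly0_bigO (near_polyW (leq0n _) Hg).
move: Hf Hg => [D HD] [E HE]; exists (D * E).
have H1 := bigO_powM HD Bg; rewrite addn0 in H1.
apply: eq_bigO_pow (bigO_powD H1 (bigO_powM (bigO_horner D) HE)) => s _.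
by rewrite hornerM; ring.
Qed.

Lemma near_polyZ m c f : near_poly m f -> near_poly m (fun s => c * f s).
Proof. exact/near_polyM/near_poly_cst. Qed.

Lemma near_polyN m f : near_poly m f -> near_poly m (fun s => - f s).
Proof. by move/(near_polyZ (-1)); apply: eq_near_poly => s _; rewrite mulN1r. Qed.

Lemma near_polyB m f g : near_poly m f -> near_poly m g ->
  near_poly m (fun s => f s - g s).
Proof. by move=> Hf /near_polyN; exact: near_polyD. Qed.

Lemma near_poly_id m : near_poly m id.
Proof. by apply: eq_near_poly (near_poly_horner m 'X) => s _; rewrite hornerX. Qed.

Lemma near_polyX m f n : near_poly m f -> near_poly m (fun s => f s ^+ n).
Proof.
move=> Hf; elim: n => [|n IHn].
  by apply: eq_near_poly (near_poly_cst m 1) => s _; rewrite expr0.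
by apply: eq_near_poly (near_polyM Hf IHn) => s _; rewrite exprS.
Qed.

Lemma near_polyS m f : near_poly m f -> near_poly m.+1 (fun s => s * f s).
Proof.
move=> [D HD]; exists ('X * D).
apply: eq_bigO_pow (bigO_powM bigO_pow_id HD) => s _.
by rewrite hornerM hornerX mulrBr.
Qed.

Lemma near_poly_sum m I (r : seq I) (F : I -> R -> R) :
  (forall i, near_poly m (F i)) ->
  near_poly m (fun s => \sum_(i <- r) F i s).
Proof.
move=> HF; elim: r => [|i r IHr].
  by apply: eq_near_poly (near_poly_cst m 0) => s _; rewrite big_nil.
by apply: eq_near_poly (near_polyD (HF i) IHr) => s _; rewrite big_cons.
Qed.

(** The tail of the exponential series is |y|^m times a series dominated by the
    one for exp 1. *)
Lemma expR_taylor m (y : R) : `|y| <= 1 ->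
  `|expR y - \sum_(i < m) y ^+ i / (i`!)%:R| <= expR 1 * `|y| ^+ m.
Proof.
move=> y1.
have cvgE (z : R) : series (exp_coeff z) @ \oo --> expR z.
  exact: is_cvg_series_exp_coeff.
have le1 n : \sum_(i < n) 1 ^+ i / (i`!)%:R <= expR 1 :> R.
  have := cvgE 1; move/cvg_lim => <- //.
  have nd : nondecreasing_seq (series (exp_coeff (1 : R))).
    apply/nondecreasing_series => i _ _.
    by rewrite /exp_coeff /= divr_ge0// ?exprn_ge0// ler0n.
  have := nondecreasing_cvgn_le nd (is_cvg_series_exp_coeff 1) n.
  by rewrite /series /= big_mkord.
have H : (fun n => `|series (exp_coeff y) (n + m)%N -
    \sum_(i < m) y ^+ i / (i`!)%:R|) @ \oo
    --> `|expR y - \sum_(i < m) y ^+ i / (i`!)%:R|.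
  apply: cvg_norm; apply: cvgB; last exact: cvg_cst.
  by rewrite cvg_shiftn.
rewrite -(cvg_lim _ H)//; apply: limr_le; first by apply/cvg_ex; eexists; exact: H.
near=> n.
rewrite /series /= addnC big_mkord big_split_ord /=.
rewrite (_ : \sum_(i < m) exp_coeff y i = \sum_(i < m) y ^+ i / (i`!)%:R)//.
rewrite addrAC subrr add0r.
apply: (le_trans (ler_norm_sum _ _ _)).
apply: (@le_trans _ _ (\sum_(i < n) `|y| ^+ m * (1 ^+ i / (i`!)%:R))).
  apply: ler_sum => i _; rewrite /exp_coeff /= normrM normrX exprD -mulrA.
  rewrite ler_wpM2l ?exprn_ge0// expr1n div1r.
  rewrite [X in _ * X <= _]ger0_norm ?invr_ge0//.
  have y1' : `|y| ^+ i <= 1 by rewrite exprn_ile1.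
  have f1 : ((m + i)`!%:R : R)^-1 <= (i`!%:R)^-1.
    by rewrite lef_pV2 ?posrE ?ltr0n ?fact_gt0// ler_nat leq_fact// leq_addl.
  by rewrite -[leRHS]mul1r; apply: ler_pM; rewrite ?exprn_ge0 ?invr_ge0.
by rewrite -mulr_sumr mulrC ler_wpM2r ?exprn_ge0.
Unshelve. all: by end_near. Qed.

Lemma near_poly_expR m (c : R) : `|c| = 1 ->
  near_poly m (fun s => (expR (c * s ^+ 2) - 1) / s ^+ 2).
Proof.
move=> c1.
apply: (@near_polyW _ (2 * m)); first by rewrite mul2n -addnn leq_addr.
apply: eq_near_poly (near_polyD (near_poly_bigO (f := fun s =>
    (expR (c * s ^+ 2) - \sum_(i < m.+1) (c * s ^+ 2) ^+ i / (i`!)%:R) / s ^+ 2) _)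
  (near_poly_sum (index_enum 'I_m) (F := fun i s => 
    (c ^+ i.+1 / (i.+1`!)%:R) * (s ^+ (2 * i)) ) _)).
- move=> s /andP[s0 _] /=.
  rewrite big_ord_recl /= expr0 fact0 divr1.
  have s2 : s ^+ 2 != 0 by rewrite expf_neq0// gt_eqF.
  apply: (mulIf s2); rewrite mulrDl !divfK// mulr_suml.
  rewrite [X in _ + X](_ : _ = \sum_(i < m)
      (c * s ^+ 2) ^+ bump 0 i / ((bump 0 i)`!)%:R); first ring.
  apply: eq_bigr => i _.
  by rewrite /bump /= add1n exprMn -exprM mulnS addnC exprD; ring.
- exists (expR 1) => s /andP[s0 s1].
  have s2 : 0 < s ^+ 2 by rewrite exprn_gt0.
  rewrite normrM normfV (gtr0_norm s2) ler_pdivrMr// -mulrA -exprD.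
  have := @expR_taylor m.+1 (c * s ^+ 2).
  rewrite normrM c1 mul1r (gtr0_norm s2) -exprM mulnS addnC; apply.
  by rewrite exprn_ile1// ltW.
- by move=> i; apply: near_polyZ; apply: near_polyX; exact: near_poly_id.
Qed.

End bigO_unit_interval.

Section moments.
Variable R : realType.

(** By Pascal's rule the truncation errors r(n, k) of (1 - x)^n satisfy
    r(n+1, k+1) = r(n, k+1) - x r(n, k), and so do the claimed bounds, with a plus
    sign. *)
Lemma bonferroni (x : R) n k : 0 <= x <= 1 ->
  `|(1 - x) ^+ n - \sum_(i < k) 'C(n, i)%:R * (- x) ^+ i| <=
  'C(n, k)%:R * x ^+ k.
Proof.
move=> /andP[x0 x1].
elim: n k => [|n IHn] [|k].
- by rewrite big_ord0 subr0 !expr0 normr1 bin0 mul1r.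
- rewrite big_ord_recl big1 ?addr0; last by move=> i _; rewrite bin0n mul0r.
  by rewrite !expr0 bin0 mul1r subrr normr0 bin0n mul0r.
- rewrite big_ord0 subr0 bin0 mul1r expr0 ger0_norm ?exprn_ge0 ?subr_ge0//.
  by rewrite exprn_ile1 ?subr_ge0// lerBlDr lerDl.
have -> : \sum_(i < k.+1) 'C(n.+1, i)%:R * (- x) ^+ i =
    \sum_(i < k.+1) 'C(n, i)%:R * (- x) ^+ i -
    x * \sum_(i < k) 'C(n, i)%:R * (- x) ^+ i.
  rewrite !big_ord_recl !bin0 -!addrA; congr (_ + _).
  rewrite mulr_sumr -sumrB; apply: eq_bigr => i _.
  by rewrite /bump /= ?add1n binS natrD exprS; ring.
rewrite exprS.
have -> : (1 - x) * (1 - x) ^+ n -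
  (\sum_(i < k.+1) 'C(n, i)%:R * (- x) ^+ i -
    x * \sum_(i < k) 'C(n, i)%:R * (- x) ^+ i) =
  ((1 - x) ^+ n - \sum_(i < k.+1) 'C(n, i)%:R * (- x) ^+ i) -
  x * ((1 - x) ^+ n - \sum_(i < k) 'C(n, i)%:R * (- x) ^+ i) by ring.
rewrite (le_trans (ler_normB _ _))// binS natrD mulrDl lerD//.
by rewrite normrM (ger0_norm x0) exprS mulrCA ler_wpM2l.
Qed.

(** This quantifies the strict convexity of the generating function of the
    offspring law at 1. *)
Lemma bernoulli_strict (x : R) n : 0 <= x <= 1 -> (2 <= n)%N ->
  x ^+ 2 <= (1 - x) ^+ n - (1 - n%:R * x).
Proof.
move=> /andP[x0 x1]; elim: n => // -[|[|n]] // IHn _; first by lra.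
have {}IHn := IHn isT.
rewrite [(1 - x) ^+ _]exprS.
have := ler_wpM2l (_ : 0 <= 1 - x) IHn; rewrite subr_ge0 => /(_ x1).
rewrite -(natr1 n.+2); set N := n.+2%:R : R.
have N2 : 2 <= N by rewrite /N (ler_nat _ 2).
rewrite mulrBr; set W := (1 - x) * (1 - x) ^+ _ => HW.
have H3 : 0 <= x ^+ 2 * (N - x) by rewrite mulr_ge0 ?sqr_ge0// subr_ge0; lra.
rewrite !expr2 in HW H3 *.
lra.
Qed.

Lemma bernoulli_weak (x : R) n : 0 <= x <= 1 ->
  0 <= (1 - x) ^+ n - (1 - n%:R * x).
Proof.
move=> x01; case: n => [|[|n]]; [lra|lra|].
by apply: le_trans (bernoulli_strict x01 _) => //; exact: sqr_ge0.
Qed.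

Lemma bin_le_exp n k : ('C(n, k) <= n ^ k)%N.
Proof.
rewrite -(leq_pmul2r (fact_gt0 k)) bin_ffact.
apply: (@leq_trans (n ^ k)); last by rewrite leq_pmulr// fact_gt0.
by elim: k => // k IHk; rewrite ffactnSr expnSr leq_mul// leq_subr.
Qed.

Lemma cvg_series_le (f g : nat -> R) (l l' : R) : (forall n, f n <= g n) ->
  series f @ \oo --> l -> series g @ \oo --> l' -> l <= l'.
Proof.
move=> fg Hf Hg; apply: ler_cvg_to Hf Hg _; near=> n.
by apply: ler_sum => i _.
Unshelve. all: by end_near. Qed.

Lemma cvg_seriesDZ (f g : nat -> R) (c l l' : R) :
  series f @ \oo --> l -> series g @ \oo --> l' ->
  series (fun n => f n + c * g n) @ \oo --> l + c * l'.
Proof.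
move=> Hf Hg.
rewrite (_ : series _ = fun n => series f n + c * series g n); last first.
  by apply/funext => n; rewrite /series /= big_split /= mulr_sumr.
by apply: cvgD => //; apply: cvgZr.
Qed.

Lemma cvg_series_sum m (f : nat -> nat -> R) (a l : nat -> R) :
  (forall i, (i < m)%N -> series (f i) @ \oo --> l i) ->
  series (fun n => \sum_(i < m) a i * f i n) @ \oo --> \sum_(i < m) a i * l i.
Proof.
elim: m => [|m IHm] Hf.
  rewrite big_ord0 (_ : series _ = fun=> 0); first exact: cvg_cst.
  by apply/funext => n; rewrite /series /= big1// => i _; rewrite big_ord0.
rewrite big_ord_recr /=.
rewrite (_ : series _ = series (fun n => \sum_(i < m) a i * f i n + a m * f m n)).
  apply: cvg_seriesDZ; last exact: Hf.
  by apply: IHm => i im; exact/Hf/ltnW.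
by congr series; apply/funext => n; rewrite big_ord_recr.
Qed.
End moments.

(** Here s stands for the square root of t, x for 1 - Y and f i for the factorial
    moment E C(xi, i), so that phi(1 - x) = sum_i f_i (-x)^i up to order k. *)
Section puiseux.
Variables (R : realType) (p : nat -> R) (k : nat) (Y : R -> R).
Hypothesis p_ge0 : forall c, 0 <= p c.
Hypothesis p_sum1 : series p @ \oo --> (1 : R).
Hypothesis p_mean1 : series (fun c => c%:R * p c) @ \oo --> (1 : R).
Hypothesis p_moment : cvgn (series (fun c => c%:R ^+ k * p c)).
Hypothesis k_ge3 : (3 <= k)%N.
Hypothesis p_ge2 : exists2 c, (2 <= c)%N & 0 < p c.
Hypothesis Y01 : forall t, 0 < t -> 0 <= Y t <= 1.
Hypothesis Y_eq : forall t, 0 < t ->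
  series (fun c => p c * Y t ^+ c) @ \oo --> expR t * Y t.

Let f i := limn (series (fun c => 'C(c, i)%:R * p c)).

Let fE i : (i <= k)%N -> series (fun c => 'C(c, i)%:R * p c) @ \oo --> f i.
Proof.
move=> ik; rewrite /f.
apply: (@series_le_cvg _ _ (fun c => p c + 1 * (c%:R ^+ k * p c))).
- by move=> c; rewrite mulr_ge0.
- by move=> c; rewrite mul1r addr_ge0// mulr_ge0// exprn_ge0.
- move=> c; rewrite mul1r -[X in X + _]mul1r -mulrDl ler_wpM2r//.
  rewrite -natrX nat1r ler_nat.
  apply: (leq_trans (bin_le_exp c i)); case: c => [|c].
    by case: i ik => // i _; rewrite exp0n.
  by rewrite leqW// leq_pexp2l.
- by apply: cvgP; apply: cvg_seriesDZ p_sum1 p_moment.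
Qed.

Let f_ge0 i : (i <= k)%N -> 0 <= f i.
Proof.
move=> ik; apply: (cvg_series_le (f := fun=> 0) _ _ (fE ik)).
  by move=> c; rewrite mulr_ge0.
rewrite (_ : series _ = fun=> 0); first exact: cvg_cst.
by apply/funext => n; rewrite /series /= big1.
Qed.

Let f0 : f 0%N = 1.
Proof.
rewrite /f (_ : (fun c => _) = p); first exact: cvg_lim.
by apply/funext => c; rewrite bin0 mul1r.
Qed.

Let f1 : f 1%N = 1.
Proof.
rewrite /f (_ : (fun c => _) = (fun c => c%:R * p c)); first exact: cvg_lim.
by apply/funext => c; rewrite bin1.
Qed.

Let cvg_single c0 (a : R) : series (fun c => if c == c0 then a else 0) @ \oo --> a.
Proof.
apply: (@cvg_near_cst _ _ _ _ _ _); exists c0.+1 => // n /= cn.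
rewrite /series /= (big_rem c0) ?mem_index_iota//= eqxx big1_seq ?addr0//.
move=> i; rewrite mem_rem_uniq ?iota_uniq// inE => /andP[_ /andP[ic _]].
by rewrite (negbTE ic).
Qed.

Let f2_gt0 : 0 < f 2%N.
Proof.
have [c0 c2 pc0] := p_ge2.
apply: (lt_le_trans pc0).
apply: (cvg_series_le _ (@cvg_single c0 (p c0)) (fE (ltnW k_ge3))) => c.
case: eqP => [->|_]; last by rewrite mulr_ge0.
by rewrite ler_peMl// (ler_nat _ 1) bin_gt0.
Qed.

Let x s := 1 - Y (s ^+ 2).

Let x01 s : 0 < s <= 1 -> 0 <= x s <= 1.
Proof.
move=> /andP[s0 s1]; have := Y01 (exprn_gt0 2 s0).
by rewrite /x => /andP[? ?]; apply/andP; split; lra.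
Qed.

Let taylor s : 0 < s <= 1 ->
  `|expR (s ^+ 2) * (1 - x s) - \sum_(i < k) (- x s) ^+ i * f i| <=
  f k * x s ^+ k.
Proof.
move=> s01; have /andP[s0 s1] := s01.
have xs01 := x01 s01.
have HY : series (fun c => p c * (1 - x s) ^+ c) @ \oo --> expR (s ^+ 2) * (1 - x s).
  by rewrite /x opprB addrC subrK; exact: Y_eq (exprn_gt0 _ _).
have HS := cvg_series_sum (f := fun i c => 'C(c, i)%:R * p c)
  (a := fun i => (- x s) ^+ i) (l := f) (fun i ik => fE (ltnW ik)) (m := k).
have HK : series (fun c => 0 + x s ^+ k * ('C(c, k)%:R * p c)) @ \oo --> 0 + x s ^+ k * f k.
  apply: cvg_seriesDZ; last exact: fE.
  rewrite (_ : series _ = fun=> 0); first exact: cvg_cst.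
  by apply/funext => n; rewrite /series /= big1.
have HD := cvg_seriesDZ (c := -1) HY HS.
rewrite mulN1r in HD.
rewrite add0r [x s ^+ k * _]mulrC in HK.
have B c : `|p c * (1 - x s) ^+ c + -1 * \sum_(i < k) (- x s) ^+ i * ('C(c, i)%:R * p c)|
    <= 0 + x s ^+ k * ('C(c, k)%:R * p c).
  have -> : \sum_(i < k) (- x s) ^+ i * ('C(c, i)%:R * p c) =
     p c * \sum_(i < k) 'C(c, i)%:R * (- x s) ^+ i.
    by rewrite mulr_sumr; apply: eq_bigr => i _; ring.
  rewrite mulN1r -mulrBr normrM (ger0_norm (p_ge0 c)) add0r mulrA mulrC.
  by rewrite ler_wpM2r// mulrC; exact: bonferroni.
rewrite ler_norml; apply/andP; split.
  have HKN := cvg_seriesDZ (c := -1) (@cvg_single 0%N 0) HK.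
  rewrite add0r mulN1r in HKN.
  apply: (cvg_series_le _ HKN HD) => c /=.
  by rewrite if_same add0r mulN1r; have := B c; rewrite ler_norml => /andP[].
apply: (cvg_series_le _ HD HK) => c /=.
by have := B c; rewrite ler_norml => /andP[].
Qed.

(** Convexity: p_c x^2 <= phi(1 - x) - (1 - x) = (e^t - 1)(1 - x) for some c >= 2
    with p_c > 0, which bounds x^2 by a multiple of t. *)
Let x_bigO : bigO_pow 1 x.
Proof.
have [c0 c2 pc0] := p_ge2.
have e0 : 0 <= expR 1 / p c0 :> R by rewrite divr_ge0// ?expR_ge0// ltW.
exists (Num.sqrt (expR 1 / p c0)) => s s01; have /andP[s0 s1] := s01.
have /andP[xs0 xs1] := x01 s01.
have t0 : 0 < s ^+ 2 by rewrite exprn_gt0.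
have t1 : s ^+ 2 <= 1 by rewrite exprn_ile1// ltW.
rewrite ger0_norm// expr1 -(@ler_pXn2r _ 2)// ?nnegrE ?mulr_ge0 ?sqrtr_ge0// ?(ltW s0)//.
rewrite exprMn sqr_sqrtr// mulrAC.
rewrite ler_pdivlMr//.
have HY : series (fun c => p c * (1 - x s) ^+ c) @ \oo --> expR (s ^+ 2) * (1 - x s).
  by rewrite /x opprB addrC subrK; exact: Y_eq.
have H1 := cvg_seriesDZ (c := -1) HY (cvg_seriesDZ (c := - x s) p_sum1 p_mean1).
have H2 := @cvg_single c0 (x s ^+ 2 * p c0).
have : x s ^+ 2 * p c0 <=
    expR (s ^+ 2) * (1 - x s) + -1 * (1 + - x s * 1).
  apply: (cvg_series_le _ H2 H1) => c /=.
  have -> : p c * (1 - x s) ^+ c + -1 * (p c + - x s * (c%:R * p c)) =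
     ((1 - x s) ^+ c - (1 - c%:R * x s)) * p c by ring.
  case: eqP => [->|_]; last by rewrite mulr_ge0// bernoulli_weak// x01.
  by rewrite ler_wpM2r// bernoulli_strict// x01.
move/le_trans; apply.
have -> : expR (s ^+ 2) * (1 - x s) + -1 * (1 + - x s * 1) =
  (expR (s ^+ 2) - 1) * (1 - x s) by ring.
have e1 : expR (s ^+ 2) <= expR 1 :> R by rewrite ler_expR.
have := expR_ge1Dx (- s ^+ 2); rewrite expRN.
have eg := expR_gt0 (s ^+ 2).
rewrite -(ler_pM2l eg) mulfV ?gt_eqF// => H.
have E1 : 0 <= expR (s ^+ 2) - 1 by rewrite subr_ge0 -expR0 ler_expR ltW.
apply: (@le_trans _ _ (expR (s ^+ 2) - 1)); first by rewrite ler_piMr//; lra.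
apply: (@le_trans _ _ (expR (s ^+ 2) * s ^+ 2)); first by lra.
by rewrite ler_wpM2r// ltW.
Qed.


Let n := (k - 3)%N.
Let kE : k = n.+3. Proof. by rewrite /n -addn3 subnK. Qed.

Let v s := x s / s.

Let xE s : 0 < s <= 1 -> x s = s * v s.
Proof. by move=> /andP[s0 _]; rewrite /v mulrC divfK// gt_eqF. Qed.

Let v_ge0 s : 0 < s <= 1 -> 0 <= v s.
Proof.
move=> s01; have /andP[s0 _] := s01; have /andP[? _] := x01 s01.
by rewrite divr_ge0// ltW.
Qed.

Let v_bigO : bigO_pow 0 v.
Proof.
have [C HC] := x_bigO; exists C => s s01; have /andP[s0 _] := s01.
rewrite mulr1 /v normrM normfV (gtr0_norm s0) ler_pdivrMr//.
exact: HC.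
Qed.

Let E s : R := (expR (1 * s ^+ 2) - 1) / s ^+ 2.

Let rem s := (expR (s ^+ 2) * (1 - x s) - \sum_(i < k) (- x s) ^+ i * f i) / s ^+ 2.

Let rem_bigO : bigO_pow n.+1 rem.
Proof.
have [C HC] := bigO_powX k x_bigO.
exists (f k * C) => s s01; have /andP[s0 _] := s01.
have s2 : 0 < s ^+ 2 by rewrite exprn_gt0.
rewrite /rem normrM normfV (gtr0_norm s2) ler_pdivrMr//.
apply: (le_trans (taylor s01)).
rewrite -!mulrA ler_wpM2l ?f_ge0// -exprD.
have := HC _ s01; rewrite muln1 {2}kE addn2 ger0_norm ?exprn_ge0//.
by have /andP[] := x01 s01.
Qed.

(** The functional equation divided by s^2. The unknown v = x / s occurs on the
    right only with a factor s, up to the error rem. *)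
Let v2_eq s : 0 < s <= 1 -> f 2%N * v s ^+ 2 =
  E s * (1 - s * v s) +
  s * (\sum_(i < n) ((-1) ^+ i * f i.+3) * (s ^+ i * v s ^+ i.+3)) - rem s.
Proof.
move=> s01; have /andP[s0 _] := s01.
have s2 : s ^+ 2 != 0 by rewrite gt_eqF// exprn_gt0.
apply: (mulIf s2); rewrite mulrBl mulrDl /rem divfK//.
have -> : E s * (1 - s * v s) * s ^+ 2 = (expR (s ^+ 2) - 1) * (1 - x s).
  by rewrite /E mul1r xE//; field; rewrite gt_eqF.
have -> : \sum_(i < k) (- x s) ^+ i * f i = \sum_(i < n.+3) (- x s) ^+ i * f i.
  by rewrite -kE.
rewrite !big_ord_recl /= f0 f1.
rewrite (_ : \sum_(i < n) (- x s) ^+ bump 0 (bump 0 (bump 0 i)) * f (bump 0 (bump 0 (bump 0 i))) =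
  - (s * (\sum_(i < n) (-1) ^+ i * f i.+3 * (s ^+ i * v s ^+ i.+3)) * s ^+ 2)); last first.
  rewrite mulr_sumr mulr_suml -sumrN; apply: eq_bigr => i _.
  rewrite /bump /= !add1n xE// -mulrN exprMn [(- v s) ^+ _]exprNn !exprS; ring.
rewrite xE//; rewrite /bump /= !add1n; ring.
Qed.

Let f2_neq0 : f 2%N != 0. Proof. by rewrite gt_eqF. Qed.

Let E_bigO : bigO_pow 1 (fun s => E s - 1).
Proof.
exists (expR 1) => s /andP[s0 s1].
have s2 : 0 < s ^+ 2 by rewrite exprn_gt0.
have s21 : s ^+ 2 <= 1 by rewrite exprn_ile1// ltW.
have -> : E s - 1 = (expR (s ^+ 2) - 1 - s ^+ 2) / s ^+ 2.
  by rewrite /E mul1r [in RHS]mulrBl divff// gt_eqF.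
rewrite normrM normfV (gtr0_norm s2) ler_pdivrMr//.
have := @expR_taylor R 2 (s ^+ 2); rewrite (gtr0_norm s2) => /(_ s21).
rewrite !big_ord_recr big_ord0 /= add0r !fact0 !divr1 opprD addrA.
move/le_trans; apply.
rewrite -mulrA ler_wpM2l ?expR_ge0// -exprD -exprM.
by rewrite ler_wiXn2l// ltW.
Qed.

Let d := Num.sqrt (f 2%N)^-1.
Let d_gt0 : 0 < d. Proof. by rewrite sqrtr_gt0 invr_gt0. Qed.

(** f_2 v^2 = 1 + O(s), and v is the nonnegative square root. *)
Let v_first_order : bigO_pow 1 (fun s => v s - d).
Proof.
have B1 : bigO_pow 1 (fun s => f 2%N * v s ^+ 2 - 1).
  have BW i : bigO_pow 0 (fun s => (-1) ^+ i * f i.+3 * (s ^+ i * v s ^+ i.+3)).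
    apply: bigO_powZ; apply: (bigO_powM (m := 0) (n := 0)).
      exact: (bigO_powW (leq0n _) (@bigO_pow_exp R i)).
    by have := bigO_powX i.+3 v_bigO; rewrite muln0.
  have BS : bigO_pow 0 (fun s => \sum_(i < n) (-1) ^+ i * f i.+3 * (s ^+ i * v s ^+ i.+3)).
    elim: n => [|m IHm].
      by apply: eq_bigO_pow (bigO_pow_cst 0) => s _; rewrite big_ord0.
    by apply: eq_bigO_pow (bigO_powD IHm (BW m)) => s _; rewrite big_ord_recr.
  have Bsv := bigO_powM (@bigO_pow_id R) v_bigO; rewrite addn0 in Bsv.
  have B0 : bigO_pow 0 (fun s => 1 - s * v s).
    by apply: bigO_powB; [exact: bigO_pow_cst|exact: bigO_powW Bsv].
  have BEsv := bigO_powM E_bigO B0; rewrite addn0 in BEsv.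
  have BsS := bigO_powM (@bigO_pow_id R) BS; rewrite addn0 in BsS.
  have Brem : bigO_pow 1 rem by exact: bigO_powW rem_bigO.
  apply: eq_bigO_pow (bigO_powB (bigO_powB (bigO_powD BEsv BsS) Bsv) Brem) => s s01.
  by rewrite v2_eq//; ring.
have [C HC] := B1.
exists (C * ((f 2%N)^-1 / d)) => s s01; have /andP[s0 s1] := s01.
have vd : 0 < v s + d by rewrite ltr_wpDl ?v_ge0.
have -> : v s - d = (f 2%N * v s ^+ 2 - 1) * ((f 2%N)^-1 / (v s + d)).
  have d2 : d ^+ 2 = (f 2%N)^-1 by rewrite sqr_sqrtr// invr_ge0 ltW.
  rewrite mulrA mulrBl mul1r mulrAC mulfV// mul1r -d2 subr_sqr mulfK//.
  by rewrite gt_eqF.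
rewrite normrM mulrAC ler_pM ?normr_ge0//; first exact: HC.
have f2i : 0 <= (f 2%N)^-1 by rewrite invr_ge0 ltW.
rewrite ger0_norm; last by rewrite divr_ge0// ltW.
rewrite ler_pM2l ?invr_gt0// lef_pV2 ?posrE//.
by rewrite lerDr v_ge0.
Qed.

(** One more order. The equation gives v^2 to order m + 2. If v = D + e with
    e = O(s^(m+1)), then e (v + D - 2d) is O(s^(m+2)), so that
    2 d e = v^2 - D^2 up to that order. *)
Let v_step m : (m < n)%N -> near_poly m.+1 v -> near_poly m.+2 v.
Proof.
move=> mn Hv.
have Hv2 : near_poly m.+2 (fun s => v s ^+ 2).
  have HW i : near_poly m.+1 (fun s => (-1) ^+ i * f i.+3 * (s ^+ i * v s ^+ i.+3)).
    apply: near_polyZ; apply: near_polyM; apply: near_polyX => //.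
    exact: near_poly_id.
  have HS := near_polyS (near_poly_sum (index_enum 'I_n) HW).
  have Hsv := near_polyB (near_poly_cst m.+2 1) (near_polyS Hv).
  have HE := near_polyM (@near_poly_expR R m.+2 1 (normr1 _)) Hsv.
  have Hrem : near_poly m.+2 rem by apply/near_poly_bigO/(bigO_powW _ rem_bigO).
  apply: eq_near_poly (near_polyZ (f 2%N)^-1 (near_polyB (near_polyD HE HS) Hrem)).
  by move=> s s01; rewrite -v2_eq// mulKf.
have [D HD] := Hv.
have He1 : bigO_pow 1 (fun s => v s - D.[s]) by exact: bigO_powW HD.
have He2 := bigO_powM HD (bigO_powB (bigO_powZ 2 v_first_order) He1).
rewrite addn1 in He2.
have HQ := near_polyB (near_polyB Hv2 (near_poly_horner m.+2 (D ^+ 2)))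
  (near_poly_bigO He2).
apply: eq_near_poly (near_polyD (near_poly_horner m.+2 D) (near_polyZ (2 * d)^-1 HQ)).
move=> s s01; have d0 : d != 0 by rewrite gt_eqF.
by rewrite horner_exp; field.
Qed.

Let v_near_poly : near_poly n.+1 v.
Proof.
suff H m : (m <= n)%N -> near_poly m.+1 v by exact: H.
elim: m => [_|m IHm mn]; last by apply: v_step => //; apply: IHm; exact: ltnW.
by exists d%:P; apply: eq_bigO_pow v_first_order => s _; rewrite hornerC.
Qed.

Lemma puiseux_expansion : exists (D : {poly R}) (C : R), forall s, 0 < s <= 1 ->
  `|Y (s ^+ 2) - expR (- s ^+ 2) - s * D.[s]| <= C * s ^+ k.-1.
Proof.
have H1 := near_polyN (near_polyM (near_poly_id R n.+1)
  (near_poly_expR n.+1 (_ : `|-1 : R| = 1))).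
have [|D [C HC]] := near_polyB (H1 _) v_near_poly; first by rewrite normrN1.
exists D, C => s s01; have /andP[s0 _] := s01.
have := HC _ s01; rewrite -(ler_pM2l s0) -{1}(gtr0_norm s0) -normrM.
rewrite [s * (C * _)]mulrCA -exprS (_ : k.-1 = n.+2)//; last by rewrite kE.
congr (_ <= _); congr (`|_|).
rewrite mulrBr mulrBr -xE// /x mulN1r; field.
by rewrite gt_eqF.
Qed.

End puiseux.

(** * Integrals over the real line *)

Section real_line.
Variable R : realType.
Local Notation mu := (@lebesgue_measure R).
Implicit Types (f g rho : R -> R) (a : R[i]).

Lemma integrable_exp_abs (e : R) : 0 < e ->
  mu.-integrable setT (EFin \o (fun u => expR (- (e * `|u|)))).
Proof.
move=> e0.
have cf : continuous (fun u : R => expR (- (e * `|u|))).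
  move=> u; apply: (@continuous_comp _ _ _ (fun u => - (e * `|u|)) expR).
    by apply: cvgN; apply: cvgM; [exact: cvg_cst|exact: cvg_norm].
  exact: continuous_expR.
apply/integrableP; split.
  by apply/measurable_EFinP; exact: continuous_measurable_fun.
under eq_integral => u _ do rewrite /= ger0_norm ?expR_ge0//.
rewrite (ge0_symfun_integralT _ cf);
  [|by move=> u; exact: expR_ge0|by move=> u /=; rewrite normrN].
rewrite -set_itvcy.
have -> : (\int[mu]_(x in `[0%R, +oo[) (expR (- (e * `|x|)))%:E =
    \int[mu]_(x in `[0%R, +oo[) (expR (- (e * x)))%:E)%E.
  by apply: eq_integral => u /[!inE] /=; rewrite in_itv/= andbT => u0;
    rewrite ger0_norm.
pose F u : R := - e^-1 * expR (- (e * u)).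
have dF (u : R) : is_derive u 1 F (expR (- (e * u))).
  rewrite /F; apply: is_derive_eq.
  by rewrite /GRing.scale /= mulr1 !mulrN mulNr opprK mulrCA mulVf ?mulr1 ?gt_eqF.
rewrite (@ge0_continuous_FTC2y _ _ F 0 0).
- by rewrite -EFinB -EFinM ltry.
- by move=> u _; exact: expR_ge0.
- apply: continuous_subspaceT => u.
  apply: (@continuous_comp _ _ _ (fun u => - (e * u)) expR).
    by apply: cvgN; apply: cvgM; [exact: cvg_cst|exact: cvg_id].
  exact: continuous_expR.
- rewrite /F -[X in _ --> X](mulr0 (- e^-1)); apply: cvgMr.
  apply: (@cvg_comp _ _ _ (fun u => e * u) (fun u => expR (- u)));
    last exact: cvgr_expR.
  by apply: gt0_cvgMry => //; exact: cvg_id.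
- by move=> u _; have [] := dF u.
- apply: cvg_at_right_filter; apply: differentiable_continuous.
  by apply/derivable1_diffP; have [] := dF 0.
- by move=> u _; rewrite derive1E; have [] := dF u.
Qed.

Lemma cvg_squeeze0 (f g : nat -> R) : (forall n, `|f n| <= g n) ->
  g @ \oo --> 0 -> f @ \oo --> 0.
Proof.
move=> fg g0; apply: norm_cvg0.
apply: (squeeze_cvgr _ (cvg_cst 0) g0); near=> n.
by rewrite normr_ge0 fg.
Unshelve. all: by end_near. Qed.

(** The fundamental theorem of calculus on the segments [a_n, b_n], which exhaust
    D, followed by dominated convergence. It serves the whole line and the
    half-line alike. *)
Lemma integral_derivative_exhaustion (D : set R) (a_ b_ : nat -> R)
    (F f : R -> R) (l : R) :
  measurable D ->
  (forall n, a_ n < b_ n) -> (forall n, `[a_ n, b_ n] `<=` D) ->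
  (forall u, D u -> \forall n \near \oo, a_ n <= u <= b_ n) ->
  (forall u : R, is_derive u 1 F (f u)) -> continuous f ->
  mu.-integrable D (EFin \o f) ->
  (fun n => F (b_ n) - F (a_ n)) @ \oo --> l ->
  \int[mu]_(u in D) f u = l.
Proof.
move=> mD ab abD Dab dF cf intf Fl.
pose f_ n := (EFin \o f) \_ `[a_ n, b_ n].
have Ff n : (\int[mu]_(u in D) f_ n u = (F (b_ n) - F (a_ n))%:E)%E.
  rewrite -integral_mkcondr setIidr// EFinB; apply: continuous_FTC2 => //.
  - exact: continuous_subspaceT.
  - have cF : continuous F.
      move=> u; apply: differentiable_continuous.
      by apply/derivable1_diffP; have [] := dF u.
    split; [by move=> u _; have [] := dF u | |].
      by apply: cvg_at_right_filter; exact: cF.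
    by apply: cvg_at_left_filter; exact: cF.
  - by move=> u _; rewrite derive1E; have [] := dF u.
have := @dominated_cvg _ _ R mu D mD f_ (EFin \o f) (fun u => `|f u|%:E).
have -> : (fun n => \int[mu]_(u in D) f_ n u)%E = EFin \o (fun n => F (b_ n) - F (a_ n)).
  by apply/funext => n; exact: Ff.
move=> H; have {}H := H _ _ _ _ _.
have HE : (EFin \o (fun n => F (b_ n) - F (a_ n))) @ \oo --> l%:E by apply: cvg_comp Fl _; exact: cvg_id.
rewrite /Rintegral -[RHS]/(fine l%:E); congr fine.
apply: (cvg_unique _ _ HE) => //; apply: H.
- move=> n; apply/measurable_restrict => //.
  by apply/measurable_funTS/measurable_EFinP; exact: continuous_measurable_fun.
- move=> u Du; apply: cvg_near_cst; have := Dab u Du; apply: filterS => n un.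
  by rewrite /f_ patchE mem_set//= in_itv.
- by [].
- exact: (integrable_abse intf).
- move=> n u Du; rewrite /f_ patchE; case: ifP => _ /=; first by [].
  by rewrite normr0 lee_fin.
Qed.

(** Change of variables is applied to the nonnegative functions f + |f| and
    |f|. *)
Lemma integral_shift (f : R -> R) (c : R) : continuous f ->
  mu.-integrable setT (EFin \o f) ->
  mu.-integrable setT (EFin \o (fun u => f (u - c))) /\
  \int[mu]_u f (u - c) = \int[mu]_u f u.
Proof.
move=> cf intf.
have shift0 (g : R -> R) : continuous g -> (forall u, 0 <= g u) ->
    (\int[mu]_u (g u)%:E = \int[mu]_u (g (u - c))%:E)%E.
  move=> cg g0.
  have dF (u : R) : is_derive u 1 (fun u : R => u - c) 1.
    by apply: is_derive_eq; rewrite subr0.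
  have F1 : derive1 (fun u : R => u - c) = fun=> 1.
    by apply/funext => u; rewrite derive1E; have [] := dF u.
  rewrite (@increasing_ge0_integration_by_substitutionT _ (fun u => u - c)) ?F1//.
  - by apply: eq_integral => u _; rewrite /= mulr1.
  - by move=> x y; rewrite ltrD2r.
  - by move=> x; exact: cvg_cst.
  - exact: is_cvg_cst.
  - exact: is_cvg_cst.
  - exact: (cvg_addrr_Ny (- c)).
  - exact: (cvg_addrr (- c)).
have cn : continuous (fun u => `|f u|).
  by move=> u; apply: cvg_norm; exact: cf.
have cc : continuous (fun u : R => u - c).
  by move=> u; apply: cvgB; [exact: cvg_id|exact: cvg_cst].
have csh (g : R -> R) : continuous g -> continuous (fun u => g (u - c)).
  by move=> cg u; apply: (@continuous_comp _ _ _ (fun u => u - c) g); [exact: cc|exact: cg].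
have mc (g : R -> R) : continuous g -> measurable_fun setT (EFin \o g).
  by move=> cg; apply/measurable_EFinP; exact: continuous_measurable_fun.
have intg (g : R -> R) : continuous g -> mu.-integrable setT (EFin \o g) ->
    mu.-integrable setT (EFin \o (fun u => g (u - c))).
  move=> cg /integrableP[_ ig]; apply/integrableP; split; first exact: (mc _ (csh _ cg)).
  have cng : continuous (fun u => `|g u|) by move=> u; apply: cvg_norm; exact: cg.
  by rewrite /= -(shift0 (fun u => `|g u|)).
have intn : mu.-integrable setT (EFin \o (fun u => `|f u|)).
  exact: (integrable_norm intf).
split; first exact: intg.
have cp : continuous (fun u => f u + `|f u|).
  by move=> u; apply: cvgD; [exact: cf|exact: cn].
have -> : \int[mu]_u f (u - c) =
    \int[mu]_u ((f (u - c) + `|f (u - c)|) - `|f (u - c)|).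
  by apply: eq_Rintegral => u _; rewrite addrK.
have -> : \int[mu]_u f u = \int[mu]_u ((f u + `|f u|) - `|f u|).
  by apply: eq_Rintegral => u _; rewrite addrK.
have ifc := intg _ cf intf; have inc := intg _ cn intn.
rewrite !RintegralB//; last 2 first.
  exact: (integrableD measurableT intf intn).
  exact: (integrableD measurableT ifc inc).
rewrite /Rintegral; congr (fine _ - fine _).
  rewrite -(shift0 (fun u => f u + `|f u|))// => u.
  by rewrite -lerBlDr sub0r lerNnormlW.
by rewrite -(shift0 (fun u => `|f u|)).
Qed.

End real_line.

(** * Two-sided Laplace transforms *)

Section laplace.
Variable R : realType.
Local Notation mu := (@lebesgue_measure R).
Implicit Types (f g rho : R -> R) (a : R[i]).
Local Notation Re := complex.Re.
Local Notation Im := complex.Im.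

(** The real part of e^{au}; the imaginary part is e_im, see cexpE. *)
Definition e_re a (u : R) : R := expR (Re a * u) * cos (Im a * u).
Definition e_im a (u : R) : R := expR (Re a * u) * sin (Im a * u).

Lemma cexpE a u : cexp (a * u%:C) = e_re a u +i* e_im a u.
Proof.
case: a => x y; rewrite /cexp /e_re /e_im; simpc => /=.
by rewrite ?mulr0 ?mul0r ?subr0 ?add0r ?addr0.
Qed.

Lemma norm_e_re a u : `|e_re a u| <= expR (Re a * u).
Proof.
by rewrite normrM (ger0_norm (expR_ge0 _)) ler_piMr ?expR_ge0// cos_max.
Qed.

Lemma norm_e_im a u : `|e_im a u| <= expR (Re a * u).
Proof.
by rewrite normrM (ger0_norm (expR_ge0 _)) ler_piMr ?expR_ge0// sin_max.
Qed.

Lemma continuous_mull (c : R) : continuous (fun u : R => c * u).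
Proof. by move=> u; apply: cvgM; [exact: cvg_cst|exact: cvg_id]. Qed.

Lemma continuous_expRM (c : R) : continuous (fun u : R => expR (c * u)).
Proof.
move=> u; apply: (@continuous_comp _ _ _ (fun u => c * u) expR).
  exact: continuous_mull.
exact: continuous_expR.
Qed.

Lemma continuous_e_re a : continuous (e_re a).
Proof.
move=> u; apply: cvgM; first exact: continuous_expRM.
apply: (@continuous_comp _ _ _ (fun u => Im a * u) cos).
  exact: continuous_mull.
exact: continuous_cos.
Qed.

Lemma continuous_e_im a : continuous (e_im a).
Proof.
move=> u; apply: cvgM; first exact: continuous_expRM.
apply: (@continuous_comp _ _ _ (fun u => Im a * u) sin).
  exact: continuous_mull.
exact: continuous_sin.
Qed.

Lemma is_derive_e_re a (u : R) :
  is_derive u 1 (e_re a) (Re a * e_re a u - Im a * e_im a u).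
Proof.
rewrite /e_re /e_im; apply: is_derive_eq.
by rewrite /GRing.scale /=; ring.
Qed.

Lemma is_derive_e_im a (u : R) :
  is_derive u 1 (e_im a) (Re a * e_im a u + Im a * e_re a u).
Proof.
rewrite /e_re /e_im; apply: is_derive_eq.
by rewrite /GRing.scale /=; ring.
Qed.

(** Finiteness of the transform in the half-plane Re a < b, in a robust form:
    since x ranges over an open interval, boundedness for nearby values of x
    yields exponential decay at both ends (decay_exp_abs). *)
Definition decay (b : R) rho := measurable_fun setT rho /\
  forall x, x < b -> exists C, forall u, expR (x * u) * `|rho u| <= C.

Lemma decay_exp_abs b rho x : decay b rho -> x < b ->
  exists e C, 0 < e /\ forall u, expR (x * u) * `|rho u| <= C * expR (- (e * `|u|)).
Proof.
move=> [_ H] xb; pose e := (b - x) / 2.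
have e0 : 0 < e by rewrite /e; lra.
have [C1 HC1] := H (x + e) ltac:(rewrite /e; lra).
have [C2 HC2] := H (x - e) ltac:(rewrite /e; lra).
exists e, (Num.max C1 C2); split=> // u.
have [u0|u0] := leP 0 u.
- rewrite (_ : x * u = (x + e) * u + - (e * `|u|)); last first.
    by rewrite ger0_norm//; ring.
  rewrite expRD mulrAC ler_wpM2r ?expR_ge0// (le_trans (HC1 u))//.
  by rewrite le_max lexx.
- rewrite (_ : x * u = (x - e) * u + - (e * `|u|)); last first.
    by rewrite ltr0_norm//; ring.
  rewrite expRD mulrAC ler_wpM2r ?expR_ge0// (le_trans (HC2 u))//.
  by rewrite le_max lexx orbT.
Qed.

Lemma decay_integrable b rho (h : R -> R) x : decay b rho -> x < b ->
  measurable_fun setT h -> (forall u, `|h u| <= expR (x * u)) ->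
  mu.-integrable setT (EFin \o (fun u => h u * rho u)).
Proof.
move=> drho xb mh hx; have [e [C [e0 HC]]] := decay_exp_abs drho xb.
have C0 : 0 <= C.
  have := HC 0; rewrite normr0 !mulr0 oppr0 expR0 mul1r mulr1.
  by apply: le_trans.
apply: (le_integrable measurableT _ _
  (integrableZl measurableT C (integrable_exp_abs e0))).
- apply/measurable_EFinP; apply: measurable_funM => //; exact: drho.1.
- move=> u _ /=; rewrite lee_fin normrM [leRHS]ger0_norm ?mulr_ge0 ?expR_ge0//.
  by apply: le_trans (HC u); rewrite ler_wpM2r.
Qed.

Lemma integrable_e_re b rho a : decay b rho -> Re a < b ->
  mu.-integrable setT (EFin \o (fun u => e_re a u * rho u)).
Proof.
move=> drho ab; apply: (decay_integrable drho ab _ (norm_e_re a)).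
exact: (continuous_measurable_fun (@continuous_e_re a)).
Qed.

Lemma integrable_e_im b rho a : decay b rho -> Re a < b ->
  mu.-integrable setT (EFin \o (fun u => e_im a u * rho u)).
Proof.
move=> drho ab; apply: (decay_integrable drho ab _ (norm_e_im a)).
exact: (continuous_measurable_fun (@continuous_e_im a)).
Qed.

(** The integral over the real line of e^{au} rho(u) du. *)
Definition laplace rho a : R[i] :=
  (\int[mu]_u (e_re a u * rho u)) +i* (\int[mu]_u (e_im a u * rho u)).

Lemma eq_laplace rho rho' a : rho =1 rho' -> laplace rho a = laplace rho' a.
Proof. by move=> /funext ->. Qed.

Lemma laplaceD b rho rho' a : decay b rho -> decay b rho' -> Re a < b ->
  laplace (fun u => rho u + rho' u) a = laplace rho a + laplace rho' a.
Proof.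
move=> d1 d2 ab; rewrite /laplace; simpc; congr (_ +i* _).
- rewrite -RintegralD//; [|exact: integrable_e_re ab|exact: integrable_e_re ab].
  by apply: eq_Rintegral => u _; rewrite mulrDr.
- rewrite -RintegralD//; [|exact: integrable_e_im ab|exact: integrable_e_im ab].
  by apply: eq_Rintegral => u _; rewrite mulrDr.
Qed.

Lemma laplaceZ b rho a c : decay b rho -> Re a < b ->
  laplace (fun u => c * rho u) a = c%:C * laplace rho a.
Proof.
move=> d1 ab; rewrite /laplace; simpc.
rewrite -!RintegralZl//; [|exact: integrable_e_im ab|exact: integrable_e_re ab].
by congr (_ +i* _); apply: eq_Rintegral => u _; rewrite mulrCA.
Qed.

Lemma decay0 b : decay b (fun=> 0).
Proof.
by split=> [|x _]; [exact: measurable_cst|exists 0 => u; rewrite normr0 mulr0].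
Qed.

Lemma decayD b rho rho' : decay b rho -> decay b rho' ->
  decay b (fun u => rho u + rho' u).
Proof.
move=> [m1 H1] [m2 H2]; split; first exact: measurable_funD.
move=> x xb; have [C1 HC1] := H1 x xb; have [C2 HC2] := H2 x xb.
exists (C1 + C2) => u; apply: le_trans (lerD (HC1 u) (HC2 u)).
by rewrite -mulrDr ler_wpM2l ?expR_ge0// ler_normD.
Qed.

Lemma decayZ b rho c : decay b rho -> decay b (fun u => c * rho u).
Proof.
move=> [m1 H1]; split; first exact: measurable_funM.
move=> x xb; have [C HC] := H1 x xb; exists (`|c| * C) => u.
by rewrite normrM mulrCA ler_wpM2l.
Qed.

Lemma decayB b rho rho' : decay b rho -> decay b rho' ->
  decay b (fun u => rho u - rho' u).
Proof.
move=> d1 /(decayZ (-1)) d2; have := decayD d1 d2; congr decay.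
by apply/funext => u; rewrite mulN1r.
Qed.

Lemma laplaceB b rho rho' a : decay b rho -> decay b rho' -> Re a < b ->
  laplace (fun u => rho u - rho' u) a = laplace rho a - laplace rho' a.
Proof.
move=> d1 d2 ab.
rewrite (@eq_laplace _ (fun u => rho u + (-1) * rho' u)); last first.
  by move=> u; rewrite mulN1r.
rewrite (laplaceD d1 (decayZ (-1) d2) ab) (laplaceZ _ d2 ab).
by rewrite rmorphN1 mulN1r.
Qed.

Lemma decayW b b' rho : b' <= b -> decay b rho -> decay b' rho.
Proof. by move=> bb [m H]; split=> // x xb; apply: H; exact: lt_le_trans bb. Qed.


Lemma measurable_expRM (c : R) : measurable_fun setT (fun u : R => expR (c * u)).
Proof. exact: (continuous_measurable_fun (@continuous_expRM c)). Qed.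

Lemma decay_expM b rho c : decay b rho ->
  decay (b + c) (fun u => expR (- c * u) * rho u).
Proof.
move=> [m H]; split.
  by apply: measurable_funM => //; exact: measurable_expRM.
move=> x xbc; have [|C HC] := H (x - c); first by rewrite ltrBlDr.
exists C => u; apply: le_trans (HC u).
by rewrite normrM (ger0_norm (expR_ge0 _)) mulrA -expRD -mulrDl.
Qed.

Lemma laplace_expM rho c a :
  laplace (fun u => expR (- c * u) * rho u) a = laplace rho (a - c%:C).
Proof.
case: a => x y; rewrite /laplace; simpc.
by congr (_ +i* _); apply: eq_Rintegral => u _;
  rewrite mulrA; congr (_ * _); rewrite /e_re /e_im /= ?subr0 mulrAC -expRD -mulrDl.
Qed.

Lemma decay_shift b rho c : decay b rho -> decay b (fun u => rho (u - c)).
Proof.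
move=> [m H]; split.
  apply: (@measurableT_comp _ _ _ _ _ _ rho) => //.
  exact: measurable_funB.
move=> x xb; have [C HC] := H x xb; exists (expR (x * c) * C) => u.
have -> : x * u = x * c + x * (u - c) by ring.
by rewrite expRD -mulrA ler_wpM2l ?expR_ge0.
Qed.

Lemma laplace_shift b rho c a : decay b rho -> continuous rho -> Re a < b ->
  laplace (fun u => rho (u - c)) a = cexp (a * c%:C) * laplace rho a.
Proof.
move=> drho crho ab.
have i1 := integrable_e_re drho ab; have i2 := integrable_e_im drho ab.
have cr : continuous (fun w => e_re a w * rho w).
  by move=> w; apply: cvgM; [exact: continuous_e_re|exact: crho].
have ci : continuous (fun w => e_im a w * rho w).
  by move=> w; apply: cvgM; [exact: continuous_e_im|exact: crho].
have [j1 s1] := integral_shift c cr i1.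
have [j2 s2] := integral_shift c ci i2.
have ZL (k : R) (f : R -> R) : mu.-integrable setT (EFin \o f) ->
    mu.-integrable setT (EFin \o (fun u => k * f u)).
  by move=> jf; exact: (integrableZl _ k jf).
rewrite cexpE /laplace -s1 -s2; simpc; congr (_ +i* _).
- rewrite -!RintegralZl// -RintegralB//; try exact: ZL.
  apply: eq_Rintegral => u _; rewrite /e_re /e_im.
  have {1 2}-> : u = c + (u - c) by ring.
  rewrite !mulrDr expRD cosD; ring.
- rewrite -!RintegralZl// -RintegralD//; try exact: ZL.
  apply: eq_Rintegral => u _; rewrite /e_re /e_im.
  have {1 2}-> : u = c + (u - c) by ring.
  rewrite !mulrDr expRD sinD; ring.
Qed.

Lemma cvg_expR_neg (e : R) : 0 < e -> (fun n : nat => expR (- (e * n%:R))) @ \oo --> (0 : R).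
Proof.
move=> e0; apply: (@cvg_comp _ _ _ (fun n : nat => n%:R) (fun u => expR (- (e * u)))).
  exact: cvgr_idn.
apply: (@cvg_comp _ _ _ (fun u => e * u) (fun u => expR (- u)));
  last exact: cvgr_expR.
by apply: gt0_cvgMry => //; exact: cvg_id.
Qed.

Lemma decay_cvg0 b rho (h : R -> R) x (s : R) : decay b rho -> x < b -> `|s| = 1 ->
  (forall u, `|h u| <= expR (x * u)) ->
  (fun n : nat => h (s * n.+1%:R) * rho (s * n.+1%:R)) @ \oo --> (0 : R).
Proof.
move=> drho xb s1 hx; have [e [C [e0 HC]]] := decay_exp_abs drho xb.
apply: (@cvg_squeeze0 _ _ (fun n => C * expR (- (e * n.+1%:R)))).
  move=> n; rewrite normrM; apply: le_trans (_ : expR (x * (s * n.+1%:R)) * `|rho (s * n.+1%:R)| <= _).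
    by rewrite ler_wpM2r.
  by apply: (le_trans (HC _)); rewrite normrM s1 mul1r normr_nat.
rewrite -[X in _ --> X](mulr0 C); apply: cvgM; first exact: cvg_cst.
have := cvg_expR_neg e0; rewrite -(cvg_shiftS (fun n : nat => expR (- (e * n%:R)))).
exact.
Qed.

(** Integration by parts: the real and imaginary parts of the derivative of
    e^{au} rho(u) have integral zero, as that function vanishes at both ends. *)
Lemma laplace_derive b rho rho' a : decay b rho -> decay b rho' ->
  (forall u : R, is_derive u 1 rho (rho' u)) -> continuous rho' -> Re a < b ->
  laplace rho' a = - a * laplace rho a.
Proof.
move=> d1 d2 dr cr' ab.
have cr : continuous rho.
  move=> u; apply: differentiable_continuous.
  by apply/derivable1_diffP; have [] := dr u.
have ZL (k : R) (f : R -> R) : mu.-integrable setT (EFin \o f) ->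
    mu.-integrable setT (EFin \o (fun u => k * f u)).
  by move=> jf; exact: (integrableZl _ k jf).
have AD (f g : R -> R) : mu.-integrable setT (EFin \o f) ->
    mu.-integrable setT (EFin \o g) ->
    mu.-integrable setT (EFin \o (fun u => f u + g u)).
  by move=> jf jg; exact: (integrableD measurableT jf jg).
have key (F f : R -> R) (h : R -> R) :
    (forall u, `|h u| <= expR (Re a * u)) -> (forall u, F u = h u * rho u) ->
    (forall u : R, is_derive u 1 F (f u)) -> continuous f ->
    mu.-integrable setT (EFin \o f) -> \int[mu]_u f u = 0.
  move=> hx FE dF cf intf.
  apply: (@integral_derivative_exhaustion _ setT (fun n => - n.+1%:R) (fun n => n.+1%:R) F) => //.
  - by move=> n; have : 0 < n.+1%:R :> R by []; lra.
  - move=> u _; near=> n.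
    rewrite -ler_norml; near: n.
    by exists (Num.truncn `|u|).+1 => // n /= un; apply/ltW/(lt_le_trans (truncnS_gt _));
      rewrite ler_nat; exact: leqW.
  - rewrite -(subr0 0); apply: cvgB.
      have := decay_cvg0 d1 ab (normr1 _) hx.
      by under eq_fun do rewrite mul1r -FE.
    have := decay_cvg0 d1 ab (_ : `|-1 : R| = 1) hx.
    rewrite normrN1 => /(_ erefl).
    by under eq_fun do rewrite mulN1r -FE.
have ir := integrable_e_re d1 ab; have ii := integrable_e_im d1 ab.
have ir' := integrable_e_re d2 ab; have ii' := integrable_e_im d2 ab.
have K1 := key (fun u => e_re a u * rho u)
  (fun u => (Re a * (e_re a u * rho u) + - Im a * (e_im a u * rho u)) + e_re a u * rho' u)
  (e_re a) (norm_e_re a) (fun=> erefl).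
have K2 := key (fun u => e_im a u * rho u)
  (fun u => (Re a * (e_im a u * rho u) + Im a * (e_re a u * rho u)) + e_im a u * rho' u)
  (e_im a) (norm_e_im a) (fun=> erefl).
have {}K1 : Re a * \int[mu]_u (e_re a u * rho u) - Im a * \int[mu]_u (e_im a u * rho u)
   + \int[mu]_u (e_re a u * rho' u) = 0.
  rewrite -mulNr -!RintegralZl// -!RintegralD//; try by do ?[exact: (ZL _ _ _)|apply: (AD _ _ _ _)].
  apply: K1.
  - move=> u; have := is_derive_e_re a u; have := dr u => H1 H2.
    by apply: is_derive_eq; rewrite /GRing.scale /=; ring.
  - move=> u; have := @continuous_e_re a u; have := @continuous_e_im a u => c1 c2.
    apply: cvgD; [apply: cvgD|apply: cvgM => //; exact: cr'];
      (apply: cvgM; [exact: cvg_cst|apply: cvgM => //; exact: cr]).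
  - by apply: (AD _ _ _ _) => //; apply: (AD _ _ _ _); exact: (ZL _ _ _).
have {}K2 : Re a * \int[mu]_u (e_im a u * rho u) + Im a * \int[mu]_u (e_re a u * rho u)
   + \int[mu]_u (e_im a u * rho' u) = 0.
  rewrite -!RintegralZl// -!RintegralD//; try by do ?[exact: (ZL _ _ _)|apply: (AD _ _ _ _)].
  apply: K2.
  - move=> u; have := is_derive_e_im a u; have := dr u => H1 H2.
    by apply: is_derive_eq; rewrite /GRing.scale /=; ring.
  - move=> u; have := @continuous_e_re a u; have := @continuous_e_im a u => c1 c2.
    apply: cvgD; [apply: cvgD|apply: cvgM => //; exact: cr'];
      (apply: cvgM; [exact: cvg_cst|apply: cvgM => //; exact: cr]).
  - by apply: (AD _ _ _ _) => //; apply: (AD _ _ _ _); exact: (ZL _ _ _).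
case: a ab K1 K2 {key ir ii ir' ii'} => x y /= ab K1 K2.
rewrite /laplace; simpc; congr (_ +i* _); lra.
Unshelve. all: by end_near. Qed.

End laplace.

(** * Convergence and holomorphy of Laplace transforms *)

Section complex_topology.
Variable R : realType.
Local Notation Re := complex.Re.
Local Notation Im := complex.Im.
Implicit Types z w : R[i].

Lemma normc_le_abs z : `|z| <= (`|Re z| + `|Im z|)%:C.
Proof.
rewrite normc_def lecR -(@ler_pXn2r _ 2)// ?nnegrE ?sqrtr_ge0 ?addr_ge0//.
rewrite sqr_sqrtr ?addr_ge0 ?sqr_ge0// sqrrD !real_normK ?num_real//.
by rewrite lerD2r lerDl mulrn_wge0// mulr_ge0.
Qed.

Lemma abs_Re_le z : `|Re z|%:C <= `|z|.
Proof.
rewrite normc_def lecR -sqrtr_sqr ler_sqrt ?addr_ge0 ?sqr_ge0//.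
by rewrite lerDl sqr_ge0.
Qed.

Lemma abs_Im_le z : `|Im z|%:C <= `|z|.
Proof.
rewrite normc_def lecR -sqrtr_sqr ler_sqrt ?addr_ge0 ?sqr_ge0//.
by rewrite lerDr sqr_ge0.
Qed.

Lemma gt0_complexE z : 0 < z -> z = (Re z)%:C /\ 0 < Re z.
Proof.
by case: z => x y; rewrite ltcE /= => /andP[/eqP -> x0].
Qed.

Lemma cvg_complex (x_ y_ : nat -> R) (x y : R) :
  x_ @ \oo --> x -> y_ @ \oo --> y ->
  ((fun n => x_ n +i* y_ n) : nat -> CC R) @ \oo --> (x +i* y : CC R).
Proof.
move=> cx cy; apply/cvgrPdist_le => /= eps /gt0_complexE[-> e0].
have e2 : 0 < Re eps / 2 by rewrite divr_gt0.
move/cvgrPdist_le : cx => /(_ _ e2) cx; move/cvgrPdist_le : cy => /(_ _ e2) cy.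
near=> n; apply: le_trans (normc_le_abs _) _.
rewrite lecR /= [leRHS](splitr (Re eps)) lerD//; near: n; [exact: cx|exact: cy].
Unshelve. all: by end_near. Qed.

Let quadratic_le_linear (K m t e : R) : 0 <= m -> m <= 2 * t -> 0 < t ->
  t * (4 * (`|K| + 1)) <= e -> K * m ^+ 2 <= t * e.
Proof.
move=> m0 mt t0 H; have K1 : 0 < `|K| + 1 by rewrite ltr_wpDl.
apply: (@le_trans _ _ ((`|K| + 1) * (2 * t) ^+ 2)).
  apply: (@le_trans _ _ ((`|K| + 1) * m ^+ 2)).
    by rewrite ler_wpM2r ?sqr_ge0// (le_trans (ler_norm _))// lerDl ler01.
  apply: ler_wpM2l; first exact: ltW.
  by apply: lerXn2r => //; rewrite nnegrE mulr_ge0// ltW.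
rewrite -(ler_pM2l t0) in H; apply: le_trans H.
by rewrite le_eqVlt; apply/orP; left; apply/eqP; ring.
Qed.

(** A first order expansion with quadratic error gives the derivative. The size of h is
    measured by |Re h| + |Im h|, which is what estimates on real and imaginary
    parts produce. *)
Lemma complex_differentiable_quadratic (f : R[i] -> R[i]) z l (K r : R) :
  0 < r ->
  (forall h, `|Re h| + `|Im h| <= r ->
    `|f (z + h) - f z - h * l| <= (K * (`|Re h| + `|Im h|) ^+ 2)%:C) ->
  complex_differentiable f z.
Proof.
move=> r0 H; rewrite /complex_differentiable /derivable.
apply/cvg_ex; exists (l : CC R); apply/cvgrPdist_le => /= eps /gt0_complexE[-> e0].
set e := Re eps in e0 *.
pose q : R := Num.min (r / 2) (e / (4 * (`|K| + 1))).
have K1 : 0 < `|K| + 1 by rewrite ltr_wpDl.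
have q0 : 0 < q by rewrite lt_min !divr_gt0// mulr_gt0.
near=> h.
have h0 : h != 0.
  near: h.
  exact: (nbhs_dnbhs_neq (0 : (R[i] : numFieldType))).
have hq : `|h| <= q%:C.
  near: h.
  have qC : 0 < q%:C by rewrite ltcR.
  exact: (@dnbhs0_le _ ((R[i] : numFieldType) : pseudoMetricNormedZmodType _) _ qC).
set m : R := `|Re h| + `|Im h|.
have m2 : m%:C <= 2 * `|h|.
  by rewrite /m rmorphD mulr_natl mulr2n lerD ?abs_Re_le ?abs_Im_le.
have mr : m <= r.
  rewrite -lecR; apply: (le_trans m2).
  apply: (@le_trans _ _ (2 * q%:C)); first by rewrite ler_wpM2l.
  rewrite -(rmorph_nat (real_complex R)) -rmorphM /= lecR.
  by rewrite -ler_pdivlMl// mulrC ge_min lexx.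
have hE : `|h| = (Num.sqrt ((Re h) ^+ 2 + (Im h) ^+ 2))%:C by rewrite normc_def.
set t : R := Num.sqrt _ in hE.
have t0 : 0 < t.
  by rewrite -ltcR -hE normr_gt0.
rewrite hE lecR in hq.
have mt : m <= 2 * t.
  by move: m2; rewrite hE -(rmorph_nat (real_complex R)) -rmorphM /= lecR.
have m0 : 0 <= m by rewrite addr_ge0.
have := H h mr; rewrite -/m.
have -> : l - h^-1 *: (f (h *: 1 + z) - f z) = - (h^-1 * (f (z + h) - f z - h * l)).
  rewrite /GRing.scale /= mulr1 [h + z]addrC.
  by rewrite [in RHS]mulrBr [in RHS]mulKf// opprB.
rewrite normrN normrM normfV => Hh.
rewrite ler_pdivrMl ?normr_gt0//; apply: (le_trans Hh).
rewrite hE -rmorphM lecR.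
apply: (quadratic_le_linear m0 mt t0).
by rewrite -ler_pdivlMr ?mulr_gt0// (le_trans hq)// ge_min lexx orbT.
Unshelve. all: by end_near. Qed.

End complex_topology.

Section elementary.
Variable R : realType.
Implicit Types w y u : R.

Lemma expR_sub1_le w : `|expR w - 1| <= `|w| * expR `|w|.
Proof.
have H v : expR v - 1 <= v * expR v :> R.
  have := expR_ge1Dx (- v); rewrite expRN -(ler_pM2r (expR_gt0 v)) mulVf ?gt_eqF ?expR_gt0//.
  by rewrite mulrDl mul1r; lra.
have [w0|w0] := leP 0 w.
  by rewrite !ger0_norm// subr_ge0 -expR0 ler_expR.
rewrite ltr0_norm ?subr_lt0 -?[X in _ < X]expR0 ?ltr_expR// (ltr0_norm w0).
have := expR_ge1Dx w; have : 1 <= expR (- w) by rewrite -[leLHS]expR0 ler_expR oppr_ge0 ltW.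
have h3 : expR w <= 1 by rewrite -[leRHS]expR0 ler_expR ltW.
by move=> h1 h2; rewrite -[leLHS]mulr1 ler_pM//; lra.
Qed.

Lemma expR_taylor1 w : `|expR w - 1 - w| <= w ^+ 2 * expR `|w|.
Proof.
have h0 : 0 <= expR w - 1 - w by have := expR_ge1Dx w; lra.
have h1 : expR w - 1 - w <= w * (expR w - 1).
  have := expR_ge1Dx (- w); rewrite expRN -(ler_pM2r (expR_gt0 w)) mulVf ?gt_eqF ?expR_gt0//.
  by rewrite mulrDl mul1r; lra.
rewrite ger0_norm//; apply: (le_trans h1); apply: (le_trans (ler_norm _)).
rewrite normrM -[w ^+ 2]real_normK ?num_real// expr2 -mulrA ler_wpM2l//.
exact: expR_sub1_le.
Qed.

Lemma abs_sin_le y : `|sin y| <= `|y|.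
Proof.
suff H (v : R) : 0 <= v -> `|sin v| <= v.
  have [y0|/ltW y0] := leP 0 y; first by rewrite (ger0_norm y0) H.
  by rewrite (ler0_norm y0) -normrN -sinN H// oppr_ge0.
rewrite le_eqVlt => /predU1P[<-|v0]; first by rewrite sin0 normr0.
have [c _] := MVT v0 (fun x _ => is_derive_sin x)
  (continuous_subspaceT (@continuous_sin R)).
rewrite sin0 !subr0 => ->.
by rewrite normrM (gtr0_norm v0) ler_piMl ?cos_max// ltW.
Qed.

Lemma abs_cos_sub1_le y : `|cos y - 1| <= y ^+ 2.
Proof.
suff H (v : R) : 0 <= v -> `|cos v - 1| <= v ^+ 2.
  have [y0|/ltW y0] := leP 0 y; first exact: H.
  by rewrite -cosN -sqrrN H// oppr_ge0.
rewrite le_eqVlt => /predU1P[<-|v0]; first by rewrite cos0 subrr normr0 expr0n.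
have [c /[!in_itv]/= /andP[c0 cv]] := MVT v0 (fun x _ => is_derive_cos x)
  (continuous_subspaceT (@continuous_cos R)).
rewrite cos0 !subr0 => ->.
rewrite normrM (gtr0_norm v0) expr2 ler_pM2r// normrN.
by apply: (le_trans (abs_sin_le _)); rewrite gtr0_norm// ltW.
Qed.

Lemma abs_sin_subid_le y : `|sin y - y| <= y ^+ 2.
Proof.
suff H (v : R) : 0 <= v -> `|sin v - v| <= v ^+ 2.
  have [y0|/ltW y0] := leP 0 y; first exact: H.
  by rewrite -normrN opprD -sinN -sqrrN H// oppr_ge0.
rewrite le_eqVlt => /predU1P[<-|v0]; first by rewrite sin0 subrr normr0 expr0n.
have dsx (x : R) : is_derive x 1 (fun x => sin x - x) (cos x - 1).
  by apply: is_derive_eq.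
have csx : continuous (fun x : R => sin x - x).
  by move=> x; apply: cvgB; [exact: continuous_sin|exact: cvg_id].
have [c /[!in_itv]/= /andP[c0 cv]] := MVT v0 (fun x _ => dsx x)
  (continuous_subspaceT csx).
rewrite sin0 !subr0 => ->.
rewrite normrM (gtr0_norm v0) expr2 ler_pM2r//.
have [c' /[!in_itv]/= /andP[c0' cv']] := MVT c0 (fun x _ => is_derive_cos x)
  (continuous_subspaceT (@continuous_cos R)).
rewrite cos0 !subr0 => ->.
rewrite normrM (gtr0_norm c0) normrN.
by apply: (@le_trans _ _ c); [rewrite ler_piMl ?sin_max// ltW|exact: ltW].
Qed.

Lemma cexp_taylor_re w y (m : R) : `|w| <= m -> `|y| <= m ->
  `|expR w * cos y - 1 - w| <= 2 * m ^+ 2 * expR m.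
Proof.
move=> wm ym; have m0 : 0 <= m by exact: le_trans (normr_ge0 _) wm.
have -> : expR w * cos y - 1 - w = (expR w - 1 - w) + expR w * (cos y - 1) by ring.
have em : expR `|w| <= expR m by rewrite ler_expR.
have em' : expR w <= expR m by rewrite ler_expR (le_trans (ler_norm _)).
have w2 : w ^+ 2 <= m ^+ 2 by rewrite -[w ^+ 2]real_normK ?num_real// lerXn2r ?nnegrE.
have y2 : y ^+ 2 <= m ^+ 2 by rewrite -[y ^+ 2]real_normK ?num_real// lerXn2r ?nnegrE.
rewrite -mulrA mulr_natl mulr2n; apply: (le_trans (ler_normD _ _)); apply: lerD.
  apply: (le_trans (expR_taylor1 _)); rewrite ler_pM ?sqr_ge0 ?expR_ge0//.
rewrite normrM (ger0_norm (expR_ge0 _)) mulrC ler_pM ?expR_ge0//.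
exact: le_trans (abs_cos_sub1_le _) _.
Qed.

Lemma cexp_taylor_im w y (m : R) : `|w| <= m -> `|y| <= m ->
  `|expR w * sin y - y| <= 2 * m ^+ 2 * expR m.
Proof.
move=> wm ym; have m0 : 0 <= m by exact: le_trans (normr_ge0 _) wm.
have -> : expR w * sin y - y = (expR w - 1) * y + expR w * (sin y - y) by ring.
have em : expR `|w| <= expR m by rewrite ler_expR.
have em' : expR w <= expR m by rewrite ler_expR (le_trans (ler_norm _)).
have y2 : y ^+ 2 <= m ^+ 2 by rewrite -[y ^+ 2]real_normK ?num_real// lerXn2r ?nnegrE.
rewrite -mulrA mulr_natl mulr2n; apply: (le_trans (ler_normD _ _)); apply: lerD.
  rewrite normrM expr2 mulrAC ler_pM// (le_trans (expR_sub1_le _))//.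
  by rewrite ler_pM ?expR_ge0.
rewrite normrM (ger0_norm (expR_ge0 _)) mulrC ler_pM ?expR_ge0//.
exact: le_trans (abs_sin_subid_le _) _.
Qed.

Lemma sqr_le_expR (e u : R) : 0 < e -> u ^+ 2 <= 4 / e ^+ 2 * expR (e * `|u|).
Proof.
move=> e0; rewrite mulrAC ler_pdivlMr ?exprn_gt0//.
have -> : e * `|u| = e * `|u| / 2 + e * `|u| / 2 by field.
rewrite expRD; have := expR_ge1Dx (e * `|u| / 2).
have h : 0 <= e * `|u| / 2 by rewrite divr_ge0// mulr_ge0// ltW.
move=> H; have {}H : e * `|u| / 2 <= expR (e * `|u| / 2) by lra.
have := ler_pM h h H H; rewrite -[u ^+ 2]real_normK ?num_real//.
set E := expR _ * expR _ => HE; rewrite !expr2.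
have -> : `|u| * `|u| * (e * e) = 4 * (e * `|u| / 2 * (e * `|u| / 2)) by field.
by rewrite ler_wpM2l.
Qed.

End elementary.

Section laplace_analysis.
Variable R : realType.
Local Notation mu := (@lebesgue_measure R).
Implicit Types (rho : R -> R) (a h : R[i]).
Local Notation Re := complex.Re.
Local Notation Im := complex.Im.

Lemma decay_id b rho : decay b rho -> decay b (fun u => u * rho u).
Proof.
move=> drho; split; first by apply: measurable_funM => //; exact: drho.1.
move=> x xb; have [e [C [e0 HC]]] := decay_exp_abs drho xb.
have C0 : 0 <= C.
  have := HC 0; rewrite normr0 !mulr0 oppr0 expR0 mul1r mulr1.
  by apply: le_trans.
exists (C / e) => u; rewrite normrM mulrCA.
apply: (le_trans (ler_wpM2l (normr_ge0 u) (HC u))).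
rewrite mulrCA ler_wpM2l// -[leRHS]div1r ler_pdivlMr//.
rewrite expRN mulrAC ler_pdivrMr ?expR_gt0// mul1r mulrC.
by have := expR_ge1Dx (e * `|u|); lra.
Qed.

(** Differentiation under the integral sign: e^{hu} - 1 - hu is bounded by a
    multiple of |h|^2 u^2 e^{|h||u|}, and for small h this is absorbed by
    the exponential decay of e^{au} rho(u). *)
Lemma laplace_holomorphic b rho a : decay b rho -> Re a < b ->
  complex_differentiable (laplace rho) a.
Proof.
move=> drho ab; have [e [C [e0 HC]]] := decay_exp_abs drho ab.
have C0 : 0 <= C.
  have := HC 0; rewrite normr0 !mulr0 oppr0 expR0 mul1r mulr1.
  by apply: le_trans.
(* For |h| <= e/4 the factors e^{|h||u|} and u^2 use up half of the decay
   e^{-e|u|}; the other bound keeps a + h inside the half-plane. *)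
pose r := Num.min (e / 4) ((b - Re a) / 2).
have r0 : 0 < r by rewrite lt_min !divr_gt0// subr_gt0.
have e2 : 0 < e / 2 by rewrite divr_gt0.
have e4 : 0 < e / 4 by rewrite divr_gt0.
pose M := 4 * (4 / (e / 4) ^+ 2) * C.
pose B (u : R) := expR (- (e / 2 * `|u|)).
have iB : mu.-integrable setT (EFin \o B) by exact: integrable_exp_abs.
have bound (m u A : R) (m0 : 0 <= m) (mr : m <= r) :
    `|A| <= 4 * (m * `|u|) ^+ 2 * expR (m * `|u|) * expR (Re a * u) ->
    `|A * rho u| <= m ^+ 2 * (M * B u).
  move=> HA; rewrite normrM.
  apply: (@le_trans _ _ (4 * (m * `|u|) ^+ 2 * expR (m * `|u|) * (expR (Re a * u) * `|rho u|))).
    by rewrite mulrA ler_wpM2r.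
  have E1 : expR (m * `|u|) <= expR (e / 4 * `|u|).
    by rewrite ler_expR ler_wpM2r// (le_trans mr)// ge_min lexx.
  have E2 := sqr_le_expR u e4.
  set X := expR (m * `|u|) in E1 *; set Y := expR (e / 4 * `|u|) in E1 E2 *.
  have BE : B u = Y * Y * expR (- (e * `|u|)).
    by rewrite /B /Y -!expRD; congr expR; field.
  have X0 : 0 <= X := expR_ge0 _; have Y0 : 0 <= Y := expR_ge0 _.
  rewrite BE exprMn real_normK ?num_real//.
  apply: (@le_trans _ _ (4 * (m ^+ 2 * (4 / (e / 4) ^+ 2 * Y)) * Y * (C * expR (- (e * `|u|))))).
    have P0 : 0 <= 4 * (m ^+ 2 * u ^+ 2) :> R.
      by apply: mulr_ge0 => //; apply: mulr_ge0; exact: sqr_ge0.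
    apply: (ler_pM _ _ _ (HC u)).
    - exact: mulr_ge0.
    - by apply: mulr_ge0 => //; exact: expR_ge0.
    - apply: (ler_pM P0 X0 _ E1).
      by rewrite ler_wpM2l// ler_wpM2l ?sqr_ge0.
  by rewrite /M le_eqVlt; apply/orP; left; apply/eqP; ring.
have dnd := decay_id drho.
pose K := 2 * (\int[mu]_u (M * B u)).
apply: (@complex_differentiable_quadratic _ _ a (laplace (fun u => u * rho u) a) K r) => // h hr.
set m : R := `|Re h| + `|Im h| in hr *.
have m0 : 0 <= m by rewrite addr_ge0.
have ahb : Re (a + h) < b.
  have -> : Re (a + h) = Re a + Re h by case: (a) (h) => ? ? [].
  have := ler_norm (Re h); have : r <= (b - Re a) / 2 by rewrite ge_min lexx orbT.
  by have := normr_ge0 (Im h); rewrite /m in hr; lra.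
pose Dr u := e_re (a + h) u - e_re a u - (Re h * (u * e_re a u) - Im h * (u * e_im a u)).
pose Di u := e_im (a + h) u - e_im a u - (Re h * (u * e_im a u) + Im h * (u * e_re a u)).
have hum (p u : R) : `|p| <= m -> `|p * u| <= m * `|u|.
  by move=> pm; rewrite normrM ler_wpM2r.
have phm : `|Re h| <= m by rewrite lerDl.
have qhm : `|Im h| <= m by rewrite lerDr.
have DrE u : Dr u = expR (Re a * u) *
   (cos (Im a * u) * (expR (Re h * u) * cos (Im h * u) - 1 - Re h * u)
    - sin (Im a * u) * (expR (Re h * u) * sin (Im h * u) - Im h * u)).
  rewrite /Dr /e_re /e_im; case: (a) (h) => [x y] [p q] /=.
  rewrite !mulrDl expRD cosD; ring.
have DiE u : Di u = expR (Re a * u) *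
   (sin (Im a * u) * (expR (Re h * u) * cos (Im h * u) - 1 - Re h * u)
    + cos (Im a * u) * (expR (Re h * u) * sin (Im h * u) - Im h * u)).
  rewrite /Di /e_re /e_im; case: (a) (h) => [x y] [p q] /=.
  rewrite !mulrDl expRD sinD; ring.
have t1 u := cexp_taylor_re (hum _ u phm) (hum _ u qhm).
have t2 u := cexp_taylor_im (hum _ u phm) (hum _ u qhm).
have two (c s A B' T : R) : `|c| <= 1 -> `|s| <= 1 -> `|A| <= 2 * T -> `|B'| <= 2 * T ->
    `|c * A| + `|s * B'| <= 4 * T.
  move=> c1 s1 HA HB; rewrite !normrM.
  have := ler_pM (normr_ge0 c) (normr_ge0 A) c1 HA.
  have := ler_pM (normr_ge0 s) (normr_ge0 B') s1 HB.
  lra.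
have bDr u : `|Dr u * rho u| <= m ^+ 2 * (M * B u).
  apply: bound => //; rewrite DrE normrM (ger0_norm (expR_ge0 _)) mulrC.
  rewrite ler_wpM2r ?expR_ge0// -mulrA; apply: (le_trans (ler_normB _ _)).
  by apply: two; rewrite ?cos_max ?sin_max// mulrA; [exact: t1|exact: t2].
have bDi u : `|Di u * rho u| <= m ^+ 2 * (M * B u).
  apply: bound => //; rewrite DiE normrM (ger0_norm (expR_ge0 _)) mulrC.
  rewrite ler_wpM2r ?expR_ge0// -mulrA; apply: (le_trans (ler_normD _ _)).
  by apply: two; rewrite ?cos_max ?sin_max// mulrA; [exact: t1|exact: t2].
have ZL (k : R) (f : R -> R) : mu.-integrable setT (EFin \o f) ->
    mu.-integrable setT (EFin \o (fun u => k * f u)).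
  by move=> jf; exact: (integrableZl _ k jf).
have AD (f g : R -> R) : mu.-integrable setT (EFin \o f) ->
    mu.-integrable setT (EFin \o g) ->
    mu.-integrable setT (EFin \o (fun u => f u + g u)).
  by move=> jf jg; exact: (integrableD measurableT jf jg).
have SB (f g : R -> R) : mu.-integrable setT (EFin \o f) ->
    mu.-integrable setT (EFin \o g) ->
    mu.-integrable setT (EFin \o (fun u => f u - g u)).
  by move=> jf jg; exact: (integrableB measurableT jf jg).
have ir := integrable_e_re drho ab; have ii := integrable_e_im drho ab.
have irh := integrable_e_re drho ahb; have iih := integrable_e_im drho ahb.
have jr := integrable_e_re dnd ab; have ji := integrable_e_im dnd ab.
have IB (F : R -> R) : (forall u, `|F u| <= m ^+ 2 * (M * B u)) ->
    mu.-integrable setT (EFin \o F) ->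
    `|\int[mu]_u F u| <= m ^+ 2 * \int[mu]_u (M * B u).
  move=> HF iF; apply: (le_trans (le_normr_Rintegral measurableT iF)).
  rewrite -RintegralZl//; last exact: (ZL _ _ iB).
  apply: le_Rintegral => //; first exact: (integrable_norm iF).
  exact: (ZL _ _ (ZL _ _ iB)).
have Er : \int[mu]_u (Dr u * rho u) =
   \int[mu]_u (e_re (a + h) u * rho u) - \int[mu]_u (e_re a u * rho u) -
   (Re h * \int[mu]_u (e_re a u * (u * rho u)) - Im h * \int[mu]_u (e_im a u * (u * rho u))).
  rewrite -!RintegralZl// -!RintegralB//; try by do ?[exact: (ZL _ _ _)|apply: (SB _ _ _ _)].
  by apply: eq_Rintegral => u _; rewrite /Dr; ring.
have Ei : \int[mu]_u (Di u * rho u) =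
   \int[mu]_u (e_im (a + h) u * rho u) - \int[mu]_u (e_im a u * rho u) -
   (Re h * \int[mu]_u (e_im a u * (u * rho u)) + Im h * \int[mu]_u (e_re a u * (u * rho u))).
  rewrite -!RintegralZl// -RintegralD//; try exact: (ZL _ _ _).
  rewrite -!RintegralB//; try by do ?[exact: (ZL _ _ _)|apply: (SB _ _ _ _)|apply: (AD _ _ _ _)].
  by apply: eq_Rintegral => u _; rewrite /Di; ring.
have iDr : mu.-integrable setT (EFin \o (fun u => Dr u * rho u)).
  have -> : (fun u => Dr u * rho u) = (fun u => (e_re (a + h) u * rho u - e_re a u * rho u) -
    (Re h * (e_re a u * (u * rho u)) - Im h * (e_im a u * (u * rho u)))).
    by apply/funext => u; rewrite /Dr; ring.
  by apply: (SB _ _ _ _); apply: (SB _ _ _ _) => //; exact: (ZL _ _ _).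
have iDi : mu.-integrable setT (EFin \o (fun u => Di u * rho u)).
  have -> : (fun u => Di u * rho u) = (fun u => (e_im (a + h) u * rho u - e_im a u * rho u) -
    (Re h * (e_im a u * (u * rho u)) + Im h * (e_re a u * (u * rho u)))).
    by apply/funext => u; rewrite /Di; ring.
  by apply: (SB _ _ _ _); [exact: (SB _ _ iih ii)|apply: (AD _ _ _ _); exact: (ZL _ _ _)].
have -> : laplace rho (a + h) - laplace rho a - h * laplace (fun u => u * rho u) a =
   (\int[mu]_u (Dr u * rho u)) +i* (\int[mu]_u (Di u * rho u)).
  rewrite Er Ei /laplace.
  by case: (h) => p q /=; simpc.
apply: (le_trans (normc_le_abs _)); rewrite lecR /=.
rewrite (_ : K * m ^+ 2 = m ^+ 2 * (\int[mu]_u (M * B u)) + m ^+ 2 * (\int[mu]_u (M * B u))).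
  by apply: lerD; exact: IB.
by rewrite /K; ring.
Qed.

Lemma laplace_dominated_cvg b (rho_ : nat -> R -> R) rho g a :
  decay b g -> Re a < b ->
  (forall n, measurable_fun setT (rho_ n)) ->
  (forall u, rho_^~ u @ \oo --> rho u) ->
  (forall n u, `|rho_ n u| <= g u) ->
  ((fun n => laplace (rho_ n) a) : nat -> CC R) @ \oo --> (laplace rho a : CC R).
Proof.
move=> dg ab mrho crho rhog.
have key (h : R -> R) : measurable_fun setT h ->
    mu.-integrable setT (EFin \o (fun u => `|h u| * g u)) ->
    (fun n => \int[mu]_u (h u * rho_ n u)) @ \oo --> \int[mu]_u (h u * rho u).
  move=> mh ig.
  have H := @dominated_cvg _ _ R mu setT measurableT
    (fun n => EFin \o (fun u => h u * rho_ n u)) (EFin \o (fun u => h u * rho u))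
    (EFin \o (fun u => `|h u| * g u)).
  have im n : measurable_fun setT (EFin \o (fun u => h u * rho_ n u)).
    by apply/measurable_EFinP; exact: measurable_funM.
  have ic u : setT u -> (EFin (h u * rho_ n u) @[n --> \oo] --> (EFin (h u * rho u))).
    move=> _; have cc : (fun n => h u * rho_ n u) @ \oo --> h u * rho u.
      by apply: cvgM; [exact: cvg_cst|exact: crho].
    by apply: cvg_comp cc _; exact: cvg_id.
  have idom n u : setT u -> (`|(h u * rho_ n u)%R%:E| <= (EFin \o (fun u => `|h u| * g u)%R) u)%E.
    by move=> _; rewrite /= lee_fin normrM ler_wpM2l.
  have ifin u : setT u -> (EFin \o (fun u => `|h u| * g u)) u \is a fin_num by [].
  have {}H := H im ic ifin ig idom.
  have iL n : mu.-integrable setT (EFin \o (fun u => h u * rho_ n u)).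
    apply: (le_integrable measurableT _ _ ig); first exact: im.
    move=> u _ /=.
    have g0 : 0 <= g u by exact: le_trans (normr_ge0 _) (rhog 0%N u).
    by rewrite lee_fin [leRHS]ger0_norm ?normrM ?mulr_ge0// ler_wpM2l.
  have iLim : mu.-integrable setT (EFin \o (fun u => h u * rho u)).
    have iml : measurable_fun setT (EFin \o (fun u => h u * rho u)).
      exact: (emeasurable_fun_cvg (fun n => EFin \o (fun u => h u * rho_ n u)) _ im).
    apply: (le_integrable measurableT _ _ ig); first exact: iml.
    move=> u _ /=.
    have g0 : 0 <= g u by exact: le_trans (normr_ge0 _) (rhog 0%N u).
    rewrite lee_fin [leRHS]ger0_norm ?normrM ?mulr_ge0// ler_wpM2l//.
    have cn : (fun n => `|rho_ n u|) @ \oo --> `|rho u| by apply: cvg_norm; exact: crho.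
    rewrite -(cvg_lim _ cn)//; apply: limr_le; first by apply/cvg_ex; eexists; exact: cn.
    by near=> n; exact: rhog.
  rewrite /Rintegral; apply: fine_cvg.
  by rewrite fineK//; exact: integrable_fin_num.
apply: cvg_complex.
- apply: key; first exact: (continuous_measurable_fun (@continuous_e_re _ a)).
  apply: (decay_integrable dg ab) => [|u]; last by rewrite normr_id norm_e_re.
  by apply: measurableT_comp => //; exact: (continuous_measurable_fun (@continuous_e_re _ a)).
- apply: key; first exact: (continuous_measurable_fun (@continuous_e_im _ a)).
  apply: (decay_integrable dg ab) => [|u]; last by rewrite normr_id norm_e_im.
  by apply: measurableT_comp => //; exact: (continuous_measurable_fun (@continuous_e_im _ a)).
Unshelve. all: by end_near. Qed.

Definition half_exp (c u : R) : R := if 0 <= u then expR (- c * u) else 0.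

Lemma half_expE c : half_exp c = (fun u => expR (- c * u)) \_ `[0, +oo[.
Proof.
apply/funext => u; rewrite /half_exp patchE.
by rewrite mem_setE in_itv/= andbT.
Qed.

Lemma decay_half_exp c : decay c (half_exp c).
Proof.
split.
  rewrite half_expE; apply/measurable_restrict => //.
  by apply: measurable_funTS; exact: measurable_expRM.
move=> x xc; exists 1 => u; rewrite /half_exp.
case: ifPn => u0; last by rewrite normr0 mulr0.
rewrite ger0_norm ?expR_ge0// -expRD -mulrDl -expR0 ler_expR.
by rewrite mulr_le0_ge0// subr_le0 ltW.
Qed.

(** For b = a - c the derivative of e^{bu} is b e^{bu}; hence b times the
    integral over the half-line is -1. *)
Lemma laplace_half_exp c a : Re a < c -> laplace (half_exp c) a = (c%:C - a)^-1.
Proof.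
move=> ac; pose b := a - c%:C.
have bE : b = (Re a - c) +i* Im a by rewrite /b; case: (a) => x y; simpc.
have dh := decay_half_exp c.
have Ir : \int[mu]_u (e_re a u * half_exp c u) = \int[mu]_(u in `[0, +oo[) e_re b u.
  rewrite [RHS]Rintegral_mkcond half_expE; apply: eq_Rintegral => u _.
  rewrite !patchE; case: ifP => _; last by rewrite mulr0.
  by rewrite bE /e_re /= mulrAC -expRD -mulrDl.
have Ii : \int[mu]_u (e_im a u * half_exp c u) = \int[mu]_(u in `[0, +oo[) e_im b u.
  rewrite [RHS]Rintegral_mkcond half_expE; apply: eq_Rintegral => u _.
  rewrite !patchE; case: ifP => _; last by rewrite mulr0.
  by rewrite bE /e_im /= mulrAC -expRD -mulrDl.
have jr : mu.-integrable `[0, +oo[ (EFin \o e_re b).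
  have := integrable_e_re dh ac; rewrite (_ : (fun u => _) = e_re b \_ `[0, +oo[).
    rewrite -restrict_EFin => /integrable_restrict; rewrite setTI; exact.
  apply/funext => u; rewrite half_expE !patchE; case: ifP => _; last by rewrite mulr0.
  by rewrite bE /e_re /= mulrAC -expRD -mulrDl.
have ji : mu.-integrable `[0, +oo[ (EFin \o e_im b).
  have := integrable_e_im dh ac; rewrite (_ : (fun u => _) = e_im b \_ `[0, +oo[).
    rewrite -restrict_EFin => /integrable_restrict; rewrite setTI; exact.
  apply/funext => u; rewrite half_expE !patchE; case: ifP => _; last by rewrite mulr0.
  by rewrite bE /e_im /= mulrAC -expRD -mulrDl.
have b0 : Re b < 0 by rewrite bE /= subr_lt0.
have key (F f : R -> R) : (forall u, `|F u| <= expR (Re b * u)) ->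
    (forall u : R, is_derive u 1 F (f u)) -> continuous f ->
    mu.-integrable `[0, +oo[ (EFin \o f) -> \int[mu]_(u in `[0, +oo[) f u = - F 0.
  move=> HF dF cf jf.
  apply: (@integral_derivative_exhaustion _ _ (fun=> 0) (fun n => n.+1%:R) F) => //.
  - by move=> n u /=; rewrite !in_itv/= => /andP[->].
  - move=> u /=; rewrite in_itv/= andbT => u0; near=> n.
    rewrite u0 /=; near: n.
    by exists (Num.truncn u).+1 => // n /= un; apply/ltW/(lt_le_trans (truncnS_gt _));
      rewrite ler_nat; exact: leqW.
  - rewrite -[X in _ --> X]add0r; apply: cvgB; last exact: cvg_cst.
    apply: (@cvg_squeeze0 _ _ (fun n => expR (- (- Re b * n.+1%:R)))).
      by move=> n; rewrite mulNr opprK.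
    have := @cvg_expR_neg R (- Re b); rewrite oppr_gt0 => /(_ b0).
    by rewrite -(cvg_shiftS (fun n : nat => expR (- (- Re b * n%:R)))).
have mitv : measurable (`[0, +oo[%classic : set R) by [].
have ZL (k : R) (f : R -> R) : mu.-integrable `[0, +oo[ (EFin \o f) ->
    mu.-integrable `[0, +oo[ (EFin \o (fun u => k * f u)).
  by move=> jf; exact: (integrableZl _ k jf).
have AD (f g : R -> R) : mu.-integrable `[0, +oo[ (EFin \o f) ->
    mu.-integrable `[0, +oo[ (EFin \o g) ->
    mu.-integrable `[0, +oo[ (EFin \o (fun u => f u + g u)).
  by move=> jf jg; have := integrableD _ jf jg; apply.
have cr := @continuous_e_re R b; have ci := @continuous_e_im R b.
have K1 := key (e_re b) (fun u => Re b * e_re b u + - Im b * e_im b u) (norm_e_re b).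
have {}K1 : Re b * \int[mu]_(u in `[0, +oo[) e_re b u - Im b * \int[mu]_(u in `[0, +oo[) e_im b u = -1.
  rewrite -mulNr -!RintegralZl// -RintegralD//; try exact: (ZL _ _ _).
  apply: (etrans (K1 _ _ _)); last by rewrite /e_re !mulr0 expR0 cos0 mulr1.
  - by move=> u; rewrite mulNr; exact: is_derive_e_re.
  - by move=> u; apply: cvgD; (apply: cvgM; [exact: cvg_cst|]); [exact: cr|exact: ci].
  - by apply: (AD _ _ _ _); exact: (ZL _ _ _).
have K2 := key (e_im b) (fun u => Re b * e_im b u + Im b * e_re b u) (norm_e_im b).
have {}K2 : Re b * \int[mu]_(u in `[0, +oo[) e_im b u + Im b * \int[mu]_(u in `[0, +oo[) e_re b u = 0.
  rewrite -!RintegralZl// -RintegralD//; try exact: (ZL _ _ _).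
  apply: (etrans (K2 _ _ _)); last by rewrite /e_im !mulr0 expR0 sin0 mulr0 oppr0.
  - by move=> u; exact: is_derive_e_im.
  - by move=> u; apply: cvgD; (apply: cvgM; [exact: cvg_cst|]); [exact: ci|exact: cr].
  - by apply: (AD _ _ _ _); exact: (ZL _ _ _).
have bn0 : c%:C - a != 0.
  rewrite subr_eq0; apply/eqP => ca; move: ac; rewrite -ca /= ltxx//.
apply: (mulfI bn0); rewrite mulfV// -opprB -/b /laplace Ir Ii.
move: K1 K2; rewrite bE /=; set I1 := Rintegral _ _ _; set I2 := Rintegral _ _ _.
move=> K1 K2; simpc; apply/eqP; rewrite eq_complex /=; apply/andP; split; apply/eqP; lra.
Unshelve. all: by end_near. Qed.

End laplace_analysis.

(** * The Gamma function as the transform of the Gumbel distribution *)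

Section gumbel.
Variable R : realType.
Local Notation mu := (@lebesgue_measure R).
Implicit Types (rho : R -> R) (u v x c : R) (a b : R[i]).
Local Notation Re := complex.Re.
Local Notation Im := complex.Im.

(** This is e^{-t} at t = e^{-u}; as a function of u it is the distribution
    function of the Gumbel law. *)
Definition gumbel u : R := expR (- expR (- u)).
Definition gumbel_pdf u : R := expR (- 1 * u) * gumbel u.

Lemma gumbel_ge0 u : 0 <= gumbel u. Proof. exact: expR_ge0. Qed.

Lemma gumbel_le1 u : gumbel u <= 1.
Proof. by rewrite -[leRHS]expR0 ler_expR oppr_le0 expR_ge0. Qed.

Lemma is_derive_gumbel u : is_derive u 1 gumbel (gumbel_pdf u).
Proof.
rewrite /gumbel_pdf /gumbel; apply: is_derive_eq.
by rewrite /GRing.scale /= mulN1r; ring.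
Qed.

Lemma continuous_gumbel : continuous gumbel.
Proof.
move=> u; apply: differentiable_continuous.
by apply/derivable1_diffP; have [] := is_derive_gumbel u.
Qed.

Lemma continuous_gumbel_pdf : continuous gumbel_pdf.
Proof.
move=> u; apply: cvgM; [exact: continuous_expRM|exact: continuous_gumbel].
Qed.

(** With t = e^{-u} >= 1 this is the bound t^M e^{-t} <= M^M, which follows from
    e^{t/M} >= t/M. *)
Lemma gumbel_left x : exists C, forall u, u <= 0 -> expR (x * u) * gumbel u <= C.
Proof.
(* Any M >= -x makes e^{xu} at most t^M. *)
pose M := (Num.truncn (- x)).+1.
have M0 : 0 < M%:R :> R by rewrite ltr0n.
have xM : - x <= M%:R by apply/ltW/truncnS_gt.
exists (M%:R ^+ M) => u u0.
have H : (expR (- u) / M%:R) ^+ M <= expR (expR (- u)).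
  have -> : expR (expR (- u)) = expR (expR (- u) / M%:R) ^+ M.
    by rewrite -expRM_natl mulrC divfK// gt_eqF.
  rewrite lerXn2r ?nnegrE ?divr_ge0 ?expR_ge0//.
  by have := expR_ge1Dx (expR (- u) / M%:R); lra.
rewrite /gumbel expRN ler_pdivrMr ?expR_gt0//.
apply: (@le_trans _ _ (M%:R ^+ M * (expR (- u) / M%:R) ^+ M)); last first.
  by rewrite ler_wpM2l ?exprn_ge0.
rewrite -exprMn mulrCA mulfV ?gt_eqF// mulr1 -expRM_natl ler_expR.
have : (- x - M%:R) * (- u) <= 0 by rewrite mulr_le0_ge0//; lra.
lra.
Qed.

Lemma gumbel_decay_cond rho (beta C : R) : measurable_fun setT rho ->
  (forall u, u < 0 -> `|rho u| <= C * gumbel u) ->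
  (forall u, 0 <= u -> `|rho u| <= C * expR (- beta * u)) ->
  decay beta rho.
Proof.
move=> mrho Hl Hr; split=> // x xb; have [K HK] := gumbel_left x.
have C0 : 0 <= C.
  have := Hr 0 (lexx _); rewrite mulr0 expR0 mulr1; exact: le_trans.
exists (Num.max (C * K) C) => u; have [u0|u0] := leP 0 u; rewrite le_max.
- apply/orP; right; apply: (le_trans (ler_wpM2l (expR_ge0 _) (Hr u u0))).
  rewrite mulrCA -expRD -mulrDl ler_piMr// -[leRHS]expR0 ler_expR.
  by rewrite mulr_le0_ge0//; lra.
- apply/orP; left; apply: (le_trans (ler_wpM2l (expR_ge0 _) (Hl u u0))).
  by rewrite mulrCA ler_wpM2l// HK// ltW.
Qed.

Lemma measurable_gumbel : measurable_fun setT gumbel.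
Proof. exact: continuous_measurable_fun continuous_gumbel. Qed.

Lemma decay_gumbel : decay 0 gumbel.
Proof.
apply: (@gumbel_decay_cond _ 0 1 measurable_gumbel) => u u0.
  by rewrite mul1r ger0_norm ?gumbel_ge0.
by rewrite oppr0 mul0r expR0 mulr1 ger0_norm ?gumbel_ge0 ?gumbel_le1.
Qed.

Lemma decay_gumbel_pdf : decay 1 gumbel_pdf.
Proof. by have := decay_expM 1 decay_gumbel; rewrite add0r. Qed.

(** Substituting t = e^{-u} in Euler's integral shows that this is Gamma(-b). *)
Definition gammaN b : R[i] := laplace gumbel b.

Lemma laplace_gumbel_pdf a : laplace gumbel_pdf a = gammaN (a - 1).
Proof. by rewrite /gumbel_pdf laplace_expM. Qed.

(** The functional equation Gamma(z + 1) = z Gamma(z) for z = -b. *)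
Lemma gammaN_sub1 b : Re b < 0 -> gammaN (b - 1) = - b * gammaN b.
Proof.
move=> b0; rewrite -laplace_gumbel_pdf.
apply: (laplace_derive decay_gumbel _ is_derive_gumbel continuous_gumbel_pdf b0).
by apply: decayW decay_gumbel_pdf.
Qed.

Lemma gammaN_subn b n : Re b < 0 ->
  gammaN (b - n%:R) = (\prod_(i < n) (i%:R - b)) * gammaN b.
Proof.
move=> b0; elim: n => [|n IHn]; first by rewrite big_ord0 mul1r subr0.
rewrite -natr1 opprD addrA gammaN_sub1; last first.
  case: b b0 {IHn} => x y /= x0; rewrite -(rmorph_nat (real_complex R)) /=.
  by have : 0 <= n%:R :> R by []; lra.
by rewrite IHn big_ord_recr /= opprB mulrA [X in X * _ = _]mulrC.
Qed.

Definition gammaNr x : R := \int[mu]_u (expR (x * u) * gumbel u).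

Lemma gammaN_real x : gammaN x%:C = (gammaNr x)%:C.
Proof.
rewrite /gammaN /laplace; apply/eqP; rewrite eq_complex /=; apply/andP; split.
  apply/eqP; apply: eq_Rintegral => u _.
  by rewrite /e_re /= mul0r cos0 mulr1.
rewrite (_ : Rintegral _ _ _ = \int[mu]_u (cst 0 u)).
  by rewrite Rintegral_cst// mul0r.
by apply: eq_Rintegral => u _; rewrite /e_im /= mul0r sin0 mulr0 mul0r.
Qed.

Lemma gammaNr_sub1 x : x < 0 -> gammaNr (x - 1) = - x * gammaNr x.
Proof.
move=> x0; have := @gammaN_sub1 x%:C x0.
rewrite (_ : x%:C - 1 = (x - 1)%:C); last by rewrite rmorphB rmorph1.
by rewrite !gammaN_real => /(congr1 (@complex.Re R)) /= ->; ring.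
Qed.

Lemma integrable_gumbel x : x < 0 ->
  mu.-integrable setT (EFin \o (fun u => expR (x * u) * gumbel u)).
Proof.
move=> x0; apply: (decay_integrable decay_gumbel x0); first exact: measurable_expRM.
by move=> u; rewrite ger0_norm ?expR_ge0.
Qed.

Lemma gammaNr_gt0 x : x < 0 -> 0 < gammaNr x.
Proof.
move=> x0; have dh := @decay_half_exp R 0.
have H : laplace (half_exp 0) x%:C = ((- x)^-1)%:C.
  by rewrite laplace_half_exp//= sub0r -rmorphN fmorphV.
have {}H : \int[mu]_u (expR (x * u) * half_exp 0 u) = (- x)^-1.
  have := congr1 (@complex.Re R) H; rewrite /laplace /= => <-.
  by apply: eq_Rintegral => u _; rewrite /e_re /= mul0r cos0 mulr1.
have ih : mu.-integrable setT (EFin \o (fun u => expR (x * u) * half_exp 0 u)).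
  apply: (decay_integrable dh x0); first exact: measurable_expRM.
  by move=> u; rewrite ger0_norm ?expR_ge0.
apply: (@lt_le_trans _ _ (expR (- 1) * (- x)^-1)).
  by rewrite mulr_gt0 ?expR_gt0// invr_gt0 oppr_gt0.
rewrite -H -RintegralZl//; apply: le_Rintegral => //.
- exact: (integrableZl _ _ ih).
- exact: integrable_gumbel.
move=> u _; rewrite mulrCA ler_wpM2l ?expR_ge0// /half_exp.
case: ifPn => u0; last by rewrite mulr0 gumbel_ge0.
rewrite oppr0 mul0r expR0 mulr1 ler_expR lerN2.
by rewrite -[leRHS]expR0 ler_expR oppr_le0.
Qed.

Lemma sqr_le_cosh v : v ^+ 2 <= 4 * (expR v - 2 + expR (- v)).
Proof.
suff H (w : R) : 0 <= w -> w ^+ 2 <= 4 * (expR w - 2 + expR (- w)).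
  have [v0|/ltW v0] := leP 0 v; first exact: H.
  have := H (- v); rewrite oppr_ge0 => /(_ v0); rewrite sqrrN opprK; lra.
move=> w0.
have E1 : expR w = expR (w / 2) ^+ 2 by rewrite expr2 -expRD -splitr.
have E2 : expR (- w) = expR (- (w / 2)) ^+ 2.
  by rewrite expr2 -expRD -opprD -splitr.
have E3 : expR (w / 2) * expR (- (w / 2)) = 1 by rewrite -expRD subrr expR0.
have h1 := expR_ge1Dx (w / 2).
have h2 : expR (- (w / 2)) <= 1.
  by rewrite -[leRHS]expR0 ler_expR oppr_le0 divr_ge0.
rewrite E1 E2; set p := expR (w / 2) in E3 h1 *; set q := expR (- (w / 2)) in E3 h2 *.
have -> : p ^+ 2 - 2 + q ^+ 2 = (p - q) ^+ 2 by rewrite sqrrB E3; ring.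
have d : w / 2 <= p - q by lra.
have d0 : 0 <= w / 2 by rewrite divr_ge0.
have := ler_pM d0 d0 d d; rewrite -!expr2; nra.
Qed.

(** Let G be a variable with the Gamma law of parameter X = -x. Up to a unimodular
    factor, Gamma(X - iy) / Gamma(X) has real part E cos(y log(G / X)), and
    E log(G / X)^2 is at most 4 E(G/X - 2 + X/G) = 4/(X - 1). So the real part is
    positive when X is large compared with y^2. *)
Lemma gammaN_neq0_far x (y : R) : 1 + 4 * y ^+ 2 < - x -> gammaN (x +i* y) != 0.
Proof.
move=> Hx; set X := - x in Hx.
have X1 : 1 < X by have := sqr_ge0 y; lra.
have X0 : 0 < X by lra.
have xE : x = - X by rewrite /X opprK.
have x0 : x < 0 by lra.
have x1 : x + 1 < 0 by lra.
have x2 : x - 1 < 0 by lra.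
have G0 := gammaNr_gt0 x0.
have F1 : gammaNr (x - 1) = X * gammaNr x by rewrite gammaNr_sub1.
have F2 : gammaNr x = (X - 1) * gammaNr (x + 1).
  by have := gammaNr_sub1 x1; rewrite addrK /X => ->; ring.
(* The centre c makes e^{-c} the mean X of the Gamma law. *)
pose c := - ln X.
have ec : expR (- c) = X by rewrite /c opprK lnK// posrE.
have ec' : expR c = X^-1 by rewrite /c expRN lnK// posrE.
apply/eqP => H0.
have ir := @integrable_e_re R 0 gumbel (x +i* y) decay_gumbel x0.
have ii := @integrable_e_im R 0 gumbel (x +i* y) decay_gumbel x0.
have [A0 B0] : \int[mu]_u (e_re (x +i* y) u * gumbel u) = 0 /\
    \int[mu]_u (e_im (x +i* y) u * gumbel u) = 0 by case: H0.
have i0 := integrable_gumbel x0; have i1 := integrable_gumbel x1.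
have i2 := integrable_gumbel x2.
have ZL (k : R) (f : R -> R) : mu.-integrable setT (EFin \o f) ->
    mu.-integrable setT (EFin \o (fun u => k * f u)).
  by move=> jf; exact: (integrableZl _ k jf).
have AD (f g : R -> R) : mu.-integrable setT (EFin \o f) ->
    mu.-integrable setT (EFin \o g) ->
    mu.-integrable setT (EFin \o (fun u => f u + g u)).
  by move=> jf jg; exact: (integrableD measurableT jf jg).
have L : \int[mu]_u ((1 + 8 * y ^+ 2) * (expR (x * u) * gumbel u) +
      ((- (4 * y ^+ 2) * expR (- c)) * (expR ((x + 1) * u) * gumbel u) +
       (- (4 * y ^+ 2) * expR c) * (expR ((x - 1) * u) * gumbel u)))
   <= \int[mu]_u (cos (y * c) * (e_re (x +i* y) u * gumbel u) +
          sin (y * c) * (e_im (x +i* y) u * gumbel u)).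
  apply: le_Rintegral => //.
  - apply: (AD _ _ (ZL _ _ i0)); exact: (AD _ _ (ZL _ _ i1) (ZL _ _ i2)).
  - exact: (AD _ _ (ZL _ _ ir) (ZL _ _ ii)).
  move=> u _; rewrite /e_re /e_im /=.
  have -> : cos (y * c) * (expR (x * u) * cos (y * u) * gumbel u) +
      sin (y * c) * (expR (x * u) * sin (y * u) * gumbel u) =
      expR (x * u) * gumbel u * cos (y * (u - c)).
    by rewrite mulrBr cosB; ring.
  have -> : expR ((x + 1) * u) = expR (x * u) * expR u by rewrite -expRD mulrDl mul1r.
  have -> : expR ((x - 1) * u) = expR (x * u) * expR (- u) by rewrite -expRD mulrBl mul1r.
  have h1 := abs_cos_sub1_le (y * (u - c)).
  have h2 := sqr_le_cosh (u - c).
  have E1 : expR (u - c) = expR u * expR (- c) by rewrite -expRD.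
  have E2 : expR (- (u - c)) = expR (- u) * expR c by rewrite -expRD opprB addrC.
  rewrite E1 E2 in h2.
  set W := expR (x * u) * gumbel u.
  have W0 : 0 <= W by rewrite mulr_ge0 ?expR_ge0 ?gumbel_ge0.
  have h3 : 1 - y ^+ 2 * (4 * (expR u * expR (- c) - 2 + expR (- u) * expR c)) <=
      cos (y * (u - c)).
    have := ler_wpM2l (sqr_ge0 y) h2; rewrite exprMn in h1.
    by move: h1; rewrite ler_norml => /andP[h1 _]; lra.
  apply: le_trans (ler_wpM2l W0 h3).
  by rewrite le_eqVlt; apply/orP; left; apply/eqP; rewrite /W; ring.
rewrite !RintegralD// in L;
  try by first [exact: (ZL _ _ i0)|exact: (ZL _ _ i1)|exact: (ZL _ _ i2)
    |exact: (ZL _ _ ir)|exact: (ZL _ _ ii)|exact: (AD _ _ (ZL _ _ i1) (ZL _ _ i2))].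
rewrite !RintegralZl// A0 B0 !mulr0 addr0 -!/(gammaNr _) in L.
rewrite ec ec' F1 in L.
have F3 : gammaNr (x + 1) = gammaNr x / (X - 1).
  by rewrite F2 mulrC mulKf// gt_eqF// subr_gt0.
rewrite F3 in L.
have : gammaNr x * (1 - 4 * y ^+ 2 / (X - 1)) <= 0.
  apply: le_trans L; rewrite le_eqVlt; apply/orP; left; apply/eqP; field.
  by rewrite subr_eq0 !gt_eqF.
rewrite pmulr_rle0// subr_le0 ler_pdivlMr ?subr_gt0// mul1r; lra.
Qed.

(** By the functional equation a zero would propagate along b - n, into the region
    covered by gammaN_neq0_far. *)
Lemma gammaN_neq0 b : Re b < 0 -> gammaN b != 0.
Proof.
move=> b0; apply/eqP => Eb0.
pose n := (Num.truncn (1 + 4 * (Im b) ^+ 2)).+1.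
have n0 : 1 + 4 * (Im b) ^+ 2 < n%:R by exact: truncnS_gt.
have := gammaN_subn n b0; rewrite Eb0 mulr0; apply/eqP.
have -> : b - n%:R = (Re b - n%:R) +i* Im b.
  rewrite -(rmorph_nat (real_complex R)); case: (b) => p q /=; simpc.
  by rewrite ?subr0.
by apply: gammaN_neq0_far; lra.
Qed.

(** Subtracting gumbel cancels the constant 1 at t = 0, which moves the half-plane of
    convergence from Re a < 0 to Re a < 1. *)
Definition gumbel_diff c u : R := gumbel (u - c) - gumbel u.

Lemma gumbel_homo u v : u <= v -> gumbel u <= gumbel v.
Proof. by move=> uv; rewrite ler_expR lerN2 ler_expR lerN2. Qed.

Lemma gumbel_diff_le0 c u : 0 <= c -> gumbel_diff c u <= 0.
Proof. by move=> c0; rewrite subr_le0 gumbel_homo// lerBlDr lerDl. Qed.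

Lemma decay_gumbel_diff c : 0 <= c -> decay 1 (gumbel_diff c).
Proof.
move=> c0; have ec : 1 <= expR c by rewrite -[leLHS]expR0 ler_expR.
apply: (@gumbel_decay_cond _ 1 (expR c)).
- apply: measurable_funB; last exact: measurable_gumbel.
  apply: (@measurableT_comp _ _ _ _ _ _ gumbel) => //; first exact: measurable_gumbel.
  exact: measurable_funB.
- move=> u _; rewrite ler0_norm ?gumbel_diff_le0// opprB.
  apply: (@le_trans _ _ (gumbel u)); first by rewrite lerBlDr lerDl gumbel_ge0.
  by rewrite ler_peMl ?gumbel_ge0.
- move=> u _; rewrite ler0_norm ?gumbel_diff_le0// opprB.
  apply: (@le_trans _ _ (1 - gumbel (u - c))); first by rewrite lerD2r gumbel_le1.
  rewrite -expRD (_ : c + - 1 * u = - (u - c)); last by ring.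
  by have := expR_ge1Dx (- expR (- (u - c))); rewrite -/(gumbel (u - c)); lra.
Qed.

(** For c = ln n this represents n^a. It is integration by parts, combined with
    the translation u - c, which multiplies the transform of gumbel_pdf by e^{ac}. *)
Lemma laplace_gumbel_diff a c : 0 <= c -> Re a < 1 ->
  cexp (a * c%:C) * gammaN (a - 1) =
  gammaN (a - 1) - a * laplace (gumbel_diff c) a.
Proof.
move=> c0 a1.
have dsh := decay_shift c decay_gumbel_pdf.
have dd : decay 1 (fun u => gumbel_pdf (u - c) - gumbel_pdf u).
  exact: decayB dsh decay_gumbel_pdf.
have cc : continuous (fun u => gumbel_pdf (u - c) - gumbel_pdf u).
  move=> u; apply: cvgB; last exact: continuous_gumbel_pdf.
  apply: (@continuous_comp _ _ _ (fun u => u - c) gumbel_pdf).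
    by apply: cvgB; [exact: cvg_id|exact: cvg_cst].
  exact: continuous_gumbel_pdf.
have dv u : is_derive u 1 (gumbel_diff c) (gumbel_pdf (u - c) - gumbel_pdf u).
  rewrite /gumbel_diff /gumbel /gumbel_pdf /gumbel; apply: is_derive_eq.
  by rewrite /GRing.scale /= !mulN1r; ring.
have := laplace_derive (decay_gumbel_diff c0) dd dv cc a1.
rewrite (laplaceB dsh decay_gumbel_pdf a1).
rewrite (laplace_shift _ decay_gumbel_pdf continuous_gumbel_pdf a1).
rewrite laplace_gumbel_pdf mulNr => /eqP; rewrite subr_eq => /eqP ->.
by rewrite addrC.
Qed.

End gumbel.

(** * Meromorphic continuation *)

Section holomorphy.
Variable R : realType.
Implicit Types (f g : R[i] -> R[i]) (z w : R[i]).
Local Notation Re := complex.Re.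
Local Notation Im := complex.Im.

Lemma complex_differentiable_cst (c : R[i]) z : complex_differentiable (fun=> c) z.
Proof. exact: derivable_cst. Qed.

Lemma complex_differentiable_id z : complex_differentiable id z.
Proof. exact: derivable_id. Qed.

Lemma complex_differentiableD f g z : complex_differentiable f z ->
  complex_differentiable g z -> complex_differentiable (fun w => f w + g w) z.
Proof. exact: derivableD. Qed.

Lemma complex_differentiableB f g z : complex_differentiable f z ->
  complex_differentiable g z -> complex_differentiable (fun w => f w - g w) z.
Proof. exact: derivableB. Qed.

Lemma complex_differentiableM f g z : complex_differentiable f z ->
  complex_differentiable g z -> complex_differentiable (fun w => f w * g w) z.
Proof. exact: derivableM. Qed.

Lemma complex_differentiableV f z : f z != 0 -> complex_differentiable f z ->
  complex_differentiable (fun w => (f w)^-1) z.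
Proof. exact: derivableV. Qed.

Lemma complex_differentiable_comp_subr f c z : complex_differentiable f (z - c) ->
  complex_differentiable (fun w => f (w - c)) z.
Proof.
rewrite /complex_differentiable /derivable /=; set X := (X in cvg (X @ _)).
set Y := (Y in _ -> cvg (Y @ _)); rewrite (_ : Y = X)//.
by apply/funext => h; rewrite /X /Y /= addrA.
Qed.

Lemma complex_differentiable_sum (I : Type) (r : seq I) (P : pred I) (F : I -> R[i] -> R[i]) z :
  (forall i, P i -> complex_differentiable (F i) z) ->
  complex_differentiable (fun w => \sum_(i <- r | P i) F i w) z.
Proof.
move=> HF; elim: r => [|i r IHr].
  have -> : (fun w => \sum_(i <- [::] | P i) F i w) = fun=> 0.
    by apply/funext => w; rewrite big_nil.
  exact: complex_differentiable_cst.
have -> : (fun w => \sum_(j <- i :: r | P j) F j w) =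
    (fun w => (if P i then F i w else 0) + \sum_(j <- r | P j) F j w).
  by apply/funext => w; rewrite big_cons; case: ifP; rewrite ?add0r.
apply: (@complex_differentiableD (fun w => if P i then F i w else 0)
  (fun w => \sum_(j <- r | P j) F j w)); last exact: IHr.
by case Pi: (P i); [exact: HF|exact: complex_differentiable_cst].
Qed.

Lemma complex_differentiable_prod (I : Type) (r : seq I) (P : pred I) (F : I -> R[i] -> R[i]) z :
  (forall i, P i -> complex_differentiable (F i) z) ->
  complex_differentiable (fun w => \prod_(i <- r | P i) F i w) z.
Proof.
move=> HF; elim: r => [|i r IHr].
  have -> : (fun w => \prod_(i <- [::] | P i) F i w) = fun=> 1.
    by apply/funext => w; rewrite big_nil.
  exact: complex_differentiable_cst.
have -> : (fun w => \prod_(j <- i :: r | P j) F j w) =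
    (fun w => (if P i then F i w else 1) * \prod_(j <- r | P j) F j w).
  by apply/funext => w; rewrite big_cons; case: ifP; rewrite ?mul1r.
apply: (@complex_differentiableM (fun w => if P i then F i w else 1)
  (fun w => \prod_(j <- r | P j) F j w)); last exact: IHr.
by case Pi: (P i); [exact: HF|exact: complex_differentiable_cst].
Qed.

Lemma near_Re_lt z (x : R) : Re z < x -> \forall w \near (z : CC R), Re w < x.
Proof.
move=> zx.
have e0 : 0 < (x - Re z)%:C :> R[i] by rewrite ltcR subr_gt0.
apply/nbhs_normP; exists (x - Re z)%:C => // w /=.
rewrite distrC => zw; have := le_lt_trans (abs_Re_le _) zw.
rewrite ltcR; case: (w) (z) => [p q] [p' q'] /= H.
by have := ler_norm (p - p'); lra.
Qed.

Lemma near_neq (z p : R[i]) : p != z -> \forall w \near (z : CC R), p != w.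
Proof.
move=> pz.
have e0 : 0 < `|z - p| by rewrite normr_gt0 subr_eq0 eq_sym.
apply/nbhs_normP; exists `|z - p| => // w /= zw.
by apply: contraTneq zw => <-; rewrite ltxx.
Qed.

Lemma complex_differentiable_continuous f z : complex_differentiable f z ->
  {for z, continuous (f : CC R -> CC R)}.
Proof.
by move=> Hf; apply: differentiable_continuous; apply/derivable1_diffP.
Qed.

Lemma complex_differentiable_subr c z : complex_differentiable (fun w => w - c) z.
Proof.
apply: (@complex_differentiableB (fun w => w) (fun=> c)).
  exact: complex_differentiable_id.
exact: complex_differentiable_cst.
Qed.

Lemma complex_differentiable_expr_subr m c z :
  complex_differentiable (fun w => (w - c) ^+ m) z.
Proof.
elim: m => [|m IHm].
  have -> : (fun w => (w - c) ^+ 0) = (fun=> 1 : R[i]).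
    by apply/funext => w; rewrite expr0.
  exact: complex_differentiable_cst.
have -> : (fun w => (w - c) ^+ m.+1) = (fun w : R[i] => (w - c) * (w - c) ^+ m).
  by apply/funext => w; rewrite exprS.
apply: (@complex_differentiableM (fun w => w - c) (fun w => (w - c) ^+ m)); last exact: IHm.
exact: complex_differentiable_subr.
Qed.

Lemma holomorphic_at_continuous f z : holomorphic_at f z ->
  {for z, continuous (f : CC R -> CC R)}.
Proof.
by move=> /nbhs_singleton; exact: complex_differentiable_continuous.
Qed.

(** At a pole of order m, f(w) (w - z)^m has a nonzero limit; if f is continuous at
    z, that limit is 0. *)
Lemma holomorphic_not_pole f z : holomorphic_at f z -> ~ pole f z.
Proof.
move=> /nbhs_singleton df [m [m0 [g [/holomorphic_at_continuous cg gz fg]]]].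
have c1 : (fun w : CC R => f w * (w - z) ^+ m : CC R) @ (z : CC R)^' --> (0 : CC R).
  have -> : (0 : CC R) = f z * (z - z) ^+ m.
    by rewrite subrr expr0n gtn_eqF// mulr0.
  have H := complex_differentiable_continuous
    (complex_differentiableM df (@complex_differentiable_expr_subr m z z)).
  by apply: cvg_trans H; apply: cvg_app; exact: nbhs_dnbhs.
have c2 : (fun w : CC R => f w * (w - z) ^+ m : CC R) @ (z : CC R)^' --> (g z : CC R).
  have cg' : (g : CC R -> CC R) @ (z : CC R)^' --> (g z : CC R).
    by apply: cvg_trans cg; apply: cvg_app; exact: nbhs_dnbhs.
  apply: cvg_trans cg'; apply: near_eq_cvg; near=> w.
  have wz : w != z by near: w; exact: (nbhs_dnbhs_neq (z : CC R)).
  have -> : f w = g w / (w - z) ^+ m by near: w; exact: fg.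
  by rewrite divfK// expf_neq0// subr_eq0.
have : g z = 0 by apply: (cvg_unique _ c2 c1).
by apply/eqP.
Unshelve. all: by end_near. Qed.

(** Near a given point at most one fraction is singular, because the points
    pt i are distinct; all others join the holomorphic part. *)
Lemma partial_fractions (x : R) (A f : R[i] -> R[i]) (I : finType) (P : pred I)
    (B : I -> R[i] -> R[i]) (pt : I -> R[i]) :
  (forall w, Re w < x -> complex_differentiable A w) ->
  (forall i w, Re w < x -> complex_differentiable (B i) w) ->
  (forall i, P i -> Re (pt i) < x -> B i (pt i) != 0) -> injective pt ->
  (forall w, f w = A w + \sum_(i | P i) B i w / (w - pt i)) ->
  forall z, Re z < x ->
  holomorphic_at f z \/ (simple_pole f z /\ exists2 i, P i & z = pt i).
Proof.
move=> dA dB Bn0 pt_inj fE z zx.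
have dF (Q : pred I) w : Re w < x -> (forall i, P i && Q i -> pt i != w) ->
    complex_differentiable
      (fun w => A w + \sum_(i | P i && Q i) B i w / (w - pt i)) w.
  move=> wx Hw; apply: (@complex_differentiableD A
    (fun w => \sum_(i | P i && Q i) B i w / (w - pt i))); first exact: dA.
  apply: (@complex_differentiable_sum _ _ _ (fun i w => B i w / (w - pt i))) => i Pi.
  apply: (@complex_differentiableM (B i) (fun w => (w - pt i)^-1)); first exact: dB.
  apply: (@complex_differentiableV (fun w => w - pt i)).
    by rewrite subr_eq0 eq_sym; exact: Hw.
  exact: complex_differentiable_subr.
have nearF (Q : pred I) : (forall i, P i && Q i -> pt i != z) ->
    holomorphic_at (fun w => A w + \sum_(i | P i && Q i) B i w / (w - pt i)) z.
  move=> Hz; have H1 : \forall w \near (z : CC R), forall i, P i && Q i -> pt i != w.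
    have FF : Filter (nbhs (z : CC R)) by exact: nbhs_filter.
    apply: (@filter_forall _ _ (fun i w => P i && Q i -> pt i != w) _ FF) => i.
    by apply: filter_imply => PQ; exact: near_neq (Hz i PQ).
  have H2 := near_Re_lt zx.
  near=> w; apply: dF; [by near: w; exact: H2|by near: w; exact: H1].
have [[i0 Pi0 zi0]|Hz] := pselect (exists2 i, P i & pt i = z); last first.
  left; have := nearF predT; rewrite (_ : (fun w => _) = f).
    apply=> i /andP[Pi _]; apply/eqP => piz; apply: Hz; by exists i.
  apply/funext => w; rewrite fE; congr (_ + _).
  by apply: eq_bigl => i; rewrite andbT.
right; split; last by exists i0.
split=> //.
pose F0 w := A w + \sum_(i | P i && (i != i0)) B i w / (w - pt i).
have hF0 : holomorphic_at F0 z.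
  apply: nearF => i /andP[Pi ii0]; apply: contra ii0 => /eqP piz.
  by apply/eqP/pt_inj; rewrite piz.
exists (fun w => (w - z) * F0 w + B i0 w); split.
- have H2 := near_Re_lt zx; near=> w.
  have wx : Re w < x by near: w; exact: H2.
  have dF0 : complex_differentiable F0 w by near: w; exact: hF0.
  apply: (@complex_differentiableD (fun w => (w - z) * F0 w) (B i0)); last exact: dB.
  apply: (@complex_differentiableM (fun w => w - z) F0); last exact: dF0.
  exact: complex_differentiable_subr.
- by rewrite subrr mul0r add0r -zi0 Bn0// zi0.
- near=> w.
  have wz : w != z by near: w; exact: (nbhs_dnbhs_neq (z : CC R)).
  have wz0 : w - z != 0 by rewrite subr_eq0.
  rewrite expr1 mulrDl mulrAC mulfV// mul1r fE (bigD1 i0)//= zi0 /F0.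
  by rewrite -addrA; congr (_ + _); rewrite addrC.
Unshelve. all: by end_near. Qed.

End holomorphy.

(** The analytic part depends on the tree only through the numbers pi_n, their
    generating function Y and its expansion. *)
Section continuation.
Variables (R : realType) (pi_ : nat -> R) (Y : R -> R) (k : nat) (D : {poly R}) (C : R).
Local Notation Re := complex.Re.
Local Notation Im := complex.Im.
Implicit Types (a z w : R[i]) (u : R).
Hypothesis k_ge3 : (3 <= k)%N.
Hypothesis pi_ge0 : forall n, 0 <= pi_ n.
Hypothesis pi0 : pi_ 0%N = 0.
Hypothesis pi_le1 : forall n, series pi_ n <= 1.
Hypothesis Y_series : forall t, 0 < t ->
  series (fun n => pi_ n * expR (- t) ^+ n) @ \oo --> Y t.
Hypothesis Y_expansion : forall s, 0 < s <= 1 ->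
  `|Y (s ^+ 2) - expR (- s ^+ 2) - s * D.[s]| <= C * s ^+ k.-1.

Let C_ge0 : 0 <= C.
Proof.
have := @Y_expansion 1; rewrite ltr01 lexx => /(_ erefl).
by rewrite (expr1n _ k.-1) mulr1; apply: le_trans.
Qed.

Let D_bound : exists2 K, 0 <= K & forall s, 0 < s <= 1 -> `|D.[s]| <= K.
Proof.
exists (\sum_(i < size D) `|D`_i|); first exact: sumr_ge0.
move=> s /andP[s0 s1]; rewrite horner_coef; apply: (le_trans (ler_norm_sum _ _ _)).
apply: ler_sum => i _; rewrite normrM ler_piMr// normrX exprn_ile1//.
by rewrite gtr0_norm.
Qed.

Let Y_near1 : exists2 K, 0 <= K & forall s, 0 < s <= 1 ->
  `|Y (s ^+ 2) - expR (- s ^+ 2)| <= K * s.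
Proof.
have [K K0 HK] := D_bound; exists (K + C); first by rewrite addr_ge0.
move=> s s01; have /andP[s0 s1] := s01.
rewrite -(subrK (s * D.[s]) (Y (s ^+ 2) - expR (- s ^+ 2))).
apply: (le_trans (ler_normD _ _)); rewrite addrC mulrDl lerD//.
  by rewrite normrM (gtr0_norm s0) mulrC ler_wpM2r ?HK// ltW.
apply: (le_trans (Y_expansion s01)); rewrite ler_wpM2l//.
rewrite -[leRHS]expr1 ler_wiXn2l// ?(ltW s0)//.
by case: (k) k_ge3 => [|[|]].
Qed.

Let nd_series (f : nat -> R) : (forall n, 0 <= f n) -> nondecreasing_seq (series f).
Proof. by move=> f0; apply/nondecreasing_series => i _ _. Qed.

Let Y_le t : 0 < t -> 0 <= Y t <= expR (- t).
Proof.
move=> t0; have q0 : 0 <= expR (- t) := expR_ge0 _.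
have q1 : expR (- t) <= 1 by rewrite -[leRHS]expR0 ler_expR oppr_le0 ltW.
have c := cvgP _ (Y_series t0); apply/andP; split.
  rewrite -(cvg_lim _ (Y_series t0))//; apply: limr_ge => //; near=> n.
  by apply: sumr_ge0 => i _; rewrite mulr_ge0 ?exprn_ge0.
rewrite -(cvg_lim _ (Y_series t0))//; apply: limr_le => //; near=> n.
apply: (@le_trans _ _ (expR (- t) * series pi_ n)); last by rewrite ler_piMr.
rewrite /series /= mulr_sumr; apply: ler_sum => -[|i] _.
  by rewrite pi0 !(mul0r, mulr0).
rewrite mulrC ler_wpM2r// exprS ler_piMr// exprn_ile1//.
Unshelve. all: by end_near. Qed.

(** The tree is almost surely finite: the expansion forces Y(t) -> 1 as t -> 0, and
    Y(t) is at most the sum of the pi_n. *)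
Lemma size_sum1 : series pi_ @ \oo --> (1 : R).
Proof.
have nd := nd_series pi_ge0.
have c : cvgn (series pi_).
  by apply: nondecreasing_is_cvgn => //; exists 1 => _ [n _ <-].
suff -> : (1 : R) = limn (series pi_) by [].
apply/eqP; rewrite eq_le; apply/andP; split; last first.
  by apply: limr_le => //; near=> n; exact: pi_le1.
have [K K0 HK] := Y_near1.
have H s : 0 < s <= 1 -> 1 - (1 + K) * s <= limn (series pi_).
  move=> s01; have /andP[s0 s1] := s01; have s2 : 0 < s ^+ 2 by rewrite exprn_gt0.
  apply: (@le_trans _ _ (Y (s ^+ 2))).
    have := HK s s01; rewrite ler_norml => /andP[h1 _].
    have h2 := expR_ge1Dx (- s ^+ 2).
    have h3 : s ^+ 2 <= s by rewrite expr2 ler_piMr// ltW.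
    lra.
  rewrite -(cvg_lim _ (Y_series s2))//; apply: limr_le; first exact: cvgP (Y_series s2).
  near=> n; apply: (@le_trans _ _ (series pi_ n)).
    apply: ler_sum => i _; rewrite ler_piMr// exprn_ile1 ?expR_ge0//.
    by rewrite -[leRHS]expR0 ler_expR oppr_le0 ltW.
  exact: nondecreasing_cvgn_le.
apply/ler_addgt0Pr => e e0.
pose s := Num.min 1 (e / (1 + K)).
have K1 : 0 < 1 + K by lra.
have s0 : 0 < s by rewrite lt_min ltr01 divr_gt0.
have s1 : s <= 1 by rewrite ge_min lexx.
have := H s; rewrite s0 s1 => /(_ erefl).
have : (1 + K) * s <= e by rewrite mulrC -ler_pdivlMr// ge_min lexx orbT.
lra.
Unshelve. all: by end_near. Qed.

Let phi u : R := Y (expR (- u)).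
Let psi u : R := phi u - gumbel u.

Let gumbel_ln (n : nat) u : (0 < n)%N -> gumbel (u - ln n%:R) = expR (- expR (- u)) ^+ n.
Proof.
move=> n0; rewrite /gumbel opprB expRD lnK ?posrE ?ltr0n// -expRM_natl.
by rewrite mulrN.
Qed.

Let sum1E (F : nat -> R) M : \sum_(1 <= n < M) pi_ n * F n = series (fun n => pi_ n * F n) M.
Proof.
case: M => [|M]; first by rewrite /series /= !big_geq.
by rewrite /series /= [RHS]big_ltn// pi0 mul0r add0r.
Qed.

Let S M u : R := \sum_(1 <= n < M) pi_ n * gumbel_diff (ln n%:R) u.

Let S_cvg u : S^~ u @ \oo --> psi u.
Proof.
have -> : S^~ u = (fun M => series (fun n => pi_ n * expR (- expR (- u)) ^+ n) M
    - series pi_ M * gumbel u).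
  apply/funext => M.
  have -> : series pi_ M = \sum_(1 <= n < M) pi_ n * 1.
    by rewrite sum1E; congr (series _ M); apply/funext => n; rewrite mulr1.
  rewrite -sum1E mulr_suml -sumrB /S big_nat [RHS]big_nat.
  apply: eq_bigr => n /andP[n0 _].
  by rewrite /gumbel_diff gumbel_ln// mulrBr mulr1.
rewrite /psi -[gumbel u in X in _ --> X]mul1r; apply: cvgB.
  by apply: Y_series; exact: expR_gt0.
by apply: cvgM; [exact: size_sum1|exact: cvg_cst].
Qed.

Let ln_nat_ge0 n : (0 < n)%N -> 0 <= ln n%:R :> R.
Proof. by move=> n0; rewrite ln_ge0// (ler_nat _ 1). Qed.

(** All summands have the same sign, so the partial sums are dominated by
    their limit. *)
Let S_le M u : `|S M u| <= - psi u.
Proof.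
have nd : nondecreasing_seq (fun M => - S M u).
  apply/nondecreasing_seqP => n; rewrite lerN2 /S.
  case: n => [|n]; first by rewrite !big_geq.
  rewrite big_nat_recr//= gerDl mulr_ge0_le0// gumbel_diff_le0// ln_nat_ge0//.
have := nondecreasing_cvgn_le nd (cvgP _ (cvgN (@S_cvg u))) M.
rewrite (cvg_lim _ (cvgN (@S_cvg u)))// => H.
have S0 : S M u <= 0.
  rewrite -oppr_ge0 /S -sumrN big_nat; apply: sumr_ge0 => n /andP[n0 _].
  by rewrite oppr_ge0 mulr_ge0_le0// gumbel_diff_le0// ln_nat_ge0.
by rewrite ler0_norm; [exact: H|exact: S0].
Qed.

Let measurable_S M : measurable_fun setT (S M).
Proof.
apply: measurable_sum => n; apply: measurable_funM => //.
apply: measurable_funB; last exact: measurable_gumbel.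
apply: (@measurableT_comp _ _ _ _ _ _ (@gumbel R)) => //; first exact: measurable_gumbel.
exact: measurable_funB.
Qed.

Let measurable_psi : measurable_fun setT psi.
Proof. by apply: (measurable_fun_cvg measurable_S) => u _; exact: S_cvg. Qed.

Let psi_left u : `|psi u| <= gumbel u.
Proof.
have /andP[h1 h2] := Y_le (expR_gt0 (- u)).
rewrite /psi /phi ler_norml; have := gumbel_ge0 u; rewrite /gumbel in h2 *.
by move=> h3; apply/andP; split; lra.
Qed.

Let s_of u : R := expR (- (2^-1) * u).

Let s_of01 u : 0 <= u -> 0 < s_of u <= 1.
Proof.
by move=> u0; rewrite expR_gt0 -[leRHS]expR0 ler_expR mulr_le0_ge0.
Qed.

Let s_ofX u n : s_of u ^+ n = expR (- (n%:R / 2) * u).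
Proof. by rewrite /s_of -expRM_natl; congr expR; ring. Qed.

Let s_of2 u : s_of u ^+ 2 = expR (- u).
Proof. by rewrite s_ofX; congr expR; field. Qed.

Let decay_psi : decay (2^-1) psi.
Proof.
have [K K0 HK] := Y_near1.
apply: (@gumbel_decay_cond _ psi _ (1 + K)) => // u u0.
  apply: (le_trans (psi_left u)).
  by rewrite ler_peMl ?gumbel_ge0// lerDl.
apply: (@le_trans _ _ (K * s_of u)).
  have := HK _ (s_of01 u0); rewrite s_of2; exact.
by rewrite ler_wpM2r ?expR_ge0// lerDr.
Qed.

Let decay_S M : decay 1 (S M).
Proof.
elim: M => [|[|M] IHM].
- have -> : S 0 = fun=> 0 by apply/funext => u; rewrite /S big_geq.
  exact: decay0.
- have -> : S 1 = fun=> 0 by apply/funext => u; rewrite /S big_geq.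
  exact: decay0.
have -> : S M.+2 = fun u => S M.+1 u + pi_ M.+1 * gumbel_diff (ln M.+1%:R) u.
  by apply/funext => u; rewrite /S big_nat_recr.
by apply: decayD => //; apply: decayZ; apply: decay_gumbel_diff; exact: ln_nat_ge0.
Qed.

Let laplace_S M a : Re a < 1 ->
  gammaN (a - 1) * \sum_(1 <= n < M) npow n a * (pi_ n)%:C =
  (\sum_(1 <= n < M) pi_ n)%:C * gammaN (a - 1) - a * laplace (S M) a.
Proof.
move=> a1.
have base : laplace (fun=> 0) a = 0 :> R[i].
  have H := laplaceZ 0 (@decay0 R 1) a1; rewrite [RHS]mul0r in H.
  by rewrite -H; apply: eq_laplace => u; rewrite mul0r.
elim: M => [|[|M] IHM].
- have -> : S 0 = fun=> 0 by apply/funext => u; rewrite /S big_geq.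
  by rewrite !big_geq// base !mulr0 mul0r subr0.
- have -> : S 1 = fun=> 0 by apply/funext => u; rewrite /S big_geq.
  by rewrite !big_geq// base !mulr0 mul0r subr0.
have -> : S M.+2 = fun u => S M.+1 u + pi_ M.+1 * gumbel_diff (ln M.+1%:R) u.
  by apply/funext => u; rewrite /S big_nat_recr.
have dM := decay_gumbel_diff (@ln_nat_ge0 M.+1 isT).
rewrite (laplaceD (decay_S M.+1) (decayZ _ dM) a1) (laplaceZ _ dM a1).
rewrite !(@big_nat_recr _ _ _ M.+1)//= mulrDr IHM rmorphD mulrDl.
have := laplace_gumbel_diff (@ln_nat_ge0 M.+1 isT) a1; rewrite -/(npow _ _).
rewrite [gammaN _ * (_ * _)]mulrA [gammaN _ * _]mulrC => ->.
ring.
Qed.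

Lemma mu_formula a : Re a < 2^-1 ->
  ((fun M => \sum_(1 <= n < M) npow n a * (pi_ n)%:C) : nat -> CC R) @ \oo -->
  (1 - a * laplace psi a / gammaN (a - 1) : CC R).
Proof.
move=> a2; have a1 : Re a < 1 by lra.
have g0 : gammaN (a - 1) != 0.
  by apply: gammaN_neq0; case: (a) a1 => x y /= ?; lra.
have cS : ((fun M => laplace (S M) a) : nat -> CC R) @ \oo --> (laplace psi a : CC R).
  apply: (@laplace_dominated_cvg _ (2^-1) S psi (fun u => - psi u)) => //.
  have := decayZ (-1) decay_psi; congr decay.
  by apply/funext => u; rewrite mulN1r.
have cP : ((fun M => (\sum_(1 <= n < M) pi_ n)%:C) : nat -> CC R) @ \oo --> (1 : CC R).
  apply: (@cvg_complex R (fun M => \sum_(1 <= n < M) pi_ n) (fun=> 0) 1 0); last exact: cvg_cst.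
  have -> : (fun M => \sum_(1 <= n < M) pi_ n) = series pi_; last exact: size_sum1.
  apply/funext => M.
  have := sum1E (fun=> 1) M; under eq_bigr do rewrite mulr1; move=> ->.
  by congr (series _ M); apply/funext => n; rewrite mulr1.
have E : (fun M => \sum_(1 <= n < M) npow n a * (pi_ n)%:C) =
    (fun M => (\sum_(1 <= n < M) pi_ n)%:C - a * laplace (S M) a / gammaN (a - 1)).
  apply/funext => M; apply: (mulfI g0); rewrite laplace_S//.
  by rewrite mulrBr [gammaN _ * (_ / _)]mulrC divfK// mulrC.
rewrite E; apply: (@cvgB _ _ _ _ _ (fun M => (\sum_(1 <= n < M) pi_ n)%:C : CC R)
  (fun M => a * laplace (S M) a / gammaN (a - 1) : CC R)); first exact: cP.
apply: (@cvgM _ _ _ _ (fun M => a * laplace (S M) a : CC R) (fun=> (gammaN (a - 1))^-1 : CC R)); last exact: cvg_cst.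
by apply: (@cvgM _ _ _ _ (fun=> a : CC R) (fun M => laplace (S M) a : CC R)); [exact: cvg_cst|exact: cS].
Qed.

Let beta : R := (k%:R - 1) / 2.
Let L := size D.
Let expo (j : nat) : R := j.+1%:R / 2.
Let P u : R := \sum_(j < L) D`_j * half_exp (expo j) u.
Let rho u : R := psi u - P u.

Let expo_ge j : 2^-1 <= expo j.
Proof.
by rewrite /expo -[leLHS]mul1r ler_wpM2r// (ler_nat _ 1).
Qed.

Let decay_term j : decay (2^-1) (half_exp (expo j)).
Proof. exact: decayW (expo_ge j) (@decay_half_exp R (expo j)). Qed.

Let decay_sum (I : Type) (r : seq I) (F : I -> R -> R) b :
  (forall i, decay b (F i)) -> decay b (fun u => \sum_(i <- r) F i u).
Proof.
move=> dF; elim: r => [|i r IHr].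
  have -> : (fun u => \sum_(i <- [::]) F i u) = fun=> 0.
    by apply/funext => u; rewrite big_nil.
  exact: decay0.
have -> : (fun u => \sum_(j <- i :: r) F j u) = (fun u => F i u + \sum_(j <- r) F j u).
  by apply/funext => u; rewrite big_cons.
exact: decayD.
Qed.

Let decay_P : decay (2^-1) P.
Proof. by apply: decay_sum => j; exact: decayZ. Qed.

Let laplace_P a : Re a < 2^-1 ->
  laplace P a = \sum_(j < L) (D`_j)%:C / ((expo j)%:C - a).
Proof.
move=> a2; rewrite /P; move: (index_enum _) => r.
elim: r => [|j r IHr].
  rewrite big_nil (@eq_laplace _ _ (fun u => 0 * 0)); last first.
    by move=> u; rewrite big_nil mul0r.
  by rewrite (laplaceZ 0 (@decay0 R (2^-1)) a2) mul0r.
rewrite big_cons -IHr -(laplace_half_exp (lt_le_trans a2 (expo_ge j))).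
rewrite -(laplaceZ _ (decay_term j) a2) -(laplaceD (decayZ _ (decay_term j)) _ a2).
  by apply: eq_laplace => u; rewrite big_cons.
by apply: decay_sum => i; exact: decayZ.
Qed.

(** For u >= 0 this is the expansion, with s = e^{-u/2}; for u < 0 the fractional
    exponentials are cut off and only the rapidly decaying psi remains. *)
Let decay_rho : decay beta rho.
Proof.
apply: (@gumbel_decay_cond _ rho beta (1 + C)) => [|u u0|u u0].
- by apply: measurable_funB => //; exact: decay_P.1.
- have -> : rho u = psi u.
    rewrite /rho /P big1 ?subr0// => j _.
    by rewrite /half_exp leNgt u0 mulr0.
  apply: (le_trans (psi_left u)).
  by rewrite ler_peMl ?gumbel_ge0// lerDl.
have -> : rho u = Y (s_of u ^+ 2) - expR (- s_of u ^+ 2) - s_of u * D.[s_of u].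
  rewrite /rho /psi /phi s_of2; congr (_ - _ - _).
  rewrite horner_coef mulr_sumr; apply: eq_bigr => j _.
  by rewrite /half_exp u0 -s_ofX exprS mulrCA.
apply: (le_trans (Y_expansion (s_of01 u0))).
have -> : - beta * u = - (k.-1%:R / 2) * u.
  by rewrite /beta; case: (k) k_ge3 => //= k' _; rewrite -natr1 addrK.
rewrite -s_ofX ler_wpM2r ?exprn_ge0 ?expR_ge0// lerDr//.
Qed.

Let n := (k + L)%N.
(** G is Gamma(n + 1 - a), which is holomorphic and nonzero in the half-plane
    considered, and Q is the product of 1 - a, ..., n - a, so that
    Gamma(1 - a) = G / Q. For odd j, Qh j is Q without the factor that vanishes at the
    integer (j + 1)/2; this cancels the candidate pole there. *)
Let G a : R[i] := gammaN (a - (1 + n%:R)).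
Let Q a : R[i] := \prod_(i < n) (i%:R - (a - 1)).
Let Qh (j : nat) a : R[i] := \prod_(i < n | val i != j./2) (i%:R - (a - 1)).
Let pt (j : 'I_L) : R[i] := (expo j)%:C.
Let A a : R[i] := 1 - a / G a *
  (Q a * laplace rho a + \sum_(j < L | odd j) (D`_j)%:C * Qh j a).
Let B (j : 'I_L) a : R[i] := a / G a * (Q a * (D`_j)%:C).
Let f a : R[i] := A a +
  \sum_(j < L | ~~ odd j && (D`_j != 0)) B j a / (a - pt j).

Let k2 : beta < k%:R.
Proof.
have : 3 <= k%:R :> R by rewrite (ler_nat _ 3).
rewrite /beta; lra.
Qed.

Let Re_shift a : Re a < beta -> Re (a - (1 + n%:R)) < 0.
Proof.
move=> ab; have -> : Re (a - (1 + n%:R)) = Re a - (1 + n%:R).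
  by rewrite -(rmorph_nat (real_complex R)) -(rmorph1 (real_complex R)) -rmorphD; case: (a).
have : k%:R <= n%:R :> R by rewrite ler_nat leq_addr.
by have := k2; lra.
Qed.

Let G_neq0 a : Re a < beta -> G a != 0.
Proof. by move=> ab; apply: gammaN_neq0; exact: Re_shift. Qed.

Let G_diff a : Re a < beta -> complex_differentiable G a.
Proof.
move=> ab; apply: complex_differentiable_comp_subr.
exact: (laplace_holomorphic (@decay_gumbel R) (Re_shift ab)).
Qed.

Let beta_ge1 : 1 <= beta.
Proof.
have : 3 <= k%:R :> R by rewrite (ler_nat _ 3).
rewrite /beta; lra.
Qed.

Let GE a : Re a < 1 -> G a = Q a * gammaN (a - 1).
Proof.
move=> a1; rewrite /G opprD addrA gammaN_subn//.
by case: (a) a1 => x y /=; lra.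
Qed.

Let factor_diff (i : nat) a : complex_differentiable (fun a => i%:R - (a - 1)) a.
Proof.
apply: (@complex_differentiableB _ (fun=> i%:R) (fun a => a - 1)).
  exact: complex_differentiable_cst.
exact: complex_differentiable_subr.
Qed.

Let Q_diff a : complex_differentiable Q a.
Proof.
rewrite /Q; apply: (@complex_differentiable_prod _ _ _ _
  (fun (i : 'I_n) a => i%:R - (a - 1))) => i _.
exact: factor_diff.
Qed.

Let Qh_diff j a : complex_differentiable (Qh j) a.
Proof.
rewrite /Qh; apply: (@complex_differentiable_prod _ _ _ _
  (fun (i : 'I_n) a => i%:R - (a - 1))) => i _.
exact: factor_diff.
Qed.

Let aG_diff a : Re a < beta -> complex_differentiable (fun a => a / G a) a.
Proof.
move=> ab; apply: (@complex_differentiableM _ (fun a => a) (fun a => (G a)^-1)).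
  exact: complex_differentiable_id.
by apply: complex_differentiableV; [exact: G_neq0|exact: G_diff].
Qed.

Let A_diff a : Re a < beta -> complex_differentiable A a.
Proof.
move=> ab; rewrite /A; apply: (@complex_differentiableB _ (fun=> 1)
  (fun a => a / G a * (Q a * laplace rho a + \sum_(j < L | odd j) (D`_j)%:C * Qh j a))).
  exact: complex_differentiable_cst.
apply: (@complex_differentiableM _ (fun a => a / G a)
  (fun a => Q a * laplace rho a + \sum_(j < L | odd j) (D`_j)%:C * Qh j a)).
  exact: aG_diff.
apply: (@complex_differentiableD _ (fun a => Q a * laplace rho a)
  (fun a => \sum_(j < L | odd j) (D`_j)%:C * Qh j a)).
  apply: (@complex_differentiableM _ Q (laplace rho)); first exact: Q_diff.
  exact: laplace_holomorphic decay_rho ab.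
apply: (@complex_differentiable_sum R 'I_L (index_enum _) (fun j => odd j)
  (fun j a => (D`_j)%:C * Qh j a)) => j _.
apply: (@complex_differentiableM _ (fun=> (D`_j)%:C) (Qh j)); last exact: Qh_diff.
exact: complex_differentiable_cst.
Qed.

Let B_diff j a : Re a < beta -> complex_differentiable (B j) a.
Proof.
move=> ab; rewrite /B; apply: (@complex_differentiableM _ (fun a => a / G a)
  (fun a => Q a * (D`_j)%:C)); first exact: aG_diff.
apply: (@complex_differentiableM _ Q (fun=> (D`_j)%:C)); first exact: Q_diff.
exact: complex_differentiable_cst.
Qed.

Let natC (m : nat) : m%:R = (m%:R : R)%:C :> R[i].
Proof. by rewrite (rmorph_nat (real_complex R)). Qed.

(** Q vanishes only at integers, and for even j the point (j + 1)/2 is not one. *)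
Let B_neq0 (j : 'I_L) : ~~ odd j && (D`_j != 0) -> Re (pt j) < beta -> B j (pt j) != 0.
Proof.
move=> /andP[oj Dj] ptb.
have e0 : 0 < expo j by apply: lt_le_trans (expo_ge j).
rewrite /B !mulf_neq0 ?invr_neq0//.
- by rewrite /pt -(rmorph0 (real_complex R)) (inj_eq (@complexI R)) gt_eqF.
- exact: G_neq0.
- apply/prodf_neq0 => i _.
  have -> : i%:R - (pt j - 1) = (i%:R - (expo j - 1))%:C.
    by rewrite natC /pt !(rmorphB (real_complex R)) rmorph1.
  rewrite -(rmorph0 (real_complex R)) (inj_eq (@complexI R)).
  apply/eqP => H; have {}H : (2 * i.+1)%:R = j.+1%:R :> R.
    by move: H; rewrite /expo natrM -(natr1 i); lra.
  move/eqP: H; rewrite eqr_nat => /eqP H.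
  by move: oj; have := congr1 odd H; rewrite mul2n odd_double /= => <-.
- by rewrite -(rmorph0 (real_complex R)) (inj_eq (@complexI R)).
Qed.

Let pt_inj : injective pt.
Proof.
move=> i j /(@complexI R) /(mulIf _) H.
have {}H : i.+1%:R = j.+1%:R :> R by apply: H; rewrite invr_eq0.
by move/eqP: H; rewrite eqr_nat eqSS => /eqP/val_inj.
Qed.

Let Q_split (j : 'I_L) a : odd j -> Q a = ((expo j)%:C - a) * Qh j a.
Proof.
move=> oj; have jn : (j./2 < n)%N.
  have := ltn_ord j; rewrite /n -divn2; lia.
rewrite /Q (bigD1 (Ordinal jn))//=; congr (_ * _).
have -> : expo j = (j./2)%:R + 1.
  have : (j.+1 = 2 * (j./2).+1)%N by have := odd_double_half j; rewrite oj; lia.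
  by rewrite /expo => ->; rewrite natrM -natr1; field.
by rewrite rmorphD rmorph1 natC; ring.
Qed.

Let fE a : Re a < 2^-1 -> f a = 1 - a * laplace psi a / gammaN (a - 1).
Proof.
move=> a2; have a1 : Re a < 1 by lra.
have ab : Re a < beta by have := beta_ge1; lra.
have lpsi : laplace psi a = laplace rho a + \sum_(j < L) (D`_j)%:C / ((expo j)%:C - a).
  rewrite -laplace_P// -(laplaceD (decayW _ decay_rho) decay_P a2).
    by apply: eq_laplace => u; rewrite /rho subrK.
  by have := beta_ge1; lra.
have Gn0 := G_neq0 ab; have GEa := GE a1.
have Qn0 : Q a != 0 by apply: contraNneq Gn0 => Q0; rewrite GEa Q0 mul0r.
have gn0 : gammaN (a - 1) != 0.
  by apply: contraNneq Gn0 => g0; rewrite GEa g0 mulr0.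
have ptn0 j : (expo j)%:C - a != 0.
  rewrite subr_eq0; apply/eqP => Ea; have := expo_ge j.
  by move: a2; rewrite -Ea /= => h1 h2; lra.
have key : laplace psi a / gammaN (a - 1) = (G a)^-1 *
   (Q a * laplace rho a + \sum_(j < L) Q a * ((D`_j)%:C / ((expo j)%:C - a))).
  by rewrite -mulr_sumr -mulrDr -lpsi GEa; field; rewrite Qn0 gn0.
rewrite -mulrA key (bigID (fun j : 'I_L => odd j)) /= /f /A.
have -> : \sum_(j < L | odd j) Q a * ((D`_j)%:C / ((expo j)%:C - a)) =
    \sum_(j < L | odd j) (D`_j)%:C * Qh j a.
  by apply: eq_bigr => j oj; rewrite (Q_split _ oj); field; exact: ptn0.
have -> : \sum_(j < L | ~~ odd j) Q a * ((D`_j)%:C / ((expo j)%:C - a)) =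
    \sum_(j < L | ~~ odd j && (D`_j != 0)) Q a * ((D`_j)%:C / ((expo j)%:C - a)).
  rewrite [RHS]big_mkcondr /=; apply: eq_bigr => j _.
  by case: eqP => // ->; rewrite rmorph0 mul0r mulr0.
have -> : \sum_(j < L | ~~ odd j && (D`_j != 0)) B j a / (a - pt j) =
    - (a / G a * \sum_(j < L | ~~ odd j && (D`_j != 0)) Q a * ((D`_j)%:C / ((expo j)%:C - a))).
  rewrite mulr_sumr -sumrN; apply: eq_bigr => j _.
  by rewrite /B -[a - pt j]opprB invrN /pt; ring.
ring.
Qed.

Lemma meromorphic_continuation : exists F : R[i] -> R[i],
  (forall a, Re a < 2^-1 ->
    ((fun M => \sum_(1 <= n < M) npow n a * (pi_ n)%:C) : nat -> CC R) @ \oo -->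
    (F a : CC R)) /\
  (forall z, Re z < (k%:R - 1) / 2 -> holomorphic_at F z \/
    (simple_pole F z /\ exists j : nat, z = (j%:R + 2^-1)%:C)).
Proof.
exists f; split=> [a a2|z zb]; first by rewrite fE//; exact: mu_formula.
have [|[sp [j /andP[oj _] zj]]] := partial_fractions A_diff B_diff B_neq0 pt_inj (fun=> erefl) zb.
  by left.
right; split=> //; exists (j./2); rewrite zj /pt; congr (_%:C).
have : (j.+1 = 2 * j./2 + 1)%N by have := odd_double_half j; rewrite (negbTE oj); lia.
by rewrite /expo => ->; rewrite natrD natrM; field.
Qed.

End continuation.

Theorem theorem6p5 (R : realType)
    (d : measure_display) (T : measurableType d) (P : probability T R)
    (xi : {RV P >-> nat})
    (d' : measure_display) (T' : measurableType d') (P' : probability T' R)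
    (X : seq nat -> {RV P' >-> nat}) (k : nat)
    (Xindep : mutually_independent X)
    (Xdistr : forall u A, measurable A ->
      distribution P' (X u) A = distribution P xi A)
    (xi_mean : ('E_P[(fun w => (xi w)%:R : R)%R] = 1)%E)
    (xi_var : (0 < 'V_P[(fun w => (xi w)%:R : R)%R] < +oo)%E)
    (k_ge3 : (3 <= k)%N)
    (xi_moment : ('E_P[(fun w => (xi w)%:R ^+ k : R)%R] < +oo)%E) :
  exists f : R[i] -> R[i],
    [/\ forall a : R[i], complex.Re a < 2^-1 ->
          cvgn (mu_partial_sum X a) /\ f a = mu X a,
        meromorphic_on [set z : R[i] | complex.Re z < (k%:R - 1) / 2] f &
        forall z : R[i], complex.Re z < (k%:R - 1) / 2 -> pole f z ->
          simple_pole f z /\ exists j : nat, z = (j%:R + 2^-1)%:C].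
Proof.
pose p := offspring_prob xi.
have Xp u c : P' (X u @^-1` [set c]) = (p c)%:E.
  by rewrite /p -offspring_probE; exact: (Xdistr u [set c] I).
have p0 c : 0 <= p c by rewrite fine_ge0.
have p_sum1 : series p @ \oo --> (1 : R).
  by apply: cvg_series_nneseries => //; exact: offspring_sum1.
have p_mean1 : series (fun c => c%:R * p c) @ \oo --> (1 : R).
  apply: cvg_series_nneseries => [c|]; first by rewrite mulr_ge0.
  by rewrite -xi_mean (ge0_expectation_nat xi (g := fun c => c%:R)).
have p_moment : cvgn (series (fun c => c%:R ^+ k * p c)).
  have g0 c : 0 <= c%:R ^+ k :> R by rewrite exprn_ge0.
  move: xi_moment; rewrite (ge0_expectation_nat xi g0) => fin.
  apply/cvg_ex; eexists; apply: (@cvg_series_nneseries _ _ (fine (\sum_(c <oo) (c%:R ^+ k * p c)%:E)%E)).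
    by move=> c; rewrite mulr_ge0.
  rewrite fineK// ge0_fin_numE//; apply: nneseries_ge0 => c _ _.
  by rewrite lee_fin mulr_ge0.
have p_ge2 : exists2 c, (2 <= c)%N & 0 < p c.
  by apply: (offspring_ge2 xi_mean); have /andP[] := xi_var.
pose pi_ := gw_size_prob X.
have pi_ge0 n : 0 <= pi_ n := gw_size_prob_ge0 X n.
pose Y t : R := fine (\sum_(n <oo) (pi_ n * expR (- t) ^+ n)%:E)%E.
have YP t : 0 < t -> [/\ 0 <= Y t <= 1,
    series (fun n => pi_ n * expR (- t) ^+ n) @ \oo --> Y t &
    series (fun c => p c * Y t ^+ c) @ \oo --> expR t * Y t].
  move=> t0; have r01 : 0 <= expR (- t) <= 1.
    by rewrite expR_ge0 -[leRHS]expR0 ler_expR oppr_le0 ltW.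
  have [y [y01 yE yeq]] := gw_generating_eq Xindep Xp r01.
  have -> : Y t = y by rewrite /Y yE.
  split=> //.
    by apply: cvg_series_nneseries => // n; rewrite mulr_ge0 ?exprn_ge0 ?expR_ge0.
  have y0 := andP y01 => /=; case: y0 => y0 _.
  apply: cvg_series_nneseries => [c|]; first by rewrite mulr_ge0 ?exprn_ge0.
  rewrite EFinM -yeq muleA -EFinM -expRD subrr expR0 mul1e//.
have [D [C HD]] := puiseux_expansion p0 p_sum1 p_mean1 p_moment k_ge3 p_ge2
  (fun t t0 => let: And3 h _ _ := YP t t0 in h)
  (fun t t0 => let: And3 _ _ h := YP t t0 in h).
have [f [f_mu f_mero]] := meromorphic_continuation k_ge3 pi_ge0
  (gw_size_prob0 Xindep Xp) (gw_size_prob_sum_le1 Xindep Xp)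
  (fun t t0 => let: And3 _ h _ := YP t t0 in h) HD.
exists f; split.
- move=> a a2; have H := f_mu a a2; split; first by apply/cvg_ex; exists (f a : CC R).
  by rewrite /mu; apply/esym; apply: (@cvg_lim (CC R)) => //.
- move=> z zk; have [|[sp _]] := f_mero z zk; [by left|right].
  by exists 1%N.
- move=> z zk pz; have [hz|//] := f_mero z zk.
  by case: (holomorphic_not_pole hz pz).
Qed.
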